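(* For every $X\subseteq\{C,D,E,F,+,-,=,\equiv\}$, the model checking problem for the logic $\mathrm{L}_X$ (in particular for $\mathrm{L}_{CDEF+-=\equiv}$) is in P.
   Context: Fix countably infinite sets $\mathsf{P}$ (atomic propositions), $\mathsf{A}$ (agents) and $\mathsf{S}$ (epistemic skills). Formulas: $\phi ::= p \mid \neg\phi \mid (\phi\to\phi) \mid K_a\phi \mid C_G\phi \mid D_G\phi \mid E_G\phi \mid F_G\phi \mid (+_S)_a\phi \mid (-_S)_a\phi \mid (=_S)_a\phi \mid (\equiv_b)_a\phi$ with $p\in\mathsf{P}$, $a,b\in\mathsf{A}$, $G\subseteq\mathsf{A}$ finite nonempty, $S\subseteq\mathsf{S}$ finite nonempty. The basic language $\mathcal{L}$ has only atoms, $\neg$, $\to$, $K_a$; $\mathcal{L}_X$ adds exactly the operators named in $X$ ($C,D,E,F$ for $C_G,D_G,E_G,F_G$; $+,-,=,\equiv$ for $(+_S)_a,(-_S)_a,(=_S)_a,(\equiv_b)_a$); $\mathrm{L}_X$ is the corresponding logic. A model is $M=(W,E,C,\beta)$ with $W\neq\emptyset$, $E:W\times W\to\wp(\mathsf{S})$ symmetric with $E(w,u)=\mathsf{S}$ only if $w=u$, $C:\mathsf{A}\to\wp(\mathsf{S})$, $\beta:W\to\wp(\mathsf{P})$. Satisfaction: $M,w\models p$ iff $p\in\beta(w)$; Booleans as usual; $K_a\psi$ holds at $w$ iff $\psi$ holds at all $u$ with $C(a)\subseteq E(w,u)$; $E_G\psi$ iff $K_a\psi$ for all $a\in G$; $C_G\psi$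 iff $E_G^n\psi$ for all $n\ge1$; $D_G\psi$ iff $\psi$ at all $u$ with $\bigcup_{a\in G}C(a)\subseteq E(w,u)$; $F_G\psi$ iff $\psi$ at all $u$ with $\bigcap_{a\in G}C(a)\subseteq E(w,u)$; $(+_S)_a\psi$, $(-_S)_a\psi$, $(=_S)_a\psi$, $(\equiv_b)_a\psi$ hold at $w$ iff $\psi$ holds at $w$ in $(W,E,C',\beta)$ where $C'$ agrees with $C$ except that $C'(a)$ is respectively $C(a)\cup S$, $C(a)\setminus S$, $S$, $C(b)$. Model checking problem for $\mathrm{L}_X$: given a finite model (finite $W$, finite skill sets, $E$ listed as triples $(w,u,S)$, $C$ listed as pairs $(a,S)$ for a finite set of agents containing all agents in the formula, $\beta$ as pairs), a world $w$ and $\phi\in\mathcal{L}_X$, decide $M,w\models\phi$. Input size is $|\phi|+|M|+1$, with $|M|$ the number of worlds plus the number of symbols writing $E,C,\beta$, and $|\phi|$ the symbol count: $|p|=1$, $|\neg\psi|=|\psi|+1$, $|(\psi\to\chi)|=|\psi|+|\chi|+3$, $|K_a\psi|=|\psi|+2$, $|O_G\psi|=|\psi|+2|G|+2$, $|(\pm_S)_a\psi|=|(=_S)_a\psi|=|\psi|+2|S|+5$, $|(\equiv_b)_a\psi|=|\psi|+5$. *)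

(* Defs.v *)
From HB Require Import structures.
From mathcomp Require Import all_boot.
From mathcomp Require Import boolp classical_sets.

Set Implicit Arguments.
Unset Strict Implicit.
Unset Printing Implicit Defensive.

Local Open Scope classical_set_scope.

(** * Deterministic multi-tape Turing machines and the class P *)

Variant move := MoveLeft | Stay | MoveRight.

(* A cell holds an input symbol, an auxiliary symbol, or is blank ([None]).
   Tape 0 is the input tape. *)
Record machine (Sigma : finType) := Machine {
  state : finType;
  extra : finType;
  tapes : nat;
  start : state;
  accept : state;
  reject : state;
  accept_neq_reject : accept != reject;
  trans : state -> {ffun 'I_tapes.+1 -> option (Sigma + extra)} ->
          state * {ffun 'I_tapes.+1 -> option (Sigma + extra) * move}
}.

Section Runs.
Variables (Sigma : finType) (T : machine Sigma).

Definition cell := option (Sigma + extra T).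

(* A two-way infinite tape: the cells to the left of the head, nearest first,
   the scanned cell, and the cells to the right of the head, nearest first; all
   the cells beyond either list are blank. *)
Record tape := Tape { lefts : seq cell; scanned : cell; rights : seq cell }.

Definition write_move (t : tape) (cm : cell * move) : tape :=
  let: (c, m) := cm in
  match m with
  | MoveLeft => Tape (behead (lefts t)) (head None (lefts t)) (c :: rights t)
  | Stay => Tape (lefts t) c (rights t)
  | MoveRight => Tape (c :: lefts t) (head None (rights t)) (behead (rights t))
  end.

Record config := Config { cstate : state T; ctapes : 'I_(tapes T).+1 -> tape }.

Definition step (c : config) : config :=
  if (cstate c == accept T) || (cstate c == reject T) then c else
  let: (q, a) := trans (cstate c) [ffun i => scanned (ctapes c i)] in
  Config q (fun i => write_move (ctapes c i) (a i)).

Definition input_tape (s : seq Sigma) : tape :=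
  let cs : seq cell := [seq Some (inl c) | c <- s] in
  Tape [::] (head None cs) (behead cs).

Definition init (s : seq Sigma) : config :=
  Config (start T)
    (fun i => if i == ord0 then input_tape s else Tape [::] None [::]).

(* Halting configurations are fixpoints of [step], so this says that the
   machine halts in the state [q] after at most [t] steps. *)
Definition halts_within (s : seq Sigma) (t : nat) (q : state T) : Prop :=
  cstate (iter t step (init s)) = q.

End Runs.

Definition inP (Sigma : finType) (L : set (seq Sigma)) : Prop :=
  exists (T : machine Sigma) (c d : nat), forall s : seq Sigma,
    let t := (c * (size s).+1 ^ d)%N in
    (L s -> halts_within s t (accept T)) /\
    (~ L s -> halts_within s t (reject T)).

(** * Formulas *)

Variant op := OpC | OpD | OpE | OpF | OpAdd | OpSub | OpSet | OpCopy.

(* Finite sets of agents or skills are written as lists; [in_lang] below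
   requires these lists to be nonempty and without repetition. *)
Inductive formula (P A S : Type) :=
| Atom of P
| Neg of formula P A S
| Imp of formula P A S & formula P A S
| Know of A & formula P A S
| Common of seq A & formula P A S
| Distributed of seq A & formula P A S
| Everyone of seq A & formula P A S
| Field of seq A & formula P A S
| AddSkills of seq S & A & formula P A S
| SubSkills of seq S & A & formula P A S
| SetSkills of seq S & A & formula P A S
| CopySkills of A & A & formula P A S. (* [CopySkills b a phi] is (\equiv_b)_a phi *)

Definition nonempty_set (T : eqType) (l : seq T) : bool :=
  (l != [::]) && uniq l.

Section Formulas.
Variables P A S : eqType.
Implicit Types phi psi : formula P A S.

Fixpoint in_lang (X : {pred op}) phi : bool :=
  match phi with
  | Atom _ => true
  | Neg psi => in_lang X psi
  | Imp psi chi => in_lang X psi && in_lang X chi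
  | Know _ psi => in_lang X psi
  | Common G psi => [&& OpC \in X, nonempty_set G & in_lang X psi]
  | Distributed G psi => [&& OpD \in X, nonempty_set G & in_lang X psi]
  | Everyone G psi => [&& OpE \in X, nonempty_set G & in_lang X psi]
  | Field G psi => [&& OpF \in X, nonempty_set G & in_lang X psi]
  | AddSkills B _ psi => [&& OpAdd \in X, nonempty_set B & in_lang X psi]
  | SubSkills B _ psi => [&& OpSub \in X, nonempty_set B & in_lang X psi]
  | SetSkills B _ psi => [&& OpSet \in X, nonempty_set B & in_lang X psi]
  | CopySkills _ _ psi => (OpCopy \in X) && in_lang X psi
  end.

Fixpoint agents phi : seq A :=
  match phi with
  | Atom _ => [::]
  | Neg psi => agents psi
  | Imp psi chi => agents psi ++ agents chi
  | Know a psi => a :: agents psi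
  | Common G psi | Distributed G psi | Everyone G psi | Field G psi =>
      G ++ agents psi
  | AddSkills _ a psi | SubSkills _ a psi | SetSkills _ a psi => a :: agents psi
  | CopySkills b a psi => b :: a :: agents psi
  end.

Fixpoint fsize phi : nat :=
  match phi with
  | Atom _ => 1
  | Neg psi => fsize psi + 1
  | Imp psi chi => fsize psi + fsize chi + 3
  | Know _ psi => fsize psi + 2
  | Common G psi | Distributed G psi | Everyone G psi | Field G psi =>
      fsize psi + 2 * size G + 2
  | AddSkills B _ psi | SubSkills B _ psi | SetSkills B _ psi => fsize psi + 2 * size B + 5
  | CopySkills _ _ psi => fsize psi + 5
  end.

End Formulas.

(** * Models and satisfaction *)

Record model (P A S : Type) := Model {
  world :> eqType;
  world_inhabited : inhabited world;
  edge : world -> world -> set S;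
  edge_sym : forall w u, edge w u = edge u w;
  edge_full : forall w u, edge w u = setT -> w = u;
  cap : A -> set S;
  valuation : world -> set P
}.

Section Semantics.
Variables P A S : eqType.
Implicit Types (M : model P A S) (G : seq A).

Definition set_cap M (C : A -> set S) : model P A S :=
  Model (world_inhabited M) (@edge_sym _ _ _ M) (@edge_full _ _ _ M) C (@valuation _ _ _ M).

Definition upd_cap M (a : A) (B : set S) : model P A S :=
  set_cap M (fun b => if b == a then B else cap M b).

Definition box M (B : set S) (Q : set M) : set M :=
  [set w | forall u, B `<=` edge w u -> Q u].

Definition everyone M G (Q : set M) : set M :=
  [set w | forall a, a \in G -> box (cap M a) Q w].

Fixpoint sat M (w : M) (phi : formula P A S) {struct phi} : Prop :=
  match phi with
  | Atom p => valuation w p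
  | Neg psi => ~ sat w psi
  | Imp psi chi => sat w psi -> sat w chi
  | Know a psi => box (cap M a) [set u | sat u psi] w
  | Common G psi =>
      forall n, (1 <= n)%N -> iter n (everyone G) [set u | sat u psi] w
  | Distributed G psi =>
      box (\bigcup_(a in [set` G]) cap M a) [set u | sat u psi] w
  | Everyone G psi => everyone G [set u | sat u psi] w
  | Field G psi =>
      box (\bigcap_(a in [set` G]) cap M a) [set u | sat u psi] w
  | AddSkills B a psi => @sat (upd_cap M a (cap M a `|` [set` B])) w psi
  | SubSkills B a psi => @sat (upd_cap M a (cap M a `\` [set` B])) w psi
  | SetSkills B a psi => @sat (upd_cap M a [set` B]) w psi
  | CopySkills b a psi => @sat (upd_cap M a (cap M b)) w psi
  end.

End Semantics.

(** * Finite models given by lists *)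

Section Listings.
Variables P A S : eqType.

Record listing (W : eqType) := Listing {
  lworlds : seq W;
  ledges : seq (W * W * seq S);
  lcaps : seq (A * seq S);
  lvals : seq (W * seq P)
}.

(* [L] lists, in any order and without repetition, the worlds of [M], the
   graphs of [edge] and [valuation], and the graph of [cap] restricted to a finite
   set of agents; in particular [M] is finite. *)
Definition lists (M : model P A S) (L : listing M) : Prop :=
  [/\ uniq (lworlds L) /\ (forall w : M, w \in lworlds L),
      perm_eq (unzip1 (ledges L)) [seq (w, u) | w <- lworlds L, u <- lworlds L] /\
      (forall w u B, (w, u, B) \in ledges L -> uniq B /\ edge w u = [set` B]),
      uniq (unzip1 (lcaps L)) /\
      (forall a B, (a, B) \in lcaps L -> uniq B /\ cap M a = [set` B]) &
      perm_eq (unzip1 (lvals L)) (lworlds L) /\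
      (forall w B, (w, B) \in lvals L -> uniq B /\ valuation w = [set` B])].

End Listings.

(** * Writing the input *)

Variant sign :=
| SNeg | SImp | SLpar | SRpar | SLbrace | SRbrace | SComma
| SK | SC | SD | SE | SF | SPlus | SMinus | SEq | SEquiv.

Definition sign_code (c : sign) : 'I_16 :=
  inord match c with
  | SNeg => 0 | SImp => 1 | SLpar => 2 | SRpar => 3
  | SLbrace => 4 | SRbrace => 5 | SComma => 6 | SK => 7
  | SC => 8 | SD => 9 | SE => 10 | SF => 11
  | SPlus => 12 | SMinus => 13 | SEq => 14 | SEquiv => 15
  end.

Definition sign_decode (i : 'I_16) : sign :=
  nth SNeg [:: SNeg; SImp; SLpar; SRpar; SLbrace; SRbrace; SComma; SK;
               SC; SD; SE; SF; SPlus; SMinus; SEq; SEquiv] i.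

Lemma sign_codeK : cancel sign_code sign_decode.
Proof. by case; rewrite /sign_decode /= inordK. Qed.

HB.instance Definition _ := Finite.copy sign (can_type sign_codeK).

(* An input is first a sequence of symbols, each being a sign or a name; this is
   the sequence whose length is the size of the input. *)
Variant symbol := Sign of sign | Name of bitseq.

(* As there are infinitely many names, they are spelled out over a finite
   alphabet: a mark [inr None] followed by the bits of the name. *)
Definition char : finType := (sign + option bool)%type.

Definition spell_symbol (x : symbol) : seq char :=
  match x with
  | Sign c => [:: inl c]
  | Name b => inr None :: [seq inr (Some d) | d <- b]
  end.

Definition spell (xs : seq symbol) : seq char := flatten [seq spell_symbol x | x <- xs].

Definition braces (xss : seq (seq symbol)) : seq symbol :=
  Sign SLbrace ::
  match xss with
  | [::] => [::]
  | xs :: yss => xs ++ flatten [seq Sign SComma :: ys | ys <- yss]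
  end ++ [:: Sign SRbrace].

Definition name_set (T : Type) (code : T -> bitseq) (l : seq T) : seq symbol :=
  braces [seq [:: Name (code x)] | x <- l].
Arguments name_set : simpl never.

Section Writing.
Variables (P A S : eqType).
Variables (codeP : P -> bitseq) (codeA : A -> bitseq) (codeS : S -> bitseq).

Fixpoint write_formula (phi : formula P A S) : seq symbol :=
  let group o G s := Sign o :: name_set codeA G ++ s in
  let update o B a s :=
    [:: Sign SLpar; Sign o] ++ name_set codeS B ++
    [:: Sign SRpar, Name (codeA a) & s] in
  match phi with
  | Atom p => [:: Name (codeP p)]
  | Neg psi => Sign SNeg :: write_formula psi
  | Imp psi chi =>
      Sign SLpar :: write_formula psi ++
      Sign SImp :: write_formula chi ++ [:: Sign SRpar]
  | Know a psi => [:: Sign SK, Name (codeA a) & write_formula psi]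
  | Common G psi => group SC G (write_formula psi)
  | Distributed G psi => group SD G (write_formula psi)
  | Everyone G psi => group SE G (write_formula psi)
  | Field G psi => group SF G (write_formula psi)
  | AddSkills B a psi => update SPlus B a (write_formula psi)
  | SubSkills B a psi => update SMinus B a (write_formula psi)
  | SetSkills B a psi => update SEq B a (write_formula psi)
  | CopySkills b a psi =>
      [:: Sign SLpar, Sign SEquiv, Name (codeA b), Sign SRpar,
          Name (codeA a) & write_formula psi]
  end.

Definition write_graph (K V : Type) (key : K -> seq symbol) (code : V -> bitseq)
    (l : seq (K * seq V)) : seq symbol :=
  braces [seq Sign SLpar :: key x.1 ++
              Sign SComma :: name_set code x.2 ++ [:: Sign SRpar] | x <- l].

Definition write_listing (W : eqType) (codeW : W -> bitseq) (L : listing P A S W) :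
    seq symbol :=
  [seq Name (codeW w) | w <- lworlds L] ++
  write_graph (fun wu => [:: Name (codeW wu.1); Sign SComma; Name (codeW wu.2)])
    codeS (ledges L) ++
  write_graph (fun a => [:: Name (codeA a)]) codeS (lcaps L) ++
  write_graph (fun w => [:: Name (codeW w)]) codeP (lvals L).

Definition write_input (W : eqType) (codeW : W -> bitseq) (L : listing P A S W)
    (w : W) (phi : formula P A S) : seq symbol :=
  write_listing codeW L ++ Name (codeW w) :: write_formula phi.

Lemma size_name_set (T : eqType) (code : T -> bitseq) (l : seq T) :
  nonempty_set l -> size (name_set code l) = (2 * size l + 1)%N.
Proof.
case: l => [//|x l] _; rewrite /name_set /= size_cat /= size_flatten /shape.
rewrite -!map_comp (eq_map (g := fun _ => 2%N)) //.
have -> : sumn [seq 2%N | _ <- l] = (2 * size l)%N.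
  by elim: l => //= _ l ->; rewrite mulnS.
by rewrite !addn1 mulnS addSn.
Qed.

Lemma size_write_formula (X : {pred op}) (phi : formula P A S) :
  in_lang X phi -> size (write_formula phi) = fsize phi.
Proof.
have hG (B : seq A) n : nonempty_set B ->
    (size (name_set codeA B) + n).+1 = n + 2 * size B + 2.
  by move=> /size_name_set ->; rewrite addnC addn1 !addnS addn0.
have hB (B : seq S) n : nonempty_set B ->
    (size (name_set codeS B) + n.+2).+2 = n + 2 * size B + 5.
  by move=> /size_name_set ->; rewrite addnC addn1 !addnS addn0 !addSn.
elim: phi => //=.
- by move=> psi IH /IH ->; rewrite addn1.
- move=> psi IH1 chi IH2 /andP[/IH1 h1 /IH2 h2].
  by rewrite size_cat /= size_cat h1 h2 /= addn1 !addnS addn0.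
- by move=> a psi IH /IH ->; rewrite addn2.
- by move=> G psi IH /and3P[_ ? /IH <-]; rewrite size_cat hG.
- by move=> G psi IH /and3P[_ ? /IH <-]; rewrite size_cat hG.
- by move=> G psi IH /and3P[_ ? /IH <-]; rewrite size_cat hG.
- by move=> G psi IH /and3P[_ ? /IH <-]; rewrite size_cat hG.
- by move=> B a psi IH /and3P[_ ? /IH <-]; rewrite size_cat hB.
- by move=> B a psi IH /and3P[_ ? /IH <-]; rewrite size_cat hB.
- by move=> B a psi IH /and3P[_ ? /IH <-]; rewrite size_cat hB.
- by move=> b a psi IH /andP[_ /IH ->]; rewrite !addnS addn0.
Qed.

(* The number of symbols of an input is |phi| + |M| + 1. *)
Lemma size_write_input (X : {pred op}) (W : eqType) (codeW : W -> bitseq)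
    (L : listing P A S W) (w : W) (phi : formula P A S) :
  in_lang X phi ->
  size (write_input codeW L w phi) =
  (fsize phi + size (write_listing codeW L) + 1)%N.
Proof.
by move=> /size_write_formula h; rewrite size_cat /= h addnS addn1 addnC.
Qed.

(* Atoms, agents and skills are numbered by the binary words through [codeP],
   [codeA] and [codeS], which are meant to be bijective; the worlds are named by
   an arbitrary injection into the binary words. *)
Definition model_checking (X : {pred op}) : set (seq char) :=
  [set s | exists (M : model P A S) (codeW : M -> bitseq)
             (L : listing P A S M) (w : M) (phi : formula P A S),
     [/\ injective codeW, lists L, in_lang X phi,
         {subset agents phi <= unzip1 (lcaps L)} &
         s = spell (write_input codeW L w phi) /\ sat w phi]].

End Writing.

Lemma size_spell (xs : seq symbol) (m : nat) :
  all (fun x => if x is Name b then size b <= m else true) xs ->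
  size xs <= size (spell xs) <= m.+1 * size xs.
Proof.
elim: xs => [|x xs IH]; first by rewrite muln0.
rewrite [all _ _]/= => /andP[h /IH/andP[h1 h2]].
have /andP[h3 h4] : 0 < size (spell_symbol x) <= m.+1.
  by case: x h => //= b h; rewrite size_map ltnS h.
by rewrite /spell /= size_cat mulnS -add1n !leq_add.
Qed.

(* Main.v *)
(* Every formula is evaluated bottom-up as a set of worlds.  A capability
   modality only changes the capabilities under which its scope is read, so the
   capability of an agent at a subformula is recovered, one skill at a time, by a
   walk through the ancestors of the subformula: an assignment [(\equiv_b)_a]
   just replaces the agent that is followed.  Nothing is copied, and all
   intermediate data stay of polynomial size.  Common knowledge is the greatest
   fixpoint of [X |-> E_G (phi /\ X)], reached after at most as many steps as
   there are worlds.

   On the machine side, binary trees in prefix code are kept on one stack, and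
   the functions computable in this way in polynomial time are closed under
   composition, pairing, case distinction, and folds whose state grows at each
   step by an amount that does not depend on the state. *)

From HB Require Import structures.
Require Import Defs.
From mathcomp Require Import all_boot zify.
From mathcomp Require Import boolp classical_sets.

Set Implicit Arguments.
Unset Strict Implicit.
Unset Printing Implicit Defensive.

(** * Stack programs and Turing machines *)

(** Each occurrence of a subformula is read under exactly one capability assignment, the one fixed
    by its ancestors. Hence one set of worlds per occurrence suffices, whereas a recursion world by
    world would multiply the work at every nested modality. The language consists of the texts for
    which some model, listing and formula exist, so well-formed text must be recognised as well.
    Surjectivity of the codings turns every word that is read into an atom, an agent or a skill;
    injectivity makes comparing words the same as comparing what they name; and since worlds may
    carry any names, the words of the text themselves can serve as worlds. Truth is shown to depend
    on the text only, so it does not matter which model witnesses membership. The procedure works on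
    plain lists of words; models and formulas appear only in its correctness proof. *)

Section StackPrograms.
Variable Sigma : finType.

Definition sym := (Sigma + bool)%type.

(* Each of the five tapes is used as a stack, with its top under the head: the
   input, the main stack, two temporary stacks and a unary counter. *)
Variant stack := Inp | Main | TmpA | TmpB | Cnt.

Definition stack_nat i := match i with Inp => 0 | Main => 1 | TmpA => 2 | TmpB => 3 | Cnt => 4 end.
Definition stack_idx i : 'I_5 := inord (stack_nat i).

Lemma stack_idx_inj : injective stack_idx.
Proof.
move=> i j /(congr1 val); rewrite /stack_idx /= !inordK; [|by case: j|by case: i].
by case: i; case: j.
Qed.

Lemma stack_idx0 : stack_idx Inp = ord0.
Proof. by apply: val_inj; rewrite /= inordK. Qed.

Definition store := (seq sym * seq sym * seq sym * seq sym * seq sym)%type.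

Definition stack_of (s : store) i :=
  let: (x, m, a, b, k) := s in
  match i with Inp => x | Main => m | TmpA => a | TmpB => b | Cnt => k end.

Definition set_stack (s : store) i v : store :=
  let: (x, m, a, b, k) := s in
  match i with
  | Inp => (v, m, a, b, k) | Main => (x, v, a, b, k) | TmpA => (x, m, v, b, k)
  | TmpB => (x, m, a, v, k) | Cnt => (x, m, a, b, v)
  end.

Lemma stack_of_set_eq s i v : stack_of (set_stack s i v) i = v.
Proof. by case: s => [[[[? ?] ?] ?] ?]; case: i. Qed.

Lemma stack_of_set_neq s i j v : i <> j -> stack_of (set_stack s i v) j = stack_of s j.
Proof. by case: s => [[[[? ?] ?] ?] ?]; case: i; case: j. Qed.

Inductive prog :=
| Nop
| Push of stack & sym
| Pop of stack
| Seq of prog & prog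
| If of stack & (option sym -> bool) & prog & prog
| While of stack & (option sym -> bool) & prog.

Inductive exec : prog -> store -> nat -> store -> Prop :=
| exNop s : exec Nop s 0 s
| exPush i c s : exec (Push i c) s 2 (set_stack s i (c :: stack_of s i))
| exPop i s : exec (Pop i) s 1 (set_stack s i (behead (stack_of s i)))
| exSeq p q s s1 s2 n m :
    exec p s n s1 -> exec q s1 m s2 -> exec (Seq p q) s (n + m) s2
| exIfT i (t : option sym -> bool) p q s s1 n :
    t (ohead (stack_of s i)) -> exec p s n s1 -> exec (If i t p q) s n.+2 s1
| exIfF i (t : option sym -> bool) p q s s1 n :
    ~~ t (ohead (stack_of s i)) -> exec q s n s1 -> exec (If i t p q) s n.+1 s1
| exWhileF i (t : option sym -> bool) p s :
    ~~ t (ohead (stack_of s i)) -> exec (While i t p) s 1 s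
| exWhileT i (t : option sym -> bool) p s s1 s2 n m :
    t (ohead (stack_of s i)) -> exec p s n s1 -> exec (While i t p) s1 m s2 ->
    exec (While i t p) s (n + m).+2 s2.

(** * Compilation to machine instructions *)

Inductive instr :=
| Act of stack & (option sym -> option sym * move)
| Jump of stack & (option sym -> bool) & nat & nat
| Halt of stack & (option sym -> bool).

Definition goto l := Jump Inp xpredT l l.

(** Jump targets are absolute addresses, hence the offset. A push takes two instructions because the
    head has to leave the old top before it writes the new one. *)
Fixpoint compile (off : nat) (p : prog) : seq instr :=
  match p with
  | Nop => [::]
  | Push i c => [:: Act i (fun x => (x, MoveLeft)); Act i (fun _ => (Some c, Stay))]
  | Pop i => [:: Act i (fun _ => (None, MoveRight))]
  | Seq p q => let c := compile off p in c ++ compile (off + size c) q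
  | If i t p q =>
      let c := compile off.+1 p in
      let off' := (off + size c).+2 in
      let d := compile off' q in
      Jump i t off.+1 off' :: c ++ goto (off' + size d) :: d
  | While i t p =>
      let c := compile off.+1 p in
      Jump i t off.+1 (off + size c).+2 :: c ++ [:: goto off]
  end.

Definition pstate (code : seq instr) : finType := ('I_(size code).+1 + bool)%type.

Definition ptrans (code : seq instr) (q : pstate code)
    (v : {ffun 'I_5 -> option sym}) :
    pstate code * {ffun 'I_5 -> option sym * move} :=
  let keep := [ffun j => (v j, Stay)] in
  match q with
  | inr b => (inr b, keep)
  | inl pc =>
    match nth (Halt Inp xpredT) code pc with
    | Act i f => (inl (inord pc.+1),
                  [ffun j => if j == stack_idx i then f (v j) else (v j, Stay)])
    | Jump i t l1 l2 => (inl (inord (if t (v (stack_idx i)) then l1 else l2)), keep)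
    | Halt i t => (inr (t (v (stack_idx i))), keep)
    end
  end.

Lemma inr_true_neq_false (code : seq instr) : (inr true : pstate code) != inr false.
Proof. by []. Qed.

Definition pmachine (code : seq instr) : machine Sigma :=
  @Machine Sigma (pstate code) bool 4 (inl ord0) (inr true) (inr false)
    (inr_true_neq_false code) (@ptrans code).

(** Everything to the left of the head is blank because a pop erases the cell before moving right.
    The number of explicit blanks at the far end varies during a run and is left existential. *)
Definition holds (T : machine Sigma) (t : tape T) (l : seq (Sigma + extra T)) : Prop :=
  all (fun c => ~~ isSome c) (lefts t) /\
  exists n, scanned t :: rights t = map Some l ++ nseq n None.

Section Correct.
Variable code : seq instr.
Local Notation T := (pmachine code).
Implicit Types (c : config T) (s : store).

Definition at_pc c pc s : Prop :=
  cstate c = inl (inord pc) /\ forall i, holds (ctapes c (stack_idx i)) (stack_of s i).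

Lemma holds_scanned (t : tape T) l : holds t l -> scanned t = ohead l.
Proof. by case=> _ [n]; case: l => [|x l] /=; [case: n => [//|n] []|case]. Qed.

Lemma holds_pop (t : tape T) l :
  holds t l -> holds (write_move t (None, MoveRight)) (behead l).
Proof.
case: t => L c R [/= hL [n h]]; split; first by rewrite /= hL.
case: l h => [|x l] /=.
  case: n => [//|n] [_ hR]; by exists n.-1.+1; rewrite hR; case: n {hR}.
case=> _ hR; rewrite hR; case: l {hR} => [|y l] /=; last by exists n.
by exists n.-1.+1; case: n.
Qed.

Lemma holds_push (t : tape T) l x :
  holds t l ->
  holds (write_move (write_move t (scanned t, MoveLeft)) (Some x, Stay)) (x :: l).
Proof.
case: t => L c R [/= hL [n h]]; split; last by exists n; rewrite /= h.
by case: L hL => //= y L /andP[].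
Qed.

Lemma step_at c pc s : at_pc c pc s -> pc < size code ->
  let: (q, a) := ptrans (inl (inord pc) : pstate code) [ffun i => scanned (ctapes c i)] in
  step c = @Config _ T q (fun i => write_move (ctapes c i) (a i)).
Proof.
move=> [hc _] _; rewrite /step /= hc /=.
by case: (nth _ _ _).
Qed.

Lemma write_stay (t : tape T) : write_move t (scanned t, Stay) = t.
Proof. by case: t. Qed.

Lemma step_jump c pc s i t l1 l2 : at_pc c pc s -> pc < size code ->
  nth (Halt Inp xpredT) code pc = Jump i t l1 l2 ->
  at_pc (step c) (if t (ohead (stack_of s i)) then l1 else l2) s.
Proof.
move=> h lt hn; have := step_at h lt; rewrite /= inordK ?ltnS ?(ltnW lt) // hn => ->.
case: h => hc h; split => /=.
  by rewrite ffunE (holds_scanned (h i)).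
by move=> j; rewrite !ffunE write_stay.
Qed.

Lemma step_halt c pc s i t : at_pc c pc s -> pc < size code ->
  nth (Halt Inp xpredT) code pc = Halt i t ->
  cstate (step c) = inr (t (ohead (stack_of s i))).
Proof.
move=> h lt hn; have := step_at h lt; rewrite /= inordK ?ltnS ?(ltnW lt) // hn => -> /=.
by case: h => hc h; rewrite ffunE (holds_scanned (h i)).
Qed.

Lemma step_act c pc s i f : at_pc c pc s -> pc < size code ->
  nth (Halt Inp xpredT) code pc = Act i f ->
  cstate (step c) = inl (inord pc.+1) /\
  (forall j, ctapes (step c) (stack_idx j) =
     if stack_idx j == stack_idx i then
       write_move (ctapes c (stack_idx j)) (f (scanned (ctapes c (stack_idx j))))
     else ctapes c (stack_idx j)).
Proof.
move=> h lt hn; have := step_at h lt; rewrite /= inordK ?ltnS ?(ltnW lt) // hn => -> /=.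
split=> // j; rewrite !ffunE; case: eqP => // _; exact: write_stay.
Qed.

(** The induction is on the run and not on the program, since a loop executes the same code again.
    Quantifying over the surrounding code [pre] and [post] lets the hypothesis apply to a fragment
    wherever it is placed. *)
Lemma exec_compile p s t s1 : exec p s t s1 ->
  forall off pre post c, code = pre ++ compile off p ++ post -> off = size pre ->
  at_pc c off s -> at_pc (iter t (@step _ T) c) (off + size (compile off p)) s1.
Proof.
elim=> {p s t s1}.
- by move=> s off pre post c /= _ _; rewrite addn0.
- move=> i x s off pre post c /= hcode hoff h.
  have hn : nth (Halt Inp xpredT) code off = Act i (fun x => (x, MoveLeft)).
    by rewrite hcode hoff nth_cat ltnn subnn.
  have hn1 : nth (Halt Inp xpredT) code off.+1 = Act i (fun _ => (Some x, Stay)).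
    by rewrite hcode hoff nth_cat ltnNge leqnSn /= subSnn.
  have sz : off.+1 < size code by rewrite hcode hoff size_cat /=; lia.
  have [e1 e2] := step_act h (ltnW sz) hn.
  set c1 := step c in e1 e2 *.
  have [h1 h2] := h.
  have st2 : cstate (step c1) = inl (inord off.+2) /\ (forall j, ctapes (step c1) (stack_idx j) =
     if stack_idx j == stack_idx i then write_move (ctapes c1 (stack_idx j)) (Some x, Stay)
     else ctapes c1 (stack_idx j)).
    rewrite /step e1 /= inordK ?hn1 //=; last by rewrite ltnS (ltnW sz).
    split=> // j; rewrite !ffunE; case: eqP => // _; exact: write_stay.
  split; first by rewrite addn2; case: st2.
  move=> j; rewrite (proj2 st2) e2; case: eqP => [/stack_idx_inj -> |hj].
    rewrite stack_of_set_eq; exact: holds_push.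
  by rewrite stack_of_set_neq // => ij; apply: hj; rewrite ij.
- move=> i s off pre post c /= hcode hoff h.
  have hn : nth (Halt Inp xpredT) code off = Act i (fun _ => (None, MoveRight)).
    by rewrite hcode hoff nth_cat ltnn subnn.
  have sz : off < size code by rewrite hcode hoff size_cat /=; lia.
  have [e1 e2] := step_act h sz hn.
  split; first by rewrite addn1.
  move=> j; rewrite e2; case: eqP => [/stack_idx_inj -> |hj].
    rewrite stack_of_set_eq; case: h => _ h; exact: holds_pop.
  rewrite stack_of_set_neq; first by case: h => _ h; exact: h.
  by move=> ij; apply: hj; rewrite ij.
- move=> p q s s1 s2 n m _ IHp _ IHq off pre post c /= hcode hoff h.
  have h1 := IHp off pre (compile (off + size (compile off p)) q ++ post) c.
  rewrite size_cat addnA addnC iterD.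
  have {}h1 := h1 _ hoff h.
  apply: (IHq _ (pre ++ compile off p) post); rewrite ?size_cat ?hoff //.
    by rewrite hcode -!catA hoff.
  by rewrite -hoff; apply: h1; rewrite hcode -!catA.
- move=> i t p q s s1 n ht _ IH off pre post c /= hcode hoff h.
  set cp := compile off.+1 p in hcode *.
  set off' := (off + size cp).+2 in hcode *.
  set cq := compile off' q in hcode *.
  have sz : off < size code by rewrite hcode hoff size_cat /=; lia.
  have hn : nth (Halt Inp xpredT) code off = Jump i t off.+1 off'.
    by rewrite hcode hoff nth_cat ltnn subnn.
  have := step_jump h sz hn; rewrite ht => h1.
  (* The first step is the conditional jump and the last one the [goto] over the other branch; these
     are the two extra steps of the rule. *)
  rewrite -!iterS iterSr iterS.
  have h2 := IH off.+1 (pre ++ [:: Jump i t off.+1 off']) (goto (off' + size cq) :: cq ++ post)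
    (step c) _ _ h1.
  have {}h2 : at_pc (iter n (@step _ T) (step c)) (off.+1 + size cp) s1.
    apply: h2; last by rewrite size_cat hoff addn1.
    by rewrite hcode -!catA /= -?catA.
  have sz2 : off.+1 + size cp < size code.
    by rewrite hcode hoff !size_cat /= !size_cat /=; lia.
  have hn2 : nth (Halt Inp xpredT) code (off.+1 + size cp) = goto (off' + size cq).
    rewrite hcode nth_cat -hoff ifF; last by lia.
    rewrite (_ : _ - off = (size cp).+1) /=; last by lia.
    by rewrite -catA nth_cat ltnn subnn.
  have := step_jump h2 sz2 hn2.
  rewrite (_ : off + _ = off' + size cq) // size_cat /= /off'; lia.
- move=> i t p q s s1 n ht _ IH off pre post c /= hcode hoff h.
  set cp := compile off.+1 p in hcode *.
  set off' := (off + size cp).+2 in hcode *.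
  set cq := compile off' q in hcode *.
  have sz : off < size code by rewrite hcode hoff size_cat /=; lia.
  have hn : nth (Halt Inp xpredT) code off = Jump i t off.+1 off'.
    by rewrite hcode hoff nth_cat ltnn subnn.
  have := step_jump h sz hn; rewrite (negbTE ht) => h1.
  rewrite -iterS iterSr.
  have := IH off' (pre ++ Jump i t off.+1 off' :: cp ++ [:: goto (off' + size cq)]) post
    (step c) _ _ h1.
  rewrite -/cq => h2.
  rewrite (_ : off + _ = off' + size cq); last by rewrite size_cat /= /off'; lia.
  apply: h2; first by rewrite hcode -!catA /= -?catA.
  by rewrite size_cat /= size_cat /= /off'; lia.
- move=> i t p s ht off pre post c /= hcode hoff h.
  set cp := compile off.+1 p in hcode *.
  have sz : off < size code by rewrite hcode hoff size_cat /=; lia.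
  have hn : nth (Halt Inp xpredT) code off = Jump i t off.+1 (off + size cp).+2.
    by rewrite hcode hoff nth_cat ltnn subnn.
  have := step_jump h sz hn; rewrite (negbTE ht).
  by rewrite size_cat addn1 !addnS.
- move=> i t p s s1 s2 n m ht _ IH _ IHw off pre post c /= hcode hoff h.
  set cp := compile off.+1 p in hcode *.
  have sz : off < size code by rewrite hcode hoff size_cat /=; lia.
  have hn : nth (Halt Inp xpredT) code off = Jump i t off.+1 (off + size cp).+2.
    by rewrite hcode hoff nth_cat ltnn subnn.
  have := step_jump h sz hn; rewrite ht => h1.
  have h2 := IH off.+1 (pre ++ [:: Jump i t off.+1 (off + size cp).+2]) (goto off :: post)
    (step c) _ _ h1.
  have {}h2 : at_pc (iter n (@step _ T) (step c)) (off.+1 + size cp) s1.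
    apply: h2; last by rewrite size_cat hoff addn1.
    by rewrite hcode -!catA /= -?catA.
  have sz2 : off.+1 + size cp < size code.
    by rewrite hcode hoff !size_cat /= !size_cat /=; lia.
  have hn2 : nth (Halt Inp xpredT) code (off.+1 + size cp) = goto off.
    rewrite hcode nth_cat -hoff ifF; last by lia.
    rewrite (_ : _ - off = (size cp).+1) /=; last by lia.
    by rewrite -catA nth_cat ltnn subnn.
  have h3 := step_jump h2 sz2 hn2; rewrite /= in h3.
  have := IHw off pre post _ hcode hoff h3.
  rewrite -!iterS (_ : (n + m).+2 = m + n.+2); last by lia.
  by rewrite iterD iterS iterSr.
Qed.

End Correct.

Definition accepting (x : option sym) := x == Some (inr true).

Definition machine_of (p : prog) : machine Sigma :=
  pmachine (compile 0 p ++ [:: Halt Main accepting]).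

(** One step after the run executes the final [Halt]. The accepting and rejecting states are
    fixpoints of [step], so every bound beyond [n] serves. *)
Lemma machine_of_halts (p : prog) (x : seq Sigma) n s :
  exec p ([seq inl c | c <- x], [::], [::], [::], [::]) n s ->
  forall t, n < t ->
  halts_within (T := machine_of p) x t
    (if accepting (ohead (stack_of s Main)) then accept (machine_of p)
     else reject (machine_of p)).
Proof.
move=> h t lt; rewrite /halts_within.
set T := machine_of p.
have h0 : at_pc (@init _ T x) 0 ([seq inl c | c <- x], [::], [::], [::], [::]).
  split.
    rewrite /= -[X in inord X]/(val (@ord0 (size (compile 0 p ++ [:: Halt Main accepting])))).
    by rewrite inord_val.
  have blank i : i <> Inp -> holds (ctapes (@init _ T x) (stack_idx i)) [::].
    move=> hi /=; rewrite ifF; first by split => //; exists 1.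
    by apply/eqP => h0; apply: hi; exact: stack_idx_inj (etrans h0 (esym stack_idx0)).
  case; try exact: blank.
  rewrite /= stack_idx0 eqxx; split => //=; case: x {h blank} => [|c x] /=; first by exists 1.
  by exists 0; rewrite cats0 -map_comp.
set code := compile 0 p ++ [:: Halt Main accepting].
have h1 : at_pc (code := code) (iter n (@step _ T) (init T x)) (size (compile 0 p)) s.
  exact: (exec_compile h (pre := [::]) erefl erefl h0).
have h2 : cstate (iter n.+1 (@step _ T) (init T x)) = inr (accepting (ohead (stack_of s Main))).
  rewrite iterS; apply: (step_halt h1); first by rewrite size_cat addn1.
  by rewrite nth_cat ltnn subnn.
rewrite -(subnK lt) iterD.
have fixH (c : config T) b k : cstate c = inr b -> cstate (iter k (@step _ T) c) = inr b.
  move=> hc; elim: k => //= k IH; rewrite /step ifT //.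
  by move: IH; rewrite /step => ->; case: b {hc}.
by rewrite (fixH _ _ _ h2); case: accepting.
Qed.

End StackPrograms.

(** * Trees on the main stack *)

(** Only upper bounds on running times are kept, so that branches of different cost share one
    statement. *)
Definition execs (p : prog char) s n s1 := exists2 m, m <= n & exec p s m s1.

Lemma execs_weak p s n m s1 : execs p s n s1 -> n <= m -> execs p s m s1.
Proof. by case=> k le h le1; exists k => //; exact: leq_trans le le1. Qed.

Lemma execs_nop s n : execs (Nop _) s n s.
Proof. by exists 0 => //; constructor. Qed.

Lemma execs_push i c s : execs (Push i c) s 2 (set_stack s i (c :: stack_of s i)).
Proof. by exists 2 => //; constructor. Qed.

Lemma execs_pop i s : execs (Pop _ i) s 1 (set_stack s i (behead (stack_of s i))).
Proof. by exists 1 => //; constructor. Qed.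

Lemma execs_seq p q s s1 s2 n m :
  execs p s n s1 -> execs q s1 m s2 -> execs (Seq p q) s (n + m) s2.
Proof.
by move=> [n' le h] [m' le' h']; exists (n' + m'); [exact: leq_add|exact: exSeq h h'].
Qed.

Lemma execs_if i t p q s s1 n :
  execs (if t (ohead (stack_of s i)) then p else q) s n s1 -> execs (If i t p q) s n.+2 s1.
Proof.
case=> m le; case: ifP => [ht|/negbT ht] h.
  by exists m.+2 => //; exact: exIfT.
by exists m.+1; [exact: leqW|exact: exIfF].
Qed.

Lemma execs_while_stop i (t : option (sym char) -> bool) p s n :
  ~~ t (ohead (stack_of s i)) -> 0 < n -> execs (While i t p) s n s.
Proof. by move=> h lt; exists 1 => //; exact: exWhileF. Qed.

Lemma execs_while i (t : option (sym char) -> bool) p s s1 s2 n m :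
  t (ohead (stack_of s i)) -> execs p s n s1 -> execs (While i t p) s1 m s2 ->
  execs (While i t p) s (n + m + 2) s2.
Proof.
move=> ht [n' le h] [m' le' h']; exists (n' + m').+2; first by rewrite addn2 !ltnS leq_add.
exact: exWhileT h h'.
Qed.

Inductive tree := Leaf | Node of tree & tree.

Fixpoint code t : seq (sym char) :=
  match t with
  | Leaf => [:: inr false]
  | Node a b => inr true :: code a ++ code b
  end.

Fixpoint tsize t := match t with Leaf => 1 | Node a b => (tsize a + tsize b).+1 end.

Lemma size_code t : size (code t) = tsize t.
Proof. by elim: t => //= a <- b <-; rewrite size_cat. Qed.

Lemma tsize_gt0 t : 0 < tsize t.
Proof. by case: t. Qed.

(** The remainders are what makes the induction work: in the code of a node, the code of the second
    child is the remainder of the first. *)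
Lemma code_prefix_free a b r1 r2 : code a ++ r1 = code b ++ r2 -> a = b /\ r1 = r2.
Proof.
elim: a b r1 r2 => [|a1 IH1 a2 IH2] [|b1 b2] r1 r2 //=; first by case.
case; rewrite -!catA => /IH1 [-> /IH2 [-> ->]] //.
Qed.

Lemma code_inj : injective code.
Proof. by move=> a b; rewrite -[code a]cats0 -[code b]cats0 => /code_prefix_free []. Qed.

Section Gadgets.
Local Notation T := (inr true : sym char).
Local Notation F := (inr false : sym char).
Local Notation accepting := (@accepting char).
Implicit Types (j : bool) (x m v o : seq (sym char)) (t : tree).

Definition tmp_idx j := if j then TmpA else TmpB.
Definition tmp_store j x m v o k : store char := if j then (x, m, v, o, k) else (x, m, o, v, k).

Definition move_loop j :=
  While Cnt isSome
    (If Main accepting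
       (Seq (Pop _ Main) (Seq (Push (tmp_idx j) T) (Push Cnt T)))
       (Seq (Pop _ Main) (Seq (Push (tmp_idx j) F) (Pop _ Cnt)))).

Definition move_tree j := Seq (Push Cnt T) (move_loop j).

(* The height of the counter is the number of subtrees still to be read. *)
Lemma move_loop_spec j t x r v o k n s :
  execs (move_loop j) (tmp_store j x r (rev (code t) ++ v) o k) n s ->
  execs (move_loop j) (tmp_store j x (code t ++ r) v o (T :: k)) (9 * tsize t + n) s.
Proof.
elim: t r v k n => [|t1 IH1 t2 IH2] r v k n h.
  apply: (execs_weak (n := 6 + n + 2)); last by rewrite /= muln1; lia.
  apply: execs_while; [by case: (j)| |exact: h].
  apply: execs_if; case: j h => h.
    exact: (execs_seq (execs_pop _ _) (execs_seq (execs_push _ _ _) (execs_pop _ _))).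
  exact: (execs_seq (execs_pop _ _) (execs_seq (execs_push _ _ _) (execs_pop _ _))).
apply: (execs_weak (n := 7 + (9 * tsize t1 + (9 * tsize t2 + n)) + 2)); last by rewrite /=; lia.
apply: (execs_while (s1 := tmp_store j x (code t1 ++ code t2 ++ r) (T :: v) o (T :: T :: k))).
- by case: (j).
- apply: execs_if; rewrite /= -catA; case: (j).
    exact: (execs_seq (execs_pop _ _) (execs_seq (execs_push _ _ _) (execs_push _ _ _))).
  exact: (execs_seq (execs_pop _ _) (execs_seq (execs_push _ _ _) (execs_push _ _ _))).
apply: IH1; apply: IH2; move: h.
by rewrite /= rev_cons rev_cat -cats1 -!catA.
Qed.

Lemma move_tree_spec j t x r v o :
  execs (move_tree j) (tmp_store j x (code t ++ r) v o [::]) (9 * tsize t + 3)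
        (tmp_store j x r (rev (code t) ++ v) o [::]).
Proof.
apply: (execs_weak (n := 2 + (9 * tsize t + 1))); last by lia.
apply: (execs_seq (s1 := tmp_store j x (code t ++ r) v o [:: T])).
  by case: j; exact: execs_push.
by apply: move_loop_spec; apply: execs_while_stop => //; case: j.
Qed.

Definition pour i (body : bool -> prog char) :=
  While i isSome (Seq (If i accepting (body true) (body false)) (Pop _ i)).

Definition bits t : seq bool := [seq if c is inr d then d else false | c <- code t].

Lemma code_bits t : code t = [seq inr d | d <- bits t].
Proof.
by rewrite /bits -map_comp; elim: t => //= a IHa b IHb; rewrite map_cat -IHa -IHb.
Qed.

Lemma rev_code t : rev (code t) = map inr (rev (bits t)).
Proof. by rewrite map_rev -code_bits. Qed.

(** The family [st] is the loop invariant, indexed by what is still to be poured and what has been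
    poured; it lets one proof cover transfer, duplication and erasure. A turn costs at most 9 steps:
    2 for the loop, 2 for the test, 4 for the body (at most two pushes) and 1 for the pop. *)
Lemma pour_spec i (body : bool -> prog char) (st : seq bool -> seq bool -> store char) :
  (forall w u, stack_of (st w u) i = map inr w) ->
  (forall d w u, exists2 s1, execs (body d) (st (d :: w) u) 4 s1 &
     set_stack s1 i (behead (stack_of s1 i)) = st w (d :: u)) ->
  forall w, execs (pour i body) (st w [::]) (9 * size w + 1) (st [::] (rev w)).
Proof.
move=> hg hb w.
suff H u : execs (pour i body) (st w u) (9 * size w + 1) (st [::] (rev w ++ u)).
  by rewrite -[rev w]cats0.
elim: w u => [|d w IH] u.
  by rewrite /pour; apply: (@execs_while_stop _ _ _ (st [::] u)); rewrite ?hg // addn1.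
apply: (execs_weak (n := (6 + 1) + (9 * size w + 1) + 2)); last by rewrite /=; lia.
apply: (execs_while (s1 := st w (d :: u))); first by rewrite hg.
  have [s1 h1 h2] := hb d w u.
  rewrite -h2; apply: execs_seq (execs_pop _ _).
  by apply: execs_if; rewrite hg /=; case: d h1 {h2}.
by rewrite rev_cons -cats1 -catA; apply: IH.
Qed.

Definition pour_main j := pour (tmp_idx j) (fun d => Push Main (inr d)).

Lemma pour_main_spec j t x m o k :
  execs (pour_main j) (tmp_store j x m (rev (code t)) o k) (9 * tsize t + 1)
        (tmp_store j x (code t ++ m) [::] o k).
Proof.
rewrite code_bits -map_rev -size_code code_bits size_map -(size_rev (bits t)).
rewrite -[in X in execs _ _ _ (X)](revK (bits t)).
move: (rev _) => w.
apply: (@pour_spec _ _ (fun w u => tmp_store j x (map inr u ++ m) (map inr w) o k)).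
  by move=> *; case: j.
move=> d w1 u.
exists (tmp_store j x (map inr (d :: u) ++ m) (map inr (d :: w1)) o k); last by case: j.
by apply: execs_weak (_ : 2 <= 4) => //; case: j; exact: execs_push.
Qed.

Definition main_store m : store char := ([::], m, [::], [::], [::]).

(** Moving a tree reverses its code and pouring reverses it back. The tree that was on top is poured
    first and therefore ends up below. *)
Definition swap := Seq (move_tree true) (Seq (move_tree false) (Seq (pour_main true) (pour_main false))).

Lemma swap_spec t u r :
  execs swap (main_store (code t ++ code u ++ r)) (18 * (tsize t + tsize u) + 8)
        (main_store (code u ++ code t ++ r)).
Proof.
apply: (execs_weak (n := (9 * tsize t + 3) + ((9 * tsize u + 3) +
  ((9 * tsize t + 1) + (9 * tsize u + 1))))); last by lia.
apply: (execs_seq (@move_tree_spec true t [::] (code u ++ r) [::] [::])); rewrite cats0.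
apply: (execs_seq (@move_tree_spec false u [::] r [::] (rev (code t)))); rewrite cats0.
apply: (execs_seq (@pour_main_spec true t [::] r (rev (code u)) [::])).
exact: (@pour_main_spec false u [::] (code t ++ r) [::] [::]).
Qed.

Definition dup :=
  Seq (move_tree true)
    (Seq (pour TmpA (fun d => Seq (Push Main (inr d)) (Push TmpB (inr d))))
       (Seq (pour TmpB (fun d => Push TmpA (inr d))) (pour_main true))).

Lemma dup_spec t r :
  execs dup (main_store (code t ++ r)) (36 * tsize t + 6) (main_store (code t ++ code t ++ r)).
Proof.
apply: (execs_weak (n := (9 * tsize t + 3) + ((9 * tsize t + 1) +
  ((9 * tsize t + 1) + (9 * tsize t + 1))))); last by lia.
apply: (execs_seq (@move_tree_spec true t [::] r [::] [::])); rewrite cats0.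
apply: (execs_seq (s1 := ([::], code t ++ r, [::], code t, [::]))).
  rewrite code_bits -map_rev -size_code code_bits size_map -(size_rev (bits t)).
  rewrite -[in X in execs _ _ _ X](revK (bits t)).
  apply: (@pour_spec _ _ (fun w u => ([::], map inr u ++ r, map inr w, map inr u, [::]))) => //.
  move=> d w u; exists ([::], map inr (d :: u) ++ r, map inr (d :: w), map inr (d :: u), [::]) => //.
  exact: (execs_seq (execs_push _ _ _) (execs_push _ _ _)).
(* The copy on [TmpB] is already in reading order, so pouring it onto [Main] would reverse it; it is
   first turned round through [TmpA]. *)
apply: (execs_seq (s1 := ([::], code t ++ r, rev (code t), [::], [::]))).
  rewrite -size_code code_bits -map_rev size_map.
  apply: (@pour_spec _ _ (fun w u => ([::], map inr (bits t) ++ r, map inr u, map inr w, [::]))) => //.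
  move=> d w u; exists ([::], map inr (bits t) ++ r, map inr (d :: u), map inr (d :: w), [::]) => //.
  by apply: execs_weak (execs_push _ _ _) _.
exact: (@pour_main_spec true t [::] (code t ++ r) [::] [::]).
Qed.

Lemma clear_spec i w s : stack_of s i = map inr w ->
  execs (pour i (fun _ => Nop _)) s (9 * size w + 1) (set_stack s i [::]).
Proof.
move=> h; have e l : stack_of (set_stack s i l) i = l by exact: stack_of_set_eq.
rewrite [X in execs _ X](_ : _ = set_stack s i (map inr w)); last first.
  by move: h; case: s {e} => [[[[? ?] ?] ?] ?]; case: i => /= ->.
apply: (@pour_spec _ _ (fun w u => set_stack s i (map inr w))) => [*|d w1 u].
  by rewrite e.
exists (set_stack s i (map inr (d :: w1))); first exact: execs_nop.
by rewrite e /=; case: s {h e} => [[[[? ?] ?] ?] ?]; case: i.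
Qed.

Definition drop_top := Seq (move_tree true) (pour TmpA (fun _ => Nop _)).

Lemma drop_top_spec t r :
  execs drop_top (main_store (code t ++ r)) (18 * tsize t + 4) (main_store r).
Proof.
apply: (execs_weak (n := (9 * tsize t + 3) + (9 * tsize t + 1))); last by lia.
apply: (execs_seq (@move_tree_spec true t [::] r [::] [::])); rewrite cats0.
rewrite -size_code {2}code_bits size_map -(size_rev (bits t)).
apply: (clear_spec (s := ([::], r, rev (code t), [::], [::]))).
by rewrite /= code_bits map_rev.
Qed.

Definition push_tree t := foldr (fun c p => Seq p (Push Main c)) (Nop _) (code t).

Lemma push_tree_spec t r :
  execs (push_tree t) (main_store r) (2 * tsize t) (main_store (code t ++ r)).
Proof.
rewrite /push_tree -size_code; elim: (code t) => [|c l IH] /=; first exact: execs_nop.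
apply: (execs_weak (n := 2 * size l + 2)); last by lia.
exact: execs_seq IH (execs_push _ _ _).
Qed.

Definition bool_tree b := if b then Node Leaf Leaf else Leaf.

Definition refuting (c : option (sym char)) := c == Some F.

Definition cmp_loop :=
  While TmpA isSome
    (Seq (If TmpA accepting (If TmpB accepting (Nop _) (Push Cnt T))
                            (If TmpB refuting (Nop _) (Push Cnt T)))
         (Seq (Pop _ TmpA) (Pop _ TmpB))).

Lemma cmp_loop_spec x m (u w : seq bool) (k : nat) : exists k',
  execs cmp_loop (x, m, map inr u, map inr w, nseq k T) (10 * size u + 1)
     (x, m, [::], map inr (drop (size u) w), nseq k' T) /\
  k' <= k + size u /\ (k' == 0) = (k == 0) && (u == take (size u) w).
Proof.
elim: u w k => [|d u IH] w k.
  exists k; rewrite /= drop0 take0 andbT addn0; split; last by [].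
  exact: execs_while_stop.
pose mis := ohead w != Some d.
have [k' [h1 [h2 h3]]] := IH (behead w) (mis + k).
exists k'; split; last first.
  split; first by move: h2; rewrite /mis /=; case: (_ != _) => /=; lia.
  rewrite h3 /mis; case: w {h1 h2 h3 IH} @mis => [|e w] /=; first by rewrite andbF.
  rewrite eqseq_cons [d == e]eq_sym (inj_eq (@Some_inj _)).
  by case: (e == d) => /=; rewrite ?andbT ?andbF ?addn0 ?add0n.
apply: (execs_weak (n := (6 + (1 + 1)) + (10 * size u + 1) + 2)); last by rewrite /=; lia.
apply: execs_while => //; last first.
  by move: h1; rewrite (_ : drop (size (d :: u)) w = drop (size u) (behead w)); [apply|case: w {h2 h3 IH} @mis].
apply: (execs_seq (s1 := (x, m, map inr (d :: u), map inr w, nseq (mis + k) T))); last first.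
  rewrite -behead_map.
  exact: (execs_seq (execs_pop _ _) (execs_pop _ _)).
rewrite /mis; clear; apply: execs_if; case: d; apply: execs_if.
  by case: w => [|[] w]; [exact: execs_push|exact: execs_nop|exact: execs_push].
by case: w => [|[] w]; [exact: execs_push|exact: execs_push|exact: execs_nop].
Qed.

Definition eq_trees :=
  Seq (Seq (move_tree true) (move_tree false))
  (Seq cmp_loop
  (Seq (If TmpB isSome (Push Cnt T) (Nop _))
  (Seq (pour TmpB (fun _ => Nop _))
       (If Cnt isSome (Seq (pour Cnt (fun _ => Nop _)) (push_tree (bool_tree false)))
                      (push_tree (bool_tree true)))))).

Lemma eq_trees_spec t u r : exists2 b : bool,
  execs eq_trees (main_store (code t ++ code u ++ r)) (50 * (tsize t + tsize u) + 50)
    (main_store (code (bool_tree b) ++ r)) & b <-> t = u.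
Proof.
have [k [h1 [h2 h3]]] := cmp_loop_spec [::] r (rev (bits t)) (rev (bits u)) 0.
set w := drop _ _ in h1.
have st : size (bits t) = tsize t by rewrite size_map size_code.
have su : size (bits u) = tsize u by rewrite size_map size_code.
have sw : size w <= tsize u by rewrite size_drop size_rev su leq_subr.
(* A remainder [w] on [TmpB] means that the second code is longer; it counts as one more
   mismatch. *)
pose k' := (w != [::]) + k.
exists (k' == 0).
  rewrite size_rev st in h1 h2.
  apply: (execs_weak (n := ((9 * tsize t + 3) + (9 * tsize u + 3)) + ((10 * tsize t + 1) +
     (4 + ((9 * size w + 1) + ((9 * (1 + tsize t) + 1) + 8)))))); last by lia.
  apply: (execs_seq (execs_seq (@move_tree_spec true t [::] (code u ++ r) [::] [::])
     (@move_tree_spec false u [::] r [::] _))); rewrite !cats0 /tmp_store /=.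
  rewrite !rev_code.
  apply: (execs_seq h1).
  apply: (execs_seq (s1 := ([::], r, [::], map inr w, nseq k' T))).
    apply: execs_if; rewrite /k' /=; case: (w) => [|c w'] /=; first exact: execs_nop.
    exact: execs_push.
  apply: (execs_seq (clear_spec (w := w) _)) => //=.
  apply: (execs_weak (n := ((9 * size (nseq k' true) + 1) + 6).+2)); last first.
    by rewrite size_nseq /k'; case: (_ != _) => /=; lia.
  apply: execs_if => /=; case: (k') => [|k1] /=.
    apply: (execs_weak (push_tree_spec _ _)) => /=; lia.
  apply: execs_seq; first by apply: (clear_spec (w := nseq k1.+1 true)); rewrite map_nseq.
  exact: (execs_weak (push_tree_spec _ _)).
have -> : (k' == 0) = (rev (bits t) == rev (bits u)).
  rewrite /k' addn_eq0 h3 /= eqb0 negbK.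
  apply/andP/eqP => [[/eqP hw /eqP e]|e].
    by rewrite -[RHS](cat_take_drop (size (rev (bits t)))) -/w hw cats0.
  by rewrite /w -e drop_size take_size !eqxx.
split=> [/eqP /(congr1 rev)|->]; last by rewrite eqxx.
by rewrite !revK => e; apply: code_inj; rewrite !code_bits e.
Qed.

End Gadgets.

(** * Functions computable in polynomial time *)

(** With a base of at least 2, a large enough exponent absorbs constants, and one extra exponent
    absorbs the doubling that comes from a sum. A single number thus describes a polynomial
    bound. *)
Definition pw k n := n.+2 ^ k.

Definition poly (G : nat -> nat) := exists k, forall n, G n <= pw k n.

Lemma pw_leq k n m : n <= m -> pw k n <= pw k m.
Proof. by move=> le; rewrite /pw; case: k => // k; rewrite leq_exp2r. Qed.

Lemma leq_pw k l n : k <= l -> pw k n <= pw l n.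
Proof. by move=> le; rewrite leq_exp2l. Qed.

Lemma poly_pw k : poly (pw k).
Proof. by exists k. Qed.

Lemma poly_const c : poly (fun _ => c).
Proof.
exists c => n; apply: leq_trans (ltnW (ltn_expl c (isT : 1 < 2))) _.
by rewrite /pw; case: c => // c; rewrite leq_exp2r.
Qed.

Lemma poly_id : poly (fun n => n).
Proof. by exists 1 => n; rewrite /pw expn1 -addn2 leq_addr. Qed.

Lemma poly_mul F G : poly F -> poly G -> poly (fun n => F n * G n).
Proof.
by case=> k hk [l hl]; exists (k + l) => n; rewrite /pw expnD leq_mul // ?hk ?hl.
Qed.

Lemma poly_add F G : poly F -> poly G -> poly (fun n => F n + G n).
Proof.
case=> k hk [l hl]; exists (k + l).+1 => n; rewrite /pw expnS.
have h1 : F n <= n.+2 ^ (k + l) by apply: leq_trans (hk n) (leq_pw _ (leq_addr _ _)).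
have h2 : G n <= n.+2 ^ (k + l) by apply: leq_trans (hl n) (leq_pw _ (leq_addl _ _)).
by apply: leq_trans (leq_add h1 h2) _; rewrite addnn -mul2n leq_mul.
Qed.

Lemma poly_succ F : poly F -> poly (fun n => (F n).+1).
Proof. by move=> h; have := poly_add h (poly_const 1); case=> k hk; exists k => n; rewrite -addn1. Qed.

Lemma poly_exp F k : poly F -> poly (fun n => F n ^ k).
Proof.
move=> h; elim: k => [|k IH]; first exact: (poly_const 1).
by have [l hl] := poly_mul h IH; exists l => n; rewrite expnS.
Qed.

Lemma poly_comp_pw k F : poly F -> poly (fun n => pw k (F n)).
Proof. by move=> h; apply: poly_exp; do 2!apply: poly_succ. Qed.

Ltac poly_tac :=
  repeat first [ assumption | apply: poly_const | apply: poly_id | apply: poly_pw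
    | apply: poly_comp_pw | apply: poly_mul | apply: poly_add | apply: poly_succ ].

(** * Encodings of data as trees *)

Class data (X : Type) := Data { enc : X -> tree; enc_inj : injective enc }.

Fixpoint nat_tree n := if n is n'.+1 then Node Leaf (nat_tree n') else Leaf.

Lemma nat_tree_inj : injective nat_tree.
Proof. by elim=> [|n IH] [|m] // [/IH ->]. Qed.

Lemma bool_tree_inj : injective bool_tree.
Proof. by case; case. Qed.

#[export] Instance bool_data : data bool := Data bool_tree_inj.

(** Unary ranks are affordable because the type is fixed: all sizes stay below a constant. *)
Definition fin_tree (T : finType) (x : T) := nat_tree (enum_rank x).

Lemma fin_tree_inj (T : finType) : injective (@fin_tree T).
Proof. by move=> x y /nat_tree_inj /val_inj /enum_rank_inj. Qed.

#[export] Instance tree_data : data tree := Data (@inj_id tree).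

Section Encodings.
Context {X Y : Type} {dX : data X} {dY : data Y}.

Definition pair_tree (z : X * Y) := Node (enc z.1) (enc z.2).

Lemma pair_tree_inj : injective pair_tree.
Proof. move=> [a b] [c d]; rewrite /pair_tree /=; by case=> h1 h2; rewrite (enc_inj h1) (enc_inj h2). Qed.

Definition seq_tree (l : seq X) := foldr (fun x t => Node (enc x) t) Leaf l.

Lemma seq_tree_inj : injective seq_tree.
Proof. by elim=> [|x l IH] [|y m] // [h /IH ->]; rewrite (enc_inj h). Qed.

End Encodings.

#[export] Instance pair_data X Y (dX : data X) (dY : data Y) : data (X * Y) :=
  Data pair_tree_inj.
#[export] Instance seq_data X (dX : data X) : data (seq X) := Data seq_tree_inj.

Definition sz {X} {dX : data X} (x : X) := tsize (enc x).

Lemma sz_gt0 {X} {dX : data X} (x : X) : 0 < sz x.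
Proof. exact: tsize_gt0. Qed.

Lemma sz_pair {X Y} {dX : data X} {dY : data Y} (x : X) (y : Y) : sz (x, y) = (sz x + sz y).+1.
Proof. by []. Qed.

Lemma sz_fst {X Y} {dX : data X} {dY : data Y} (z : X * Y) : sz z.1 <= sz z.
Proof. by case: z => x y; rewrite sz_pair /=; lia. Qed.

Lemma sz_nil {X} {dX : data X} : sz ([::] : seq X) = 1.
Proof. by []. Qed.

Lemma sz_cons {X} {dX : data X} (x : X) l : sz (x :: l) = (sz x + sz l).+1.
Proof. by []. Qed.

Lemma sz_bool (b : bool) : sz b <= 3.
Proof. by case: b. Qed.

Lemma size_sz {X} {dX : data X} (l : seq X) : size l <= sz l.
Proof. by elim: l => //= y l IH; rewrite sz_cons; lia. Qed.

Lemma sz_cat {X} {dX : data X} (l m : seq X) : sz (l ++ m) <= sz l + sz m.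
Proof. by elim: l => [|x l IH]; rewrite /= ?sz_nil ?sz_cons; lia. Qed.

Lemma sz_behead {X} {dX : data X} (l : seq X) : sz (behead l) <= sz l.
Proof. by case: l => //= x l; rewrite sz_cons; lia. Qed.

Lemma sz_head {X} {dX : data X} (x : X) (l : seq X) : sz (head x l) <= sz x + sz l.
Proof. by case: l => [|y l] /=; rewrite ?sz_cons; lia. Qed.

Lemma sz_filter {X} {dX : data X} a (l : seq X) : sz (filter a l) <= sz l.
Proof. by elim: l => //= x l IH; case: ifP; rewrite !sz_cons; lia. Qed.

(* Leaving the rest [r] of the main stack untouched is what makes such programs
   composable. *)
Definition polyfun {X Y} {dX : data X} {dY : data Y} (f : X -> Y) :=
  exists p k, forall x, sz (f x) <= pw k (sz x) /\
    forall r, execs p (main_store (code (enc x) ++ r)) (pw k (sz x))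
                      (main_store (code (enc (f x)) ++ r)).

Section PolyFun.
Context {X : Type} {dX : data X}.

Lemma polyfun_intro {Y} {dY : data Y} (f : X -> Y) p G : poly G ->
  (forall x, sz (f x) <= G (sz x)) ->
  (forall x r, execs p (main_store (code (enc x) ++ r)) (G (sz x))
                      (main_store (code (enc (f x)) ++ r))) ->
  polyfun f.
Proof.
move=> [k hk] h1 h2; exists p, k => x; split; first exact: leq_trans (h1 x) (hk _).
by move=> r; exact: execs_weak (h2 x r) (hk _).
Qed.

Lemma pf_comp {Y Z} {dY : data Y} {dZ : data Z} (g : Y -> Z) (f : X -> Y) :
  polyfun g -> polyfun f -> polyfun (fun x => g (f x)).
Proof.
move=> [q [l hq]] [p [k hp]].
apply: (@polyfun_intro _ _ _ (Seq p q) (fun n => pw k n + pw l (pw k n))); first by poly_tac.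
  move=> x; have [h1 _] := hp x; have [h2 _] := hq (f x).
  by apply: leq_trans h2 _; apply: leq_trans (pw_leq _ h1) _; rewrite leq_addl.
move=> x r; have [h1 h1'] := hp x; have [_ h2] := hq (f x).
apply: execs_seq (h1' r) _; apply: execs_weak (h2 r) _; exact: pw_leq.
Qed.

Lemma pf_recode {Y} {dY : data Y} (f : X -> Y) : (forall x, enc (f x) = enc x) -> polyfun f.
Proof.
move=> h; apply: (@polyfun_intro _ _ _ (Nop _) (fun n => n)); first by poly_tac.
  by move=> x; rewrite /sz h.
by move=> x r; rewrite h; exact: execs_nop.
Qed.

Lemma pf_id : polyfun (fun x : X => x).
Proof. exact: pf_recode. Qed.

Lemma pf_const {Y} {dY : data Y} (y : Y) : polyfun (fun _ : X => y).
Proof.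
apply: (@polyfun_intro _ _ _ (Seq drop_top (push_tree (enc y))) (fun n => (18 * n + 4) + 2 * sz y)).
- by poly_tac.
- by move=> x; lia.
by move=> x r; apply: execs_seq (drop_top_spec _ _) (push_tree_spec _ _).
Qed.

Section Nodes.
Context {Y Z V : Type} {dY : data Y} {dZ : data Z} {dV : data V}.

(** The argument is duplicated, each copy is transformed while on top of the stack, and one node
    mark joins the results. Asking only for the shape of the encoding makes pairs, lists, successors
    and symbols instances of the same lemma. *)
Lemma pf_node (f : X -> Y) (g : X -> Z) (h : X -> V) :
  (forall x, enc (h x) = Node (enc (f x)) (enc (g x))) -> polyfun f -> polyfun g -> polyfun h.
Proof.
move=> e [p [k hp]] [q [l hq]].
apply: (@polyfun_intro _ _ _ (Seq dup (Seq p (Seq swap (Seq q (Seq swap (Push Main (inr true)))))))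
  (fun n => (36 * n + 6) + (pw k n + ((18 * (pw k n + n) + 8) + (pw l n + ((18 * (pw l n + pw k n) + 8) + 2)))))).
- by poly_tac.
- by move=> x; rewrite /sz e /=; have [] := hp x; have [] := hq x; rewrite /sz; lia.
move=> x r; have [h1 h1'] := hp x; have [h2 h2'] := hq x.
rewrite /sz in h1 h1' h2 h2' *.
apply: execs_seq (dup_spec _ _) _.
apply: execs_seq (h1' _) _.
apply: (execs_seq (execs_weak (swap_spec _ _ _) _)); first by lia.
apply: execs_seq (h2' _) _.
apply: (execs_seq (execs_weak (swap_spec _ _ _) _)); first by lia.
by rewrite e /= -catA; exact: execs_push.
Qed.

(** As with [pf_right], only the shape of the encoding counts, so these two yield not only the
    projections of pairs but also [head], [behead] and the predecessor, once the degenerate case has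
    been padded to a node. *)
Lemma pf_left (f : X -> Y) (g : X -> Z) :
  (forall x, exists t, enc (f x) = Node (enc (g x)) t) -> polyfun f -> polyfun g.
Proof.
move=> e [p [k hp]].
apply: (@polyfun_intro _ _ _ (Seq p (Seq (Pop _ Main) (Seq swap drop_top)))
  (fun n => pw k n + (1 + ((18 * pw k n + 8) + (18 * pw k n + 4))))).
- by poly_tac.
- by move=> x; have [h1 _] := hp x; have [t et] := e x; move: h1; rewrite /sz et /=; lia.
move=> x r; have [h1 h1'] := hp x; have [t et] := e x.
have h3 : (tsize (enc (g x)) + tsize t).+1 <= pw k (sz x) by move: h1; rewrite /sz et.
apply: execs_seq (h1' _) _.
apply: execs_seq (execs_pop _ _) _; rewrite et /= -catA.
apply: (execs_seq (execs_weak (swap_spec _ _ _) _)); first by lia.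
by apply: execs_weak (drop_top_spec _ _) _; lia.
Qed.

Lemma pf_right (f : X -> Y) (g : X -> Z) :
  (forall x, exists t, enc (f x) = Node t (enc (g x))) -> polyfun f -> polyfun g.
Proof.
move=> e [p [k hp]].
apply: (@polyfun_intro _ _ _ (Seq p (Seq (Pop _ Main) drop_top))
  (fun n => pw k n + (1 + (18 * pw k n + 4)))).
- by poly_tac.
- by move=> x; have [h1 _] := hp x; have [t et] := e x; move: h1; rewrite /sz et /=; lia.
move=> x r; have [h1 h1'] := hp x; have [t et] := e x.
have h3 : (tsize t + tsize (enc (g x))).+1 <= pw k (sz x) by move: h1; rewrite /sz et.
apply: execs_seq (h1' _) _.
apply: execs_seq (execs_pop _ _) _; rewrite et /= -catA.
by apply: execs_weak (drop_top_spec _ _) _; lia.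
Qed.

Lemma pf_is_node (f : X -> Y) (b : X -> bool) :
  (forall x, b x = if enc (f x) is Node _ _ then true else false) -> polyfun f -> polyfun b.
Proof.
move=> e [p [k hp]].
apply: (@polyfun_intro _ _ _
  (Seq p (If Main (@accepting char) (Seq drop_top (push_tree (bool_tree true)))
                                    (Seq drop_top (push_tree (bool_tree false)))))
  (fun n => pw k n + (((18 * pw k n + 4) + 6).+2))).
- by poly_tac.
- by move=> x; apply: leq_trans (sz_bool _) _; lia.
move=> x r; have [h1 h1'] := hp x.
apply: execs_seq (h1' _) _.
have {}h1 : tsize (enc (f x)) <= pw k (sz x) := h1.
apply: execs_if; rewrite /= e; case: (enc (f x)) h1 => [|t u] /= h1.
  apply: (execs_seq (execs_weak (drop_top_spec Leaf _) _)) => /=; first by lia.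
  exact: execs_weak (push_tree_spec _ _) _.
by apply: (execs_seq (execs_weak (drop_top_spec (Node t u) _) _) (push_tree_spec _ _)) => /=; lia.
Qed.

Lemma pf_if (b : X -> bool) (f g : X -> Y) :
  polyfun b -> polyfun f -> polyfun g -> polyfun (fun x => if b x then f x else g x).
Proof.
move=> [pb [kb hb]] [p [k hp]] [q [l hq]].
(* The answer [true] occupies three symbols of the stack and [false] one, hence three pops against
   one. *)
apply: (@polyfun_intro _ _ _ (Seq dup (Seq pb (If Main (@accepting char)
    (Seq (Seq (Pop _ Main) (Seq (Pop _ Main) (Pop _ Main))) p) (Seq (Pop _ Main) q))))
  (fun n => (36 * n + 6) + (pw kb n + (3 + (pw k n + pw l n)).+2))).
- by poly_tac.
- by move=> x; have [+ _] := hp x; have [+ _] := hq x; case: ifP; lia.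
move=> x r; have [_ h1] := hp x; have [_ h2] := hq x; have [_ h3] := hb x.
apply: execs_seq (dup_spec _ _) _; apply: execs_seq (h3 _) _.
apply: execs_if; case: (b x) => /=.
  apply: execs_seq; last by apply: execs_weak (h1 _) _; lia.
  exact: (execs_seq (execs_pop _ _) (execs_seq (execs_pop _ _) (execs_pop _ _))).
apply: (execs_weak (n := 1 + (2 + (pw k (sz x) + pw l (sz x))))); last by lia.
apply: execs_seq (execs_pop _ _) _.
by apply: execs_weak (h2 _) _; lia.
Qed.

End Nodes.

Lemma pf_pair {Y Z} {dY : data Y} {dZ : data Z} (f : X -> Y) (g : X -> Z) :
  polyfun f -> polyfun g -> polyfun (fun x => (f x, g x)).
Proof. exact: pf_node. Qed.

Lemma pf_fst {Y Z} {dY : data Y} {dZ : data Z} (f : X -> Y * Z) :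
  polyfun f -> polyfun (fun x => (f x).1).
Proof. by apply: pf_left => x; exists (enc (f x).2). Qed.

Lemma pf_snd {Y Z} {dY : data Y} {dZ : data Z} (f : X -> Y * Z) :
  polyfun f -> polyfun (fun x => (f x).2).
Proof. by apply: pf_right => x; exists (enc (f x).1). Qed.

Lemma pf_cons {Y} {dY : data Y} (f : X -> Y) (g : X -> seq Y) :
  polyfun f -> polyfun g -> polyfun (fun x => f x :: g x).
Proof. exact: pf_node. Qed.

Lemma pf_eq {Y : eqType} {dY : data Y} (f g : X -> Y) :
  polyfun f -> polyfun g -> polyfun (fun x => f x == g x).
Proof.
move=> hf hg; have h : polyfun (fun z : Y * Y => z.1 == z.2).
  pose p := Seq (Pop char Main) eq_trees.
  have [k hk] : poly (fun n => 1 + (50 * n + 50)) by poly_tac.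
  exists p, k => -[y1 y2]; split; first by apply: leq_trans (sz_bool _) (leq_trans _ (hk _)); lia.
  move=> r; apply: execs_weak (hk _).
  apply: execs_seq (execs_pop _ _) _ => /=; rewrite -catA.
  have [b h1 h2] := eq_trees_spec (enc y1) (enc y2) r.
  have -> : (y1 == y2) = b.
    by apply/idP/idP => [/eqP e|/h2 e]; [apply/h2; rewrite e|apply/eqP; exact: enc_inj].
  by apply: execs_weak h1 _; rewrite sz_pair /sz; lia.
exact: (pf_comp (f := fun x => (f x, g x)) h (pf_pair hf hg)).
Qed.

Lemma pf_nilp {Y} {dY : data Y} (f : X -> seq Y) : polyfun f -> polyfun (fun x => nilp (f x)).
Proof.
move=> hf; have h : polyfun (fun x => ~~ nilp (f x)).
  by apply: pf_is_node hf => x; case: (f x).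
rewrite (_ : (fun x => _) = fun x => if ~~ nilp (f x) then false else true).
  by apply: pf_if => //; exact: pf_const.
by apply/funext => x; case: nilp.
Qed.

Lemma pf_head {Y} {dY : data Y} (y : X -> Y) (f : X -> seq Y) :
  polyfun y -> polyfun f -> polyfun (fun x => head (y x) (f x)).
Proof.
move=> hy hf.
have h : polyfun (fun x => if nilp (f x) then [:: y x] else f x).
  by apply: pf_if => //; [exact: pf_nilp|apply: pf_cons hy _; exact: pf_const].
by apply: pf_left h => x; case: (f x) => [|z l]; eexists.
Qed.

End PolyFun.

Lemma pf_behead {X Y} {dX : data X} {dY : data Y} (f : X -> seq Y) :
  polyfun f -> polyfun (fun x => behead (f x)).
Proof.
move=> hf.
(* For the empty list a dummy node is supplied whose right child encodes the empty list. As no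
   element of [Y] is at hand, the dummy is a tree and not a list. *)
have hh : polyfun (fun x => if nilp (f x) then Node Leaf Leaf else enc (f x)).
  apply: pf_if; [exact: pf_nilp|exact: pf_const|].
  have he : polyfun (fun l : seq Y => enc l) by exact: pf_recode.
  exact: (pf_comp he hf).
by apply: pf_right hh => x; case: (f x) => [|z l]; eexists.
Qed.

(** * Folds in polynomial time *)

Section Loop.
Context {E S T : Type} {dE : data E} {dS : data S} {dT : data T}.

(** A polynomial bound on one step does not bound its iterates, so the size of all intermediate
    states, obtained from the prefixes of the list, is a hypothesis. Given it, each turn costs a
    polynomial in the size of the environment. *)
Lemma pf_foldl_bound (step : E -> S -> T -> S) (s0 : E -> S) (l : E -> seq T) G :
  polyfun (fun z : E * (S * T) => step z.1 z.2.1 z.2.2) -> polyfun s0 -> polyfun l ->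
  poly G ->
  (forall e k, sz (foldl (step e) (s0 e) (take k (l e))) <= G (sz e)) ->
  polyfun (fun e => foldl (step e) (s0 e) (l e)).
Proof.
move=> hstep hs0 hl hG hb.
have [p0 [k0 h0]] : polyfun (fun e => (l e, (e, s0 e))).
  by apply: pf_pair => //; apply: pf_pair => //; exact: pf_id.
have [p [k hp]] : polyfun (fun z : (T * seq T) * (E * S) =>
    (z.1.2, (z.2.1, step z.2.1 z.2.2 z.1.1))).
  apply: pf_pair; first by apply: pf_snd; apply: pf_fst; exact: pf_id.
  apply: pf_pair; first by apply: pf_fst; apply: pf_snd; exact: pf_id.
  apply: (pf_comp (g := fun z : E * (S * T) => step z.1 z.2.1 z.2.2)
    (f := fun z : (T * seq T) * (E * S) => (z.2.1, (z.2.2, z.1.1)))) => //.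
  apply: pf_pair; first by apply: pf_fst; apply: pf_snd; exact: pf_id.
  apply: pf_pair; first by apply: pf_snd; apply: pf_snd; exact: pf_id.
  by apply: pf_fst; apply: pf_fst; exact: pf_id.
(* The rest of the list lies above the pair of environment and state. A node mark on top joins them
   into one datum for [p], and the mark of the result is removed again. The loop test reads the
   first symbol of the list, which is a node mark exactly when the list is nonempty. *)
pose body := Seq (Push Main (inr true)) (Seq p (Pop char Main)).
pose loop := While Main (@accepting char) body.
pose B n := pw k0 n + (n + G n) + 2.
have loop_spec e r m s : (forall i, sz (foldl (step e) s (take i m)) <= G (sz e)) ->
    sz m <= pw k0 (sz e) ->
    execs loop (main_store (code (enc m) ++ code (enc (e, s)) ++ r))
      (size m * (pw k (B (sz e)) + 5) + 1)
      (main_store (inr false :: code (enc (e, foldl (step e) s m)) ++ r)).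
  elim: m s => [|t m IH] s hm lm; first exact: execs_while_stop.
  have szs : sz s <= G (sz e) by have := hm 0; rewrite take0.
  apply: (execs_weak (n := (2 + (pw k (B (sz e)) + 1)) + (size m * (pw k (B (sz e)) + 5) + 1) + 2));
    last by rewrite /= mulSn; lia.
  apply: execs_while => //; last first.
    apply: (IH (step e s t)); last by move: lm; rewrite sz_cons; lia.
    by move=> i; exact: (hm i.+1).
  apply: execs_seq (execs_push _ _ _) _.
  have [_ h1] := hp ((t, m), (e, s)).
  apply: (execs_seq (s1 := main_store (code (enc (m, (e, step e s t))) ++ r))).
    apply: (execs_weak (n := pw k (sz ((t, m), (e, s))))).
      by have := h1 r; rewrite /= -!catA /= -!catA.
    by apply: pw_leq; rewrite /B !sz_pair; move: lm; rewrite sz_cons; lia.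
  by rewrite /= -catA; exact: execs_pop.
apply: (@polyfun_intro _ _ _ _ _
  (Seq p0 (Seq (Pop _ Main) (Seq loop (Seq (Pop _ Main) (Seq (Pop _ Main) drop_top)))))
  (fun n => pw k0 n + (1 + ((pw k0 n * (pw k (pw k0 n + (n + G n) + 2) + 5) + 1) +
     (1 + (1 + (18 * n + 4))))) + G n)).
- by poly_tac.
- by move=> e; have := hb e (size (l e)); rewrite take_size; lia.
move=> e r; have [h1 h1'] := h0 e.
have sl : sz (l e) <= pw k0 (sz e) by move: h1; rewrite sz_pair; lia.
apply: (execs_weak (n := pw k0 (sz e) + (1 + ((size (l e) * (pw k (B (sz e)) + 5) + 1) +
     (1 + (1 + (18 * sz e + 4))))))); last first.
  have hm : size (l e) <= pw k0 (sz e) by exact: leq_trans (size_sz _) sl.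
  apply: leq_trans (leq_addr _ _).
  by rewrite !(leq_add2l, leq_add2r) leq_mul2r hm orbT.
apply: execs_seq (h1' r) _.
apply: execs_seq (execs_pop _ _) _; rewrite /= -catA.
apply: (execs_seq (loop_spec e r (l e) (s0 e) (hb e) sl)).
(* What surrounds the final state is removed in this order: the empty list, the node mark of the
   pair, the environment. *)
apply: execs_seq (execs_pop _ _) _; rewrite /= -catA.
apply: execs_seq (execs_pop _ _) _; rewrite /=.
exact: drop_top_spec.
Qed.

(* The increment [G] may depend on the environment and on the current item, but
   not on the state: this is what excludes exponential growth. *)
Lemma pf_foldl (step : E -> S -> T -> S) (s0 : E -> S) (l : E -> seq T) G :
  polyfun (fun z : E * (S * T) => step z.1 z.2.1 z.2.2) -> polyfun s0 -> polyfun l ->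
  poly G ->
  (forall e s t, sz (step e s t) <= sz s + G (sz e + sz t)) ->
  polyfun (fun e => foldl (step e) (s0 e) (l e)).
Proof.
move=> hstep hs0 hl [k hk] hG.
have [p0 [k0 h0]] := hs0; have [p1 [k1 h1]] := hl.
(* The bound is the size of the initial state plus one increment for each item; both the number of
   items and the size of an item are at most [pw k1 n]. *)
apply: (pf_foldl_bound (G := fun n => pw k0 n + pw k1 n * pw k (n + pw k1 n))) => //.
  by poly_tac.
move=> e i; have [h0' _] := h0 e; have [h1' _] := h1 e.
have ht : sz (take i (l e)) <= sz (l e).
  by elim: (l e) {h1'} i => [|t m IH] [|i] //=; rewrite ?sz_cons ?sz_nil; have := IH i; lia.
have : sz (take i (l e)) <= pw k1 (sz e) by exact: leq_trans ht h1'.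
move: (take i (l e)) => m {ht h1'} hm.
apply: leq_trans (_ : sz (s0 e) + size m * pw k (sz e + pw k1 (sz e)) <= _); last first.
  by rewrite leq_add // leq_mul // (leq_trans (size_sz m)).
elim: m (s0 e) hm {h0'} => [|t m IH] s hm /=; first by rewrite mul0n addn0.
have hm' : sz m <= pw k1 (sz e) /\ sz t <= pw k1 (sz e) by move: hm; rewrite sz_cons; lia.
apply: leq_trans (IH _ (proj1 hm')) _.
have h1' := leq_trans (hG e s t) (leq_add (leqnn _) (hk _)).
have h2' : pw k (sz e + sz t) <= pw k (sz e + pw k1 (sz e)) by apply: pw_leq; lia.
by rewrite mulSn; lia.
Qed.

End Loop.

Ltac proj := repeat first [exact: pf_id | apply: pf_fst | apply: pf_snd].

(** * Closure under Boolean operations, list operations and case distinction *)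

Section Booleans.
Context {E : Type} {dE : data E}.

Lemma pf_andb (a b : E -> bool) : polyfun a -> polyfun b -> polyfun (fun e => a e && b e).
Proof. by move=> ha hb; apply: (pf_if (f := b)) ha hb _; exact: pf_const. Qed.

Lemma pf_orb (a b : E -> bool) : polyfun a -> polyfun b -> polyfun (fun e => a e || b e).
Proof. by move=> ha hb; apply: (pf_if (g := b)) ha _ hb; exact: pf_const. Qed.

Lemma pf_implb (a b : E -> bool) : polyfun a -> polyfun b -> polyfun (fun e => a e ==> b e).
Proof. by move=> ha hb; apply: (pf_if (f := b)) ha hb _; exact: pf_const. Qed.

Lemma pf_negb (a : E -> bool) : polyfun a -> polyfun (fun e => ~~ a e).
Proof. by move=> ha; apply: pf_if ha _ _; exact: pf_const. Qed.

Lemma pf_ext {Y} {dY : data Y} (f g : E -> Y) : f =1 g -> polyfun f -> polyfun g.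
Proof. by move/funext=> ->. Qed.

End Booleans.

Section Lists.
Context {E T : Type} {dE : data E} {dT : data T}.
Implicit Types (l : E -> seq T).

Lemma pf_rev l : polyfun l -> polyfun (fun e => rev (l e)).
Proof.
move=> hl; apply: (@pf_ext _ _ _ _ (fun e => foldl (fun s x => x :: s) [::] (l e))).
  by move=> e; rewrite /rev; elim: (l e) [::] => /=.
apply: (pf_foldl (E := E) (step := fun _ s x => x :: s) (G := fun n => n.+1)) => //.
- by apply: pf_cons; proj.
- exact: pf_const.
- by poly_tac.
- by move=> e s t; rewrite sz_cons; lia.
Qed.

Lemma pf_cat l m : polyfun l -> polyfun m -> polyfun (fun e => l e ++ m e).
Proof.
move=> hl hm; apply: (@pf_ext _ _ _ _ (fun e => foldl (fun s x => x :: s) (m e) (rev (l e)))).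
  by move=> e; rewrite foldl_rev; elim: (l e) => //= x s ->.
apply: (pf_foldl (step := fun _ s x => x :: s) (G := fun n => n.+1)) => //.
- by apply: pf_cons; proj.
- exact: pf_rev.
- by poly_tac.
- by move=> e s t; rewrite sz_cons; lia.
Qed.

End Lists.

Section Iterators.
Context {E T U : Type} {dE : data E} {dT : data T} {dU : data U}.
Implicit Types (l : E -> seq T).

Lemma pf_all (f : E -> T -> bool) l :
  polyfun (fun z : E * T => f z.1 z.2) -> polyfun l -> polyfun (fun e => all (f e) (l e)).
Proof.
move=> hf hl; apply: (@pf_ext _ _ _ _ (fun e => foldl (fun b x => b && f e x) true (l e))).
  move=> e; rewrite -[RHS]andTb; elim: (l e) true => [|x s IH] b /=; first by rewrite andbT.
  by rewrite IH andbA.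
apply: (pf_foldl (step := fun e b x => b && f e x) (G := fun _ => 3)) => //.
- apply: pf_andb; first by proj.
  apply: (pf_comp (f := fun z : E * (bool * T) => (z.1, z.2.2)) hf).
  apply: pf_pair; first by proj.
  by proj.
- exact: pf_const.
- by poly_tac.
- by move=> e s t; apply: leq_trans (sz_bool _) _; rewrite leq_addl.
Qed.

Lemma pf_has (f : E -> T -> bool) l :
  polyfun (fun z : E * T => f z.1 z.2) -> polyfun l -> polyfun (fun e => has (f e) (l e)).
Proof.
move=> hf hl; apply: (@pf_ext _ _ _ _ (fun e => ~~ all (fun x => ~~ f e x) (l e))).
  by move=> e; rewrite -has_predC; apply: eq_has => x /=; rewrite negbK.
by apply: pf_negb; apply: pf_all => //; exact: pf_negb.
Qed.

Lemma pf_map (f : E -> T -> U) l :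
  polyfun (fun z : E * T => f z.1 z.2) -> polyfun l -> polyfun (fun e => [seq f e x | x <- l e]).
Proof.
move=> hf hl; apply: (@pf_ext _ _ _ _ (fun e => rev (foldl (fun s x => f e x :: s) [::] (l e)))).
  move=> e; rewrite -[RHS]cat0s -[X in X ++ _]/(rev [::]); elim: (l e) [::] => [|x s IH] b /=.
    by rewrite cats0.
  by rewrite IH rev_cons cat_rcons.
have [p [k hk]] := hf; apply: pf_rev.
apply: (pf_foldl (step := fun e s x => f e x :: s) (G := fun n => (pw k n.+1).+1)) => //.
- apply: pf_cons; last by proj.
  apply: (pf_comp (f := fun z : E * (seq U * T) => (z.1, z.2.2)) hf).
  apply: pf_pair; first by proj.
  by proj.
- exact: pf_const.
- by poly_tac.
- by move=> e s t; rewrite sz_cons; have [h _] := hk (e, t); move: h; rewrite sz_pair /=; lia.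
Qed.

Lemma pf_filter (f : E -> T -> bool) l :
  polyfun (fun z : E * T => f z.1 z.2) -> polyfun l -> polyfun (fun e => [seq x <- l e | f e x]).
Proof.
move=> hf hl.
apply: (@pf_ext _ _ _ _ (fun e => rev (foldl (fun s x => if f e x then x :: s else s) [::] (l e)))).
  move=> e; rewrite -[RHS]cat0s -[X in X ++ _]/(rev [::]); elim: (l e) [::] => [|x s IH] b /=.
    by rewrite cats0.
  by rewrite IH; case: ifP => //; rewrite rev_cons cat_rcons.
apply: pf_rev.
apply: (pf_foldl (step := fun e s x => if f e x then x :: s else s) (G := fun n => n.+1)) => //.
- apply: pf_if.
  + apply: (pf_comp (f := fun z : E * (seq T * T) => (z.1, z.2.2)) hf).
    apply: pf_pair; first by proj.
    by proj.
  + by apply: pf_cons; proj.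
  + by proj.
- exact: pf_const.
- by poly_tac.
- by move=> e s t; case: ifP; rewrite ?sz_cons; lia.
Qed.

Lemma pf_flatten (l : E -> seq (seq T)) : polyfun l -> polyfun (fun e => flatten (l e)).
Proof.
move=> hl; apply: (@pf_ext _ _ _ _ (fun e => foldl (fun s x => s ++ x) [::] (l e))).
  by move=> e; rewrite -[RHS]cat0s; elim: (l e) [::] => [|x s IH] b /=; rewrite ?cats0 // IH catA.
apply: (pf_foldl (E := E) (step := fun _ s x => s ++ x) (G := fun n => n)) => //.
- by apply: pf_cat; proj.
- exact: pf_const.
- by poly_tac.
- by move=> e s t; apply: leq_trans (sz_cat _ _) _; lia.
Qed.

End Iterators.

Lemma pf_mem {E : Type} {T : eqType} {dE : data E} {dT : data T} (x : E -> T) (l : E -> seq T) :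
  polyfun x -> polyfun l -> polyfun (fun e => x e \in l e).
Proof.
move=> hx hl; apply: (@pf_ext _ _ _ _ (fun e => has (fun y => x e == y) (l e))).
  by move=> e; rewrite -has_pred1; apply: eq_has => y; rewrite /= eq_sym.
apply: pf_has => //; apply: pf_eq; last by proj.
by apply: (pf_comp hx); proj.
Qed.

Lemma pf_uniq {E : Type} {T : eqType} {dE : data E} {dT : data T} (l : E -> seq T) :
  polyfun l -> polyfun (fun e => uniq (l e)).
Proof.
move=> hl.
pose step (_ : E) s (x : T) := (x :: s.1, s.2 && (x \notin s.1)).
apply: (@pf_ext _ _ _ _ (fun e => (foldl (step e) ([::], true) (l e)).2)).
  move=> e; rewrite -rev_uniq.
  suff -> s : foldl (step e) (s, uniq s) (l e) = (catrev (l e) s, uniq (catrev (l e) s)).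
    by [].
  by elim: (l e) s => //= x m IH s; rewrite /step /= andbC IH.
apply: pf_snd; apply: (pf_foldl (step := step) (G := fun n => (n + 4))) => //.
- apply: pf_pair; first by apply: pf_cons; proj.
  apply: pf_andb; first by proj.
  apply: pf_negb; apply: pf_mem; first by proj.
  by proj.
- exact: pf_const.
- by poly_tac.
- move=> e [s b] t; rewrite /step /= !sz_pair sz_cons; have := sz_bool (b && (t \notin s)).
  by have := sz_gt0 b; lia.
Qed.

Section Cases.
Context {E X Y : Type} {dE : data E} {dX : data X} {dY : data Y}.

(** The distinction is a chain of equality tests along the enumeration of [T]; its length is a
    constant, so no uniformity in [c] is required of the functions [F c]. *)
Lemma pf_case {T : finType} (F : T -> E -> Y) (t : E -> T) :
  (forall c, polyfun (F c)) -> @polyfun _ _ _ (Data (@fin_tree_inj T)) t ->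
  polyfun (fun e => F (t e) e).
Proof.
(* If [T] is empty then so is [E], through [t]; otherwise some [c0] supplies the end of the
   chain. *)
move=> hF ht; case: (pickP (fun _ : T => true)) => [c0 _|h]; last first.
  apply: (@polyfun_intro _ _ _ _ _ (Nop _) (fun n => n)); first by poly_tac.
    by move=> e; discriminate (h (t e) : true = false).
  by move=> e; discriminate (h (t e) : true = false).
have [G hG GE] : exists2 G : E -> Y, polyfun G & forall e, t e \in enum T -> G e = F (t e) e.
  elim: (enum T) => [|c s [G hG GE]]; first by exists (F c0).
  exists (fun e => if t e == c then F c e else G e).
    by apply: pf_if => //; apply: pf_eq ht _; exact: pf_const.
  by move=> e; rewrite inE; case: eqP => [-> //|_] /GE.
by apply: pf_ext hG => e; apply: GE; rewrite mem_enum.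
Qed.

End Cases.

#[export] Instance sign_data : data sign := Data (@fin_tree_inj sign).
#[export] Instance osign_data : data (option sign) := Data (@fin_tree_inj (option sign)).
#[export] Instance char_data : data char := Data (@fin_tree_inj char).
#[export] Instance nat_data : data nat := Data nat_tree_inj.

Definition sym_pair (x : symbol) : option sign * bitseq :=
  match x with Sign c => (Some c, [::]) | Name b => (None, b) end.

Lemma sym_pair_inj : injective sym_pair.
Proof. by case=> [c|b] [d|e] //= [->]. Qed.

HB.instance Definition _ := Equality.copy symbol (inj_type sym_pair_inj).

#[export] Instance symbol_data : data symbol :=
  Data (inj_comp (@enc_inj (option sign * bitseq) _) sym_pair_inj).

Lemma pf_symcase {E Y} {dE : data E} {dY : data Y} (F : sign -> E -> Y) (G : E -> bitseq -> Y)
    (x : E -> symbol) :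
  polyfun x -> (forall c, polyfun (F c)) -> polyfun (fun z : E * bitseq => G z.1 z.2) ->
  polyfun (fun e => match x e with Sign c => F c e | Name b => G e b end).
Proof.
move=> hx hF hG.
have hp : polyfun (fun e => sym_pair (x e)).
  have h : polyfun sym_pair by exact: pf_recode.
  exact: (pf_comp h hx).
apply: (@pf_ext _ _ _ _ (fun e =>
  (fun k e => if k is Some c then F c e else G e (sym_pair (x e)).2) (sym_pair (x e)).1 e)).
  by move=> e /=; case: (x e).
apply: (pf_case (F := fun k e => if k is Some c then F c e else G e (sym_pair (x e)).2)
  (t := fun e => (sym_pair (x e)).1)); last exact: pf_fst.
case=> [c|] //.
apply: (pf_comp (f := fun e => (e, (sym_pair (x e)).2)) hG).
by apply: pf_pair; [exact: pf_id|exact: pf_snd].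
Qed.

Lemma pf_Sign {E} {dE : data E} (c : E -> sign) : polyfun c -> polyfun (fun e => Sign (c e)).
Proof.
move=> hc; apply: (pf_node (f := fun e => Some (c e)) (g := fun _ => [::] : bitseq)) => //.
  by apply: (pf_case (F := fun c _ => Some c) (t := c)) => // d; exact: pf_const.
exact: pf_const.
Qed.

Lemma pf_Name {E} {dE : data E} (b : E -> bitseq) : polyfun b -> polyfun (fun e => Name (b e)).
Proof.
move=> hb; apply: (pf_node (f := fun e => None : option sign) (g := b)) => //.
exact: pf_const.
Qed.

Lemma pf_succn {E} {dE : data E} (n : E -> nat) : polyfun n -> polyfun (fun e => (n e).+1).
Proof.
by move=> hn; apply: (pf_node (f := fun e => Leaf) (g := n)) => //; exact: pf_const.
Qed.

Lemma pf_predn {E} {dE : data E} (n : E -> nat) : polyfun n -> polyfun (fun e => (n e).-1).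
Proof.
move=> hn.
have h : polyfun (fun e => if n e == 0 then 1 else n e).
  by apply: pf_if => //; [apply: pf_eq => //|]; exact: pf_const.
by apply: pf_right h => e; exists Leaf; case: (n e).
Qed.

Lemma pf_letp {E A B Y} {dE : data E} {dA : data A} {dB : data B} {dY : data Y}
    (g : E -> A * B) (F : E -> A -> B -> Y) :
  polyfun g -> polyfun (fun z : E * (A * B) => F z.1 z.2.1 z.2.2) ->
  polyfun (fun e => let: (a, b) := g e in F e a b).
Proof.
move=> hg hF; apply: (@pf_ext _ _ _ _ (fun e => F e (g e).1 (g e).2)).
  by move=> e; case: (g e).
by apply: (pf_comp (f := fun e => (e, g e)) hF); apply: pf_pair => //; exact: pf_id.
Qed.

Lemma pf_bit {E} {dE : data E} (d : E -> bool) :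
  polyfun d -> polyfun (fun e => inr (Some (d e)) : char).
Proof.
move=> hd; apply: (@pf_ext _ _ _ _ (fun e => if d e then inr (Some true) else inr (Some false) : char)).
  by move=> e; case: (d e).
by apply: pf_if => //; exact: pf_const.
Qed.

(** A hook of the syntax-directed tactic below, redefined whenever further functions have been shown
    to be polynomial. *)
Ltac pf_user := fail.

Ltac pf1 :=
  cbv beta;
  match goal with
  | |- forall _, _ => intro
  | H : polyfun ?f |- polyfun ?f => exact H
  | |- @polyfun _ _ _ _ (fun _ => ?y) => exact (pf_const y)
  | |- @polyfun _ _ _ _ (fun e => e) => exact pf_id
  | |- @polyfun _ _ _ _ (@fst _ _) => exact (pf_fst pf_id)
  | |- @polyfun _ _ _ _ (@snd _ _) => exact (pf_snd pf_id)
  | |- @polyfun _ _ _ _ (fun e => fst (@?f e)) => apply (@pf_fst _ _ _ _ _ _ f)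
  | |- @polyfun _ _ _ _ (fun e => snd (@?f e)) => apply (@pf_snd _ _ _ _ _ _ f)
  | |- @polyfun _ _ _ _ (fun e => pair (@?f e) (@?g e)) => apply (@pf_pair _ _ _ _ _ _ f g)
  | |- @polyfun _ _ _ _ (fun e => cons (@?f e) (@?g e)) => apply (@pf_cons _ _ _ _ f g)
  | |- @polyfun _ _ _ _ (fun e => Sign (@?f e)) => apply (@pf_Sign _ _ f)
  | |- @polyfun _ _ _ _ (fun e => Name (@?f e)) => apply (@pf_Name _ _ f)
  | |- @polyfun _ _ _ _ (fun e => S (@?f e)) => apply (@pf_succn _ _ f)
  | |- @polyfun _ _ _ _ (fun e => Nat.pred (@?f e)) => apply (@pf_predn _ _ f)
  | |- @polyfun _ _ _ _ (fun e => andb (@?f e) (@?g e)) => apply (@pf_andb _ _ f g)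
  | |- @polyfun _ _ _ _ (fun e => orb (@?f e) (@?g e)) => apply (@pf_orb _ _ f g)
  | |- @polyfun _ _ _ _ (fun e => implb (@?f e) (@?g e)) => apply (@pf_implb _ _ f g)
  | |- @polyfun _ _ _ _ (fun e => nilp (@?l e)) => apply (@pf_nilp _ _ _ _ l)
  | |- @polyfun _ _ _ _ (fun e => negb (@?f e)) => apply (@pf_negb _ _ f)
  | |- @polyfun _ _ _ _ (fun e => eq_op (@?f e) (@?g e)) => apply: (@pf_eq _ _ _ _ f g)
  | |- @polyfun _ _ _ _ (fun e => in_mem (@?f e) (mem (@?l e))) => apply: (@pf_mem _ _ _ _ f l)
  | |- @polyfun _ _ _ _ (fun e => uniq (@?l e)) => apply: (@pf_uniq _ _ _ _ l)
  | |- @polyfun _ _ _ _ (fun e => rev (@?l e)) => apply (@pf_rev _ _ _ _ l)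
  | |- @polyfun _ _ _ _ (fun e => cat (@?l e) (@?m e)) => apply (@pf_cat _ _ _ _ l m)
  | |- @polyfun _ _ _ _ (fun e => behead (@?l e)) => apply (@pf_behead _ _ _ _ l)
  | |- @polyfun _ _ _ _ (fun e => head (@?d e) (@?l e)) => apply (@pf_head _ _ _ _ d l)
  | |- @polyfun _ _ _ _ (fun e => flatten (@?l e)) => apply (@pf_flatten _ _ _ _ l)
  | |- @polyfun _ _ _ _ (fun e => all (@?f e) (@?l e)) => apply: (@pf_all _ _ _ _ f l)
  | |- @polyfun _ _ _ _ (fun e => has (@?f e) (@?l e)) => apply: (@pf_has _ _ _ _ f l)
  | |- @polyfun _ _ _ _ (fun e => filter (@?f e) (@?l e)) => apply: (@pf_filter _ _ _ _ f l)
  | |- @polyfun _ _ _ _ (fun e => map (@?f e) (@?l e)) => apply: (@pf_map _ _ _ _ _ _ f l)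
  | H : polyfun ?h |- @polyfun _ _ _ _ (fun e => ?h (@?g e)) => apply (@pf_comp _ _ _ _ _ _ h g H)
  | |- _ => pf_user
  | |- polyfun _ => apply: pf_if
  | |- polyfun _ => apply: pf_letp
  end.

Ltac pf := repeat pf1.

Lemma sz_rev {X} {dX : data X} (l : seq X) : sz (rev l) = sz l.
Proof.
have h m : sz (catrev l m) + 1 = sz l + sz m.
  by elim: l m => [|x l IH] m /=; rewrite ?IH ?sz_cons ?sz_nil; lia.
by move: (h [::]); rewrite sz_nil /rev; lia.
Qed.

Definition fin_bound (T : finType) := (2 * #|T|).+1.

Lemma sz_fin (T : finType) (x : T) : @sz T (Data (@fin_tree_inj T)) x <= fin_bound T.
Proof.
rewrite /fin_bound /sz /= /fin_tree; have := ltn_ord (enum_rank x); move: (nat_of_ord _) => n.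
suff -> : tsize (nat_tree n) = (2 * n).+1 by move=> h; rewrite ltnS leq_mul2l ltnW.
by elim: n => //= n ->; lia.
Qed.

Notation name := (seq bool).

Definition sym_bound := fin_bound (option sign) + 4.

Lemma sz_Sign c : sz (Sign c) <= sym_bound.
Proof. by rewrite /sz /= /sym_bound /reverse_coercion; have := sz_fin (Some c); rewrite /sz /=; lia. Qed.

Lemma sz_Name (b : name) : sz (Name b) <= sym_bound + sz b.
Proof.
by rewrite /sz /= /sym_bound /reverse_coercion; have := sz_fin (None : option sign); rewrite /sz /=; lia.
Qed.

(** The text is consumed from its end, so the bits of a name are collected before the mark that
    completes it. Bits without a mark are lost, which spelling the result again will reveal. *)
Definition lex_step (s : name * seq symbol) (c : char) : name * seq symbol :=
  match c with
  | inl g => ([::], Sign g :: s.2)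
  | inr None => ([::], Name s.1 :: s.2)
  | inr (Some d) => (d :: s.1, s.2)
  end.

Definition lex (x : seq char) : seq symbol := (foldl lex_step ([::], [::]) x).2.

Lemma pf_lex {E} {dE : data E} (x : E -> seq char) : polyfun x -> polyfun (fun e => lex (x e)).
Proof.
move=> hx; apply: pf_snd.
apply: (pf_foldl (step := fun _ => lex_step) (s0 := fun _ => ([::], [::])) (l := x)
  (G := fun n => sym_bound + 10)) => //.
- apply: (@pf_case _ _ _ _ char (fun c z => lex_step z.2.1 c) (fun z => z.2.2)); last by pf.
  by case=> [c|[d|]] /=; pf.
- by pf.
- by poly_tac.
move=> e [b l] c.
case: c => [g|[d|]] /=; rewrite !sz_pair !sz_cons ?sz_nil.
- by pose proof (sz_Sign g); pose proof (sz_gt0 b); lia.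
- by have hd : @sz bool _ d <= 3 := sz_bool d; lia.
- by pose proof (sz_Name b); lia.
Qed.

Lemma pf_spell {E} {dE : data E} (x : E -> seq symbol) :
  polyfun x -> polyfun (fun e => spell (x e)).
Proof.
move=> hx; apply: pf_flatten; apply: pf_map => //.
apply: (pf_symcase (x := snd) (F := fun c _ => [:: inl c : char])
  (G := fun _ b => (inr None : char) :: [seq (inr (Some (d : bool)) : char) | d <- b]));
  [by pf|by move=> c; pf|].
by pf1; [pf|pf1; [apply: pf_bit; pf|pf]].
Qed.
(** * The decision procedure *)

Notation entry := (seq name * seq name)%type.
(* A token of the Polish notation of a formula: the sign of its operator
   ([SComma] for an atom), its set of agents or skills, and its name. *)
Notation mtok := (sign * (seq name * name))%type.
(* Worlds, edges, capabilities and valuation, in this order. *)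
Notation pmodel := (seq name * (seq entry * (seq entry * seq entry)))%type.

Definition sym_name (x : symbol) : name := if x is Name b then b else [::].

(* Parsing ignores syntax errors: [decide] writes the result again and compares
   it with the input.  The listing is read from left to right: names outside
   parentheses are worlds, and what follows the third graph is kept for later. *)
Definition lstate := (bool * seq name * (seq name * seq name) * (seq entry * seq (seq entry)))%type.

(** Braces occur on two levels. Within an entry the opening brace turns the names read so far into
    the key; a closing brace completes a graph only outside parentheses, which is what [par]
    records. *)
Definition lstep_sign (c : sign) (s : lstate) : lstate :=
  let: (par, ws, (key, cur), (ents, blocks)) := s in
  match c with
  | SLpar => (true, ws, (key, cur), (ents, blocks))
  | SLbrace => (par, ws, (cur, [::]), (ents, blocks))
  | SRpar => (false, ws, ([::], [::]), ((rev key, rev cur) :: ents, blocks))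
  | SRbrace => if par then s else (par, ws, (key, cur), ([::], rev ents :: blocks))
  | _ => s
  end.

Definition lstep_name (b : name) (s : lstate) : lstate :=
  let: (par, ws, (key, cur), eb) := s in
  if par then (par, ws, (key, b :: cur), eb) else (par, b :: ws, (key, cur), eb).

(** The double [behead] is empty as long as at most two graphs are complete. *)
Definition lstep (s : lstate * seq symbol) (x : symbol) : lstate * seq symbol :=
  if nilp (behead (behead s.1.2.2)) then
    match x with Sign c => (lstep_sign c s.1, s.2) | Name b => (lstep_name b s.1, s.2) end
  else (s.1, x :: s.2).

Definition lstate0 : lstate * seq symbol := (false, [::], ([::], [::]), ([::], [::]), [::]).

Definition split_input (ts : seq symbol) := foldl lstep lstate0 ts.

Definition dtok : mtok := (SComma, ([::], [::])).
Definition tok_arg (m : seq mtok) : name := (head dtok m).2.2.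

(* The formula is read from right to left.  A name outside braces is first taken
   for an atom, and absorbed by the sign that it turns out to follow; after the
   sign of a capability modality the next parenthesis is not that of an
   implication, which is what the second flag records. *)
Definition parse_state := (bool * bool * (seq name * seq mtok))%type.

Definition pstep_sign (c : sign) (s : parse_state) : parse_state :=
  let: (inset, skip, (ns, m)) := s in
  match c with
  | SRbrace => (true, skip, ([::], m))
  | SLbrace => (false, skip, (ns, m))
  | SNeg => (inset, skip, (ns, (c, ([::], [::])) :: m))
  | SLpar => if skip then (inset, false, (ns, m)) else (inset, skip, (ns, (SImp, ([::], [::])) :: m))
  | SK => (inset, skip, (ns, (c, ([::], tok_arg m)) :: behead m))
  | SC | SD | SE | SF => (inset, skip, ([::], (c, (ns, [::])) :: m))
  | SPlus | SMinus | SEq => (inset, true, ([::], (c, (ns, tok_arg m)) :: behead m))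
  | SEquiv => (inset, true, (ns, (c, ([:: tok_arg m], tok_arg (behead m))) :: behead (behead m)))
  | _ => s
  end.

Definition pstep_name (b : name) (s : parse_state) : parse_state :=
  let: (inset, skip, (ns, m)) := s in
  if inset then (inset, skip, (b :: ns, m)) else (inset, skip, (ns, (SComma, ([::], b)) :: m)).

Definition pstep (s : parse_state) (x : symbol) : parse_state :=
  match x with Sign c => pstep_sign c s | Name b => pstep_name b s end.

Definition parse_formula (f : seq symbol) : seq mtok :=
  (foldl pstep (false, false, ([::], [::])) (rev f)).2.2.

Definition assemble (s : lstate * seq symbol) : pmodel * (name * seq mtok) :=
  ((rev s.1.1.1.2, (head [::] (behead (behead s.1.2.2)), (head [::] (behead s.1.2.2), head [::] s.1.2.2))),
   (sym_name (head (Name [::]) (rev s.2)), parse_formula (behead (rev s.2)))).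

Definition parse_input (ts : seq symbol) := assemble (split_input ts).

Definition join (xss : seq (seq symbol)) : seq symbol :=
  head [::] xss ++ flatten [seq Sign SComma :: ys | ys <- behead xss].
Definition wset (l : seq name) : seq symbol :=
  Sign SLbrace :: join [seq [:: Name b] | b <- l] ++ [:: Sign SRbrace].
Definition wentry (x : entry) : seq symbol :=
  Sign SLpar :: join [seq [:: Name b] | b <- x.1] ++ Sign SComma :: wset x.2 ++ [:: Sign SRpar].
Definition wgraph (l : seq entry) : seq symbol :=
  Sign SLbrace :: join [seq wentry x | x <- l] ++ [:: Sign SRbrace].
Definition wmodel (M : pmodel) : seq symbol :=
  [seq Name w | w <- M.1] ++ wgraph M.2.1 ++ wgraph M.2.2.1 ++ wgraph M.2.2.2.

Definition wtok_kind (c : sign) (G : seq name) (a : name) (x y : seq symbol) : seq symbol :=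
  match c with
  | SNeg => Sign SNeg :: x
  | SImp => Sign SLpar :: x ++ Sign SImp :: y ++ [:: Sign SRpar]
  | SK => [:: Sign SK, Name a & x]
  | SC | SD | SE | SF => Sign c :: wset G ++ x
  | SPlus | SMinus | SEq => [:: Sign SLpar; Sign c] ++ wset G ++ [:: Sign SRpar, Name a & x]
  | SEquiv => [:: Sign SLpar, Sign SEquiv, Name (head [::] G), Sign SRpar, Name a & x]
  | _ => [:: Name a]
  end.
Definition wtok (t : mtok) := wtok_kind t.1 t.2.1 t.2.2.

Definition pop {R} (c : sign) (st : seq R) : seq R :=
  match c with
  | SImp => behead (behead st)
  | SNeg | SK | SC | SD | SE | SF | SPlus | SMinus | SEq | SEquiv => behead st
  | _ => st
  end.

(** One step of a stack machine that runs through Polish notation from right to left, so that the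
    left operand is on top. Printing, decoding and evaluation are all instances; the default [d]
    makes them total on malformed token lists. *)
Definition reduce {R} (d : R) (op : mtok -> R -> R -> R) (st : seq R) (t : mtok) : seq R :=
  op t (head d st) (head d (behead st)) :: pop t.1 st.

Definition unparse (m : seq mtok) : seq symbol :=
  head [:: Name [::]] (foldl (reduce [:: Name [::]] wtok) [::] (rev m)).

Definition write_parsed (I : pmodel * (name * seq mtok)) : seq symbol :=
  wmodel I.1 ++ Name I.2.1 :: unparse I.2.2.

Definition lookup (k : seq name) (l : seq entry) : seq name :=
  head [::] [seq x.2 | x <- l & x.1 == k].

(* The first component counts the complete subtrees between the current token
   and the position whose ancestors are sought. *)
Definition cstep_kind (c : sign) (t : mtok) (s : nat * seq mtok) : nat * seq mtok :=
  let: (d, acc) := s in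
  match c with
  | SImp => if (d == 0) || (d == 1) then (0, t :: acc) else (d.-1, acc)
  | SNeg | SK | SC | SD | SE | SF | SPlus | SMinus | SEq | SEquiv =>
      if d == 0 then (0, t :: acc) else (d, acc)
  | _ => (d.+1, acc)
  end.
Definition cstep (s : nat * seq mtok) (t : mtok) := cstep_kind t.1 t s.
Definition ancestors (r : seq mtok) : seq mtok := rev (foldl cstep (0, [::]) r).2.

(* State of the walk through the ancestors: the agent followed, whether the
   question is settled, and the answer. *)
Definition icstep_kind (c : sign) (B : seq name) (s : name) (st : name * (bool * bool)) :
    name * (bool * bool) :=
  match c with
  | SPlus => if s \in B then (st.1, (true, true)) else st
  | SMinus => if s \in B then (st.1, (true, false)) else st
  | SEq => (st.1, (true, s \in B))
  | SEquiv => (head [::] B, (false, false))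
  | _ => st
  end.
Definition icstep (s : name) (st : name * (bool * bool)) (t : mtok) : name * (bool * bool) :=
  if st.2.1 then st else if t.2.2 == st.1 then icstep_kind t.1 t.2.1 s st else st.
Definition in_cap (cs : seq entry) (c : seq mtok) (s a : name) : bool :=
  let r := foldl (icstep s) (a, (false, false)) c in
  if r.2.1 then r.2.2 else s \in lookup [:: r.1] cs.

(** A finite range for testing inclusions between sets of skills: a skill can only come from a
    listed capability or from a set named by an ancestor. Names of agents that occur in groups get
    in as well, which is harmless since any finite superset will do. *)
Definition univ (cs : seq entry) (c : seq mtok) : seq name :=
  flatten [seq x.2 | x <- cs] ++ flatten [seq t.2.1 | t <- c].

Definition box_any (M : pmodel) (c : seq mtok) (G Q : seq name) : seq name :=
  [seq w <- M.1 | all (fun u => all (fun s => has (fun a => in_cap M.2.2.1 c s a) G ==>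
     (s \in lookup [:: w; u] M.2.1)) (univ M.2.2.1 c) ==> (u \in Q)) M.1].
Definition box_all (M : pmodel) (c : seq mtok) (G Q : seq name) : seq name :=
  [seq w <- M.1 | all (fun u => all (fun s => all (fun a => in_cap M.2.2.1 c s a) G ==>
     (s \in lookup [:: w; u] M.2.1)) (univ M.2.2.1 c) ==> (u \in Q)) M.1].
Definition box_every (M : pmodel) (c : seq mtok) (G Q : seq name) : seq name :=
  [seq w <- M.1 | all (fun a => w \in box_any M c [:: a] Q) G].
(** The second copy of the list of worlds is used as a counter of iterations only. *)
Definition box_common (M : pmodel) (c : seq mtok) (G Q : seq name) : seq name :=
  foldl (fun X (_ : name) => box_every M c G [seq w <- Q | w \in X]) M.1 M.1.

(** Every value is at most as large as the list of worlds, whatever the operands; the capability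
    modalities filter their operand again to keep this bound. Their effect is not seen here but in
    the context of their scope. *)
Definition tok_val_kind (k : sign) (M : pmodel) (c : seq mtok) (G : seq name) (a : name)
    (Q1 Q2 : seq name) : seq name :=
  match k with
  | SNeg => [seq w <- M.1 | w \notin Q1]
  | SImp => [seq w <- M.1 | (w \in Q1) ==> (w \in Q2)]
  | SK => box_any M c [:: a] Q1
  | SC => box_common M c G Q1
  | SD => box_any M c G Q1
  | SE => box_every M c G Q1
  | SF => box_all M c G Q1
  | SPlus | SMinus | SEq | SEquiv => [seq w <- M.1 | w \in Q1]
  | _ => [seq w <- M.1 | a \in lookup [:: w] M.2.2.2]
  end.
Definition tok_val (M : pmodel) (c : seq mtok) (t : mtok) := tok_val_kind t.1 M c t.2.1 t.2.2.

(** The second component is consumed in step with the tokens. Its [behead] is therefore the part of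
    the formula to the left of the current token, read backwards, which is where the ancestors
    are. *)
Definition evstep (M : pmodel) (s : seq (seq name) * seq mtok) (t : mtok) :=
  (reduce [::] (tok_val M (ancestors (behead s.2))) s.1 t, behead s.2).
Definition eval (M : pmodel) (m : seq mtok) : seq name :=
  head [::] (foldl (evstep M) ([::], rev m) (rev m)).1.

Definition nonempty_uniq (l : seq name) := (l != [::]) && uniq l.

Definition tok_ok_kind (X : {pred op}) (c : sign) (ks : seq (seq name)) (G : seq name) (a : name) : bool :=
  match c with
  | SK => [:: a] \in ks
  | SC => [&& OpC \in X, nonempty_uniq G & all (fun b => [:: b] \in ks) G]
  | SD => [&& OpD \in X, nonempty_uniq G & all (fun b => [:: b] \in ks) G]
  | SE => [&& OpE \in X, nonempty_uniq G & all (fun b => [:: b] \in ks) G]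
  | SF => [&& OpF \in X, nonempty_uniq G & all (fun b => [:: b] \in ks) G]
  | SPlus => [&& OpAdd \in X, nonempty_uniq G & [:: a] \in ks]
  | SMinus => [&& OpSub \in X, nonempty_uniq G & [:: a] \in ks]
  | SEq => [&& OpSet \in X, nonempty_uniq G & [:: a] \in ks]
  | SEquiv => [&& OpCopy \in X, [:: head [::] G] \in ks & [:: a] \in ks]
  | _ => true
  end.
Definition tok_ok (X : {pred op}) (ks : seq (seq name)) (t : mtok) := tok_ok_kind X t.1 ks t.2.1 t.2.2.

Definition keys_of (l : seq entry) (ks : seq (seq name)) : bool :=
  let l1 := [seq x.1 | x <- l] in
  [&& uniq l1, all (fun k => k \in ks) l1 & all (fun k => k \in l1) ks].
Definition uniq_values (l : seq entry) : bool := all (fun x => uniq x.2) l.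
Definition symmetric_edges (M : pmodel) : bool :=
  all (fun w => all (fun u =>
    all (fun s => s \in lookup [:: u; w] M.2.1) (lookup [:: w; u] M.2.1)) M.1) M.1.

Definition wf_model (M : pmodel) : bool :=
  [&& uniq M.1,
      keys_of M.2.1 (flatten [seq [seq [:: w; u] | u <- M.1] | w <- M.1]),
      uniq_values M.2.1, symmetric_edges M,
      uniq [seq x.1 | x <- M.2.2.1],
      all (fun x => x.1 == [:: head [::] x.1]) M.2.2.1, uniq_values M.2.2.1,
      keys_of M.2.2.2 [seq [:: w] | w <- M.1] & uniq_values M.2.2.2].

Definition valid (X : {pred op}) (I : pmodel * (name * seq mtok)) : bool :=
  [&& wf_model I.1, I.2.1 \in I.1.1, all (tok_ok X [seq x.1 | x <- I.1.2.2.1]) I.2.2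
    & I.2.1 \in eval I.1 I.2.2].

(** The argument is the reversed text. The two comparisons show that neither lexing nor parsing has
    lost anything, so both have to be right only on text that was properly written. *)
Definition decide (X : {pred op}) (x : seq char) : bool :=
  [&& spell (lex x) == rev x, write_parsed (parse_input (lex x)) == lex x
    & valid X (parse_input (lex x))].

(** * Polynomial bounds for the decision procedure *)

Lemma pf_sym_name {E} {dE : data E} (x : E -> symbol) :
  polyfun x -> polyfun (fun e => sym_name (x e)).
Proof. by move=> hx; apply: (pf_symcase (F := fun _ _ => [::]) (G := fun _ b => b)); pf. Qed.

Lemma pf_lookup {E} {dE : data E} (k : E -> seq name) (l : E -> seq entry) :
  polyfun k -> polyfun l -> polyfun (fun e => lookup (k e) (l e)).
Proof. by move=> hk hl; rewrite /lookup; pf. Qed.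

Lemma pf_wgraph {E} {dE : data E} (l : E -> seq entry) : polyfun l -> polyfun (fun e => wgraph (l e)).
Proof. by move=> hl; rewrite /wgraph /wentry /wset /join; pf. Qed.

Ltac pf_user ::= first [ apply: pf_sym_name | apply: pf_lookup | apply: pf_wgraph ].

Lemma pf_wmodel {E} {dE : data E} (M : E -> pmodel) : polyfun M -> polyfun (fun e => wmodel (M e)).
Proof. by move=> hM; rewrite /wmodel; pf. Qed.

Lemma pf_wf_model {E} {dE : data E} (M : E -> pmodel) :
  polyfun M -> polyfun (fun e => wf_model (M e)).
Proof. by move=> hM; rewrite /wf_model /keys_of /uniq_values /symmetric_edges; pf. Qed.

Definition sign_bound := fin_bound sign.

Lemma sz_sign (c : sign) : sz c <= sign_bound.
Proof. exact: sz_fin. Qed.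

Lemma sz_Name_ge (b : name) : sz b <= sz (Name b).
Proof. by rewrite /sz /=; lia. Qed.

Lemma sz_true : sz true = 3. Proof. by []. Qed.
Lemma sz_false : sz false = 1. Proof. by []. Qed.

Ltac sz_lia :=
  repeat match goal with H : is_true (sz _ <= _) |- _ => move: H end;
  rewrite ?(sz_pair, sz_cons, sz_nil, sz_rev, sz_true, sz_false) /=; lia.

Lemma pf_split_input {E} {dE : data E} (x : E -> seq symbol) :
  polyfun x -> polyfun (fun e => split_input (x e)).
Proof.
move=> hx; apply: (pf_foldl (step := fun _ => lstep) (s0 := fun _ => lstate0) (l := x)
  (G := fun n => n + 20)) => //.
- rewrite /lstep; apply: pf_if; [by pf| |by pf].
  apply: (pf_symcase (x := fun z : E * (lstate * seq symbol * symbol) => z.2.2)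
    (F := fun c z => (lstep_sign c z.2.1.1, z.2.1.2))
    (G := fun z b => (lstep_name b z.2.1.1, z.2.1.2))); first by pf.
    by case; rewrite /lstep_sign; pf.
  by rewrite /lstep_name; pf.
- by pf.
- by poly_tac.
move=> e [[[[par ws] [key cur]] [ents blocks]] suf] x1.
rewrite /lstep /=; case: (nilp _); last by rewrite !sz_pair !sz_cons; lia.
case: x1 => [c|b]; last by pose proof (sz_Name_ge b); rewrite /=; case: par; sz_lia.
by case: c; rewrite /=; try case: par; sz_lia.
Qed.

Lemma sz_tok_arg (m : seq mtok) : sz (tok_arg m) + sz (behead m) <= sz m + 1.
Proof. by case: m => [|[k [B b]] m] //; rewrite /tok_arg /=; sz_lia. Qed.

Lemma pf_parse_formula {E} {dE : data E} (x : E -> seq symbol) :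
  polyfun x -> polyfun (fun e => parse_formula (x e)).
Proof.
move=> hx; apply: pf_snd; apply: pf_snd.
apply: (pf_foldl (step := fun _ => pstep) (s0 := fun _ => (false, false, ([::], [::])))
  (l := fun e => rev (x e)) (G := fun n => n + 3 * sign_bound + 40)) => //.
- apply: (pf_symcase (x := fun z : E * (parse_state * symbol) => z.2.2)
    (F := fun c z => pstep_sign c z.2.1) (G := fun z b => pstep_name b z.2.1)); first by pf.
    by case; rewrite /pstep_sign /tok_arg; pf.
  by rewrite /pstep_name; pf.
- by pf.
- by pf.
- by poly_tac.
move=> e [[inset skip] [ns m]] x1.
pose proof (sz_sign SNeg); pose proof (sz_sign SImp); pose proof (sz_sign SK).
pose proof (sz_sign SC); pose proof (sz_sign SD); pose proof (sz_sign SE); pose proof (sz_sign SF).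
pose proof (sz_sign SPlus); pose proof (sz_sign SMinus); pose proof (sz_sign SEq).
pose proof (sz_sign SEquiv); pose proof (sz_sign SComma).
case: x1 => [c|b]; last by pose proof (sz_Name_ge b); rewrite /=; case: inset; sz_lia.
pose proof (sz_tok_arg m); pose proof (sz_tok_arg (behead m)).
by case: c => /=; try case: skip; sz_lia.
Qed.

Ltac pf_user ::=
  first [ apply: pf_sym_name | apply: pf_lookup | apply: pf_wgraph | apply: pf_parse_formula ].

Lemma pf_parse_input {E} {dE : data E} (x : E -> seq symbol) :
  polyfun x -> polyfun (fun e => parse_input (x e)).
Proof.
move=> hx; have h : polyfun assemble by rewrite /assemble; pf.
exact: pf_comp h (pf_split_input hx).
Qed.

Lemma pf_reduce {E R} {dE : data E} {dR : data R} (d : R) (op : E -> mtok -> R -> R -> R)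
    (st : E -> seq R) (t : E -> mtok) :
  polyfun (fun z : E * (mtok * (R * R)) => op z.1 z.2.1 z.2.2.1 z.2.2.2) ->
  polyfun st -> polyfun t -> polyfun (fun e => reduce d (op e) (st e) (t e)).
Proof.
move=> hop hst ht; rewrite /reduce; pf1.
  apply: (pf_comp (f := fun e => (e, (t e, (head d (st e), head d (behead (st e)))))) hop); pf.
by apply: (pf_case (F := fun c e => pop c (st e)) (t := fun e => (t e).1)); [case; rewrite /pop|]; pf.
Qed.

(** A result may contain the operands it consumes, because these leave the stack; only the surplus
    [B] makes the stack grow. The two copies of [sz d] pay for operands missing from a stack that is
    too short. *)
Lemma sz_reduce {R} {dR : data R} (d : R) (op : mtok -> R -> R -> R) (st : seq R) (t : mtok) B :
  (forall x y, sz (op t x y) <= B + match t.1 with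
    | SImp => sz x + sz y
    | SNeg | SK | SC | SD | SE | SF | SPlus | SMinus | SEq | SEquiv => sz x
    | _ => 0
    end) ->
  sz (reduce d op st t) <= sz st + (B + 2 * sz d + 1).
Proof.
move=> h; rewrite /reduce sz_cons; have {h} := h (head d st) (head d (behead st)).
pose proof (sz_gt0 d).
by case: t.1; case: st => [|x [|y st]] /=; rewrite ?sz_cons ?sz_nil; lia.
Qed.

Lemma sz_join (l : seq name) : sz (join [seq [:: Name b] | b <- l]) <= (3 * sym_bound + 5) * sz l.
Proof.
pose proof (sz_Sign SComma).
have h (m : seq name) : sz (flatten [seq Sign SComma :: ys | ys <- [seq [:: Name b] | b <- m]])
    <= (2 * sym_bound + 4) * sz m.
  elim: m => [|b m IH]; first by rewrite /= !sz_nil; lia.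
  by pose proof (sz_Name b); rewrite /=; sz_lia.
case: l => [|b l]; first by rewrite /join /= !sz_nil; lia.
rewrite /join /=; pose proof (sz_Name b); pose proof (h l); sz_lia.
Qed.

Lemma sz_wset (l : seq name) : sz (wset l) <= (3 * sym_bound + 5) * sz l + 2 * sym_bound + 5.
Proof.
pose proof (sz_Sign SLbrace); pose proof (sz_Sign SRbrace); pose proof (sz_join l).
rewrite /wset; pose proof (sz_cat (join [seq [:: Name b] | b <- l]) [:: Sign SRbrace]); sz_lia.
Qed.

Lemma pf_unparse {E} {dE : data E} (m : E -> seq mtok) :
  polyfun m -> polyfun (fun e => unparse (m e)).
Proof.
move=> hm; rewrite /unparse; pf1; [by pf|].
apply: (pf_foldl (step := fun _ => reduce [:: Name [::]] wtok) (s0 := fun _ => [::])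
  (l := fun e => rev (m e)) (G := fun n => (3 * sym_bound + 5) * n + 20 * sym_bound + 100)) => //.
- apply: (@pf_reduce _ _ _ _ [:: Name [::]] (fun _ => wtok)); [|by pf|by pf].
  apply: (pf_case (F := fun c z => wtok_kind c z.2.1.2.1 z.2.1.2.2 z.2.2.1 z.2.2.2)
    (t := fun z : (E * (seq (seq symbol) * mtok)) * (mtok * (seq symbol * seq symbol)) => z.2.1.1));
    last by pf.
  by case; rewrite /wtok_kind /wset /join; pf.
- by pf.
- by pf.
- by poly_tac.
move=> e st [k [G a]].
apply: leq_trans (@sz_reduce _ _ _ _ _ _
  ((3 * sym_bound + 5) * sz G + 10 * sym_bound + 40 + sz a) _) _.
  move=> x y.
  pose proof (sz_wset G); pose proof (sz_Name a); pose proof (sz_cat (wset G) x).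
  pose proof (sz_cat (wset G) [:: Sign SRpar, Name a & x]).
  pose proof (sz_cat x (Sign SImp :: y ++ [:: Sign SRpar])).
  pose proof (sz_cat y [:: Sign SRpar]).
  pose proof (sz_Sign SNeg); pose proof (sz_Sign SImp); pose proof (sz_Sign SK).
  pose proof (sz_Sign SLpar); pose proof (sz_Sign SRpar).
  pose proof (sz_Sign SC); pose proof (sz_Sign SD); pose proof (sz_Sign SE); pose proof (sz_Sign SF).
  pose proof (sz_Sign SPlus); pose proof (sz_Sign SMinus); pose proof (sz_Sign SEq).
  pose proof (sz_Sign SEquiv); pose proof (sz_Sign SComma).
  have hh : sz (Name (head [::] G)) <= sym_bound + sz G + 1.
    apply: leq_trans (sz_Name _) _; pose proof (sz_head ([::] : name) G); sz_lia.
  rewrite /wtok; case: k => /=; sz_lia.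
rewrite !sz_pair !sz_cons; pose proof (sz_Name [::]); sz_lia.
Qed.

Lemma pf_ancestors {E} {dE : data E} (r : E -> seq mtok) :
  polyfun r -> polyfun (fun e => ancestors (r e)).
Proof.
move=> hr; rewrite /ancestors; pf1; pf1.
apply: (pf_foldl (step := fun _ => cstep) (s0 := fun _ => (0, [::])) (l := r)
  (G := fun n => n + 10)) => //.
- apply: (pf_case (F := fun c z => cstep_kind c z.2.2 z.2.1)
    (t := fun z : E * ((nat * seq mtok) * mtok) => z.2.2.1)); last by pf.
  by case; rewrite /cstep_kind; pf.
- by pf.
- by poly_tac.
move=> e [d acc] t.
have h0 : sz 0 = 1 by [].
have hS : sz d.+1 = (sz d).+2 by [].
have hP : sz d.-1 <= sz d by case: (d) => [|d'] //; rewrite /sz /=; lia.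
have hd : 0 < sz d by exact: sz_gt0.
by rewrite /cstep; case: t.1 => /=; try case: ifP => _; sz_lia.
Qed.

Lemma pf_in_cap {E} {dE : data E} (cs : E -> seq entry) (c : E -> seq mtok) (s a : E -> name) :
  polyfun cs -> polyfun c -> polyfun s -> polyfun a ->
  polyfun (fun e => in_cap (cs e) (c e) (s e) (a e)).
Proof.
move=> hcs hc hs ha.
have h : polyfun (fun e => foldl (icstep (s e)) (a e, (false, false)) (c e)).
  apply: (pf_foldl (step := fun e => icstep (s e)) (s0 := fun e => (a e, (false, false))) (l := c)
    (G := fun n => n + 10)) => //.
  - rewrite /icstep; apply: pf_if; [by pf|by pf|].
    apply: pf_if; [by pf| |by pf].
    apply: (pf_case (F := fun k z => icstep_kind k z.2.2.2.1 (s z.1) z.2.1)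
      (t := fun z : E * ((name * (bool * bool)) * mtok) => z.2.2.1)); last by pf.
    by case; rewrite /icstep_kind; pf.
  - by pf.
  - by poly_tac.
  move=> e [b [d v]] [k [B b']]; rewrite /icstep /=.
  have hB : sz (head [::] B) <= sz B + 1 by pose proof (sz_head ([::] : name) B); sz_lia.
  have hv : sz (s e \in B) <= 3 by exact: sz_bool.
  have hd : 0 < sz d by exact: sz_gt0.
  have hv' : 0 < sz v by exact: sz_gt0.
  case: (d) hd => hd; first by sz_lia.
  case: ifP => _; last by sz_lia.
  by case: k => /=; try case: ifP => _; sz_lia.
rewrite /in_cap; apply: pf_if; pf.
Qed.

Ltac pf_user ::= first [ apply: pf_lookup | apply: pf_in_cap | apply: pf_ancestors ].

Lemma pf_box_any {E} {dE : data E} (M : E -> pmodel) (c : E -> seq mtok) (G Q : E -> seq name) :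
  polyfun M -> polyfun c -> polyfun G -> polyfun Q ->
  polyfun (fun e => box_any (M e) (c e) (G e) (Q e)).
Proof. by move=> hM hc hG hQ; rewrite /box_any /univ; pf. Qed.

Lemma pf_box_all {E} {dE : data E} (M : E -> pmodel) (c : E -> seq mtok) (G Q : E -> seq name) :
  polyfun M -> polyfun c -> polyfun G -> polyfun Q ->
  polyfun (fun e => box_all (M e) (c e) (G e) (Q e)).
Proof. by move=> hM hc hG hQ; rewrite /box_all /univ; pf. Qed.

Ltac pf_user ::=
  first [ apply: pf_lookup | apply: pf_in_cap | apply: pf_ancestors | apply: pf_box_any
        | apply: pf_box_all ].

Lemma pf_box_every {E} {dE : data E} (M : E -> pmodel) (c : E -> seq mtok) (G Q : E -> seq name) :
  polyfun M -> polyfun c -> polyfun G -> polyfun Q ->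
  polyfun (fun e => box_every (M e) (c e) (G e) (Q e)).
Proof. by move=> hM hc hG hQ; rewrite /box_every; pf. Qed.

Lemma pf_box_common {E} {dE : data E} (M : E -> pmodel) (c : E -> seq mtok) (G Q : E -> seq name) :
  polyfun M -> polyfun c -> polyfun G -> polyfun Q ->
  polyfun (fun e => box_common (M e) (c e) (G e) (Q e)).
Proof.
move=> hM hc hG hQ.
have [p [k hk]] := hM.
apply: (pf_foldl (step := fun e X _ => box_every (M e) (c e) (G e) [seq w <- Q e | w \in X])
  (s0 := fun e => (M e).1) (l := fun e => (M e).1) (G := fun n => pw k n)) => //.
- by apply: pf_box_every; pf.
- by pf.
- by pf.
- by poly_tac.
move=> e X x0; rewrite /box_every; apply: leq_trans (sz_filter _ _) _.
have [h _] := hk e; have h1 := leq_trans (sz_fst _) h.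
have h2 : pw k (sz e) <= pw k (sz e + sz x0) by apply: pw_leq; rewrite leq_addr.
by apply: leq_trans h1 (leq_trans h2 _); rewrite leq_addl.
Qed.

Ltac pf_user ::=
  first [ apply: pf_lookup | apply: pf_in_cap | apply: pf_ancestors | apply: pf_box_any
        | apply: pf_box_all | apply: pf_box_every | apply: pf_box_common ].

Lemma sz_box_common M c G Q : sz (box_common M c G Q) <= sz M.1.
Proof.
rewrite /box_common; elim/last_ind: {2}M.1 => [|l x IH] //.
by rewrite foldl_rcons; exact: sz_filter.
Qed.

Lemma sz_tok_val M c t Q1 Q2 : sz (tok_val M c t Q1 Q2) <= sz M.1.
Proof. by rewrite /tok_val; case: t.1; try exact: sz_filter; exact: sz_box_common. Qed.

Lemma pf_tok_val {E} {dE : data E} (M : E -> pmodel) (c : E -> seq mtok) (t : E -> mtok)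
    (Q1 Q2 : E -> seq name) :
  polyfun M -> polyfun c -> polyfun t -> polyfun Q1 -> polyfun Q2 ->
  polyfun (fun e => tok_val (M e) (c e) (t e) (Q1 e) (Q2 e)).
Proof.
move=> hM hc ht h1 h2; rewrite /tok_val.
apply: (pf_case (F := fun k e => tok_val_kind k (M e) (c e) (t e).2.1 (t e).2.2 (Q1 e) (Q2 e))
  (t := fun e => (t e).1)); last by pf.
by case; rewrite /tok_val_kind; pf.
Qed.

Lemma pf_eval {E} {dE : data E} (M : E -> pmodel) (m : E -> seq mtok) :
  polyfun M -> polyfun m -> polyfun (fun e => eval (M e) (m e)).
Proof.
move=> hM hm; rewrite /eval; have [p [k hk]] := hM; pf1; [by pf|pf1].
apply: (pf_foldl (step := fun e => evstep (M e)) (s0 := fun e => ([::], rev (m e)))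
  (l := fun e => rev (m e)) (G := fun n => pw k n + 10)) => //.
- rewrite /evstep; pf1; last by pf.
  apply: (@pf_reduce _ _ _ _ [::] (fun z => tok_val (M z.1) (ancestors (behead z.2.1.2)))); [|by pf|by pf].
  by apply: pf_tok_val; pf.
- by pf.
- by pf.
- by poly_tac.
move=> e [st r] t; rewrite /evstep /=.
have h1 : sz (M e).1 <= pw k (sz e) by have [h _] := hk e; exact: leq_trans (sz_fst _) h.
have h2 : sz (reduce [::] (tok_val (M e) (ancestors (behead r))) st t) <=
    sz st + (pw k (sz e) + 2 * sz ([::] : seq name) + 1).
  by apply: sz_reduce => x y; exact: leq_trans (sz_tok_val _ _ _ _ _) (leq_trans h1 (leq_addr _ _)).
have h3 : pw k (sz e) <= pw k (sz e + sz t) by apply: pw_leq; rewrite leq_addr.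
rewrite !sz_pair.
by pose proof (sz_behead r); move: h2; rewrite sz_nil; lia.
Qed.

Lemma pf_valid X {E} {dE : data E} (I : E -> pmodel * (name * seq mtok)) :
  polyfun I -> polyfun (fun e => valid X (I e)).
Proof.
move=> hI; rewrite /valid; pf1; first by apply: pf_wf_model; pf.
pf1; first by pf.
pf1; last by pf1; [pf|apply: pf_eval; pf].
pf1; last by pf.
apply: (pf_case
  (F := fun c z => tok_ok_kind X c [seq x.1 | x <- (I z.1).1.2.2.1] z.2.2.1 z.2.2.2)
  (t := fun z : E * mtok => z.2.1)); last by pf.
by case; rewrite /tok_ok_kind /nonempty_uniq; pf.
Qed.

Lemma pf_decide X : polyfun (decide X).
Proof.
have hl : polyfun (fun x : seq char => lex x) by apply: pf_lex; exact: pf_id.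
have hp : polyfun (fun x : seq char => parse_input (lex x)) by exact: pf_parse_input.
rewrite /decide; pf1; first by pf1; [apply: pf_spell|pf].
pf1; last by exact: pf_valid.
pf1; last by [].
rewrite /write_parsed; pf1; first by apply: pf_wmodel; pf.
pf1; first by pf.
by apply: pf_unparse; pf.
Qed.

(** * Parsing inverts writing *)

Lemma lex_spell (xs : seq symbol) : lex (rev (spell xs)) = xs.
Proof.
rewrite /lex foldl_rev /spell.
suff -> : foldr (fun c s => lex_step s c) ([::], [::]) (flatten [seq spell_symbol x | x <- xs])
  = ([::], xs) by [].
elim: xs => //= x xs IH; rewrite foldr_cat IH; case: x => [c|b] //=.
suff -> : foldr (fun c s => lex_step s c) ([::], xs) [seq inr (Some d) | d <- b] = (b, xs) by [].
by elim: b => //= d b ->.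
Qed.

Lemma braces_join (xss : seq (seq symbol)) :
  braces xss = Sign SLbrace :: join xss ++ [:: Sign SRbrace].
Proof. by case: xss. Qed.

Lemma name_set_wset (T : Type) (code : T -> bitseq) (l : seq T) :
  name_set code l = wset [seq code x | x <- l].
Proof. by rewrite /name_set braces_join /wset -map_comp. Qed.

Lemma join_cons (x : seq symbol) l : join (x :: l) = x ++ flatten [seq Sign SComma :: y | y <- l].
Proof. by []. Qed.

Lemma join_names b (l : seq name) :
  join [seq [:: Name x] | x <- b :: l] = Name b :: flatten [seq [:: Sign SComma; Name x] | x <- l].
Proof. by rewrite /join /= -map_comp. Qed.

#[local] Arguments wentry : simpl never.
#[local] Arguments wset : simpl never.
#[local] Arguments wgraph : simpl never.
#[local] Arguments join : simpl never.

Section Splitting.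
Implicit Types (ws key cur : seq name) (ents : seq entry) (blocks : seq (seq entry)) (M : pmodel).

Lemma lstep_listing (s : lstate) suf x : nilp (behead (behead s.2.2)) ->
  lstep (s, suf) x =
  match x with Sign c => (lstep_sign c s, suf) | Name b => (lstep_name b s, suf) end.
Proof. by rewrite /lstep /= => ->. Qed.

Lemma split_names ws key cur ents blocks l : nilp (behead (behead blocks)) ->
  foldl lstep (true, ws, (key, cur), (ents, blocks), [::]) (join [seq [:: Name x] | x <- l])
  = (true, ws, (key, rev l ++ cur), (ents, blocks), [::]).
Proof.
move=> he; case: l => [|b l] //; rewrite join_names /= lstep_listing //=.
rewrite rev_cons cat_rcons; elim: l (b :: cur) => //= x l IH c.
by rewrite lstep_listing //= lstep_listing //= IH rev_cons cat_rcons.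
Qed.

Lemma split_entry ws ents blocks x : nilp (behead (behead blocks)) ->
  foldl lstep (false, ws, ([::], [::]), (ents, blocks), [::]) (wentry x)
  = (false, ws, ([::], [::]), (x :: ents, blocks), [::]).
Proof.
move=> he; case: x => k B; rewrite /wentry /wset /= lstep_listing //= foldl_cat split_names //=.
rewrite lstep_listing //= lstep_listing //= 2!foldl_cat cats0 split_names //=.
by rewrite cats0 lstep_listing //= lstep_listing //= !revK.
Qed.

Lemma split_graph ws blocks l : nilp (behead (behead blocks)) ->
  foldl lstep (false, ws, ([::], [::]), ([::], blocks), [::]) (wgraph l)
  = (false, ws, ([::], [::]), ([::], l :: blocks), [::]).
Proof.
move=> he; rewrite /wgraph /= lstep_listing //= foldl_cat.
have -> : foldl lstep (false, ws, ([::], [::]), ([::], blocks), [::]) (join [seq wentry x | x <- l])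
   = (false, ws, ([::], [::]), (rev l, blocks), [::]).
  case: l => [|x l] //; rewrite map_cons join_cons foldl_cat split_entry // rev_cons -cats1.
  have fc s z m : foldl lstep s (z :: m) = foldl lstep (lstep s z) m by [].
  elim: l [:: x] => // y l IH e.
  rewrite -[flatten _]/(Sign SComma ::
    wentry y ++ flatten [seq Sign SComma :: z | z <- [seq wentry z | z <- l]]).
  rewrite fc lstep_listing // foldl_cat split_entry // IH.
  by rewrite rev_cons cat_rcons.
by rewrite /= lstep_listing //= revK.
Qed.

Lemma split_rest s l : ~~ nilp (behead (behead s.1.2.2)) ->
  foldl lstep s l = (s.1, rev l ++ s.2).
Proof.
elim: l s => [|x l IH] s hs /=; first by case: s {hs}.
by rewrite {2}/lstep ifN // IH //= rev_cons cat_rcons.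
Qed.

(** The tail [f] is arbitrary: the end of the third graph alone shows where the listing stops, so
    the splitting knows nothing about formulas. *)
Lemma parse_input_write M w f :
  parse_input (wmodel M ++ Name w :: f) = (M, (w, parse_formula f)).
Proof.
case: M => ws [es [cs vs]].
rewrite /parse_input /split_input.
rewrite -[wmodel _]/([seq Name w | w <- ws] ++ wgraph es ++ wgraph cs ++ wgraph vs) -!catA foldl_cat.
have hw l : foldl lstep (false, l, ([::], [::]), ([::], [::]), [::]) [seq Name w | w <- ws]
    = (false, rev ws ++ l, ([::], [::]), ([::], [::]), [::]).
  elim: ws l => //= x ws IH l.
  by rewrite lstep_listing //= IH rev_cons cat_rcons.
rewrite hw cats0.
rewrite foldl_cat split_graph // foldl_cat split_graph // foldl_cat split_graph // split_rest //.
rewrite cats0 /assemble /= !revK.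
by [].
Qed.

End Splitting.

Section Formulas.
Context {P A S : eqType}.
Variables (codeP : P -> bitseq) (codeA : A -> bitseq) (codeS : S -> bitseq).
Implicit Types phi psi : formula P A S.
Local Notation write := (write_formula codeP codeA codeS).

Fixpoint polish phi : seq mtok :=
  match phi with
  | Atom p => [:: (SComma, ([::], codeP p))]
  | Neg psi => (SNeg, ([::], [::])) :: polish psi
  | Imp psi chi => (SImp, ([::], [::])) :: polish psi ++ polish chi
  | Know a psi => (SK, ([::], codeA a)) :: polish psi
  | Common G psi => (SC, ([seq codeA a | a <- G], [::])) :: polish psi
  | Distributed G psi => (SD, ([seq codeA a | a <- G], [::])) :: polish psi
  | Everyone G psi => (SE, ([seq codeA a | a <- G], [::])) :: polish psi
  | Field G psi => (SF, ([seq codeA a | a <- G], [::])) :: polish psi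
  | AddSkills B a psi => (SPlus, ([seq codeS s | s <- B], codeA a)) :: polish psi
  | SubSkills B a psi => (SMinus, ([seq codeS s | s <- B], codeA a)) :: polish psi
  | SetSkills B a psi => (SEq, ([seq codeS s | s <- B], codeA a)) :: polish psi
  | CopySkills b a psi => (SEquiv, ([:: codeA b], codeA a)) :: polish psi
  end.

Local Notation ps := (foldr (fun x s => pstep s x)).

Lemma parse_names skip ns m l :
  ps (true, skip, (ns, m)) (join [seq [:: Name x] | x <- l]) = (true, skip, (l ++ ns, m)).
Proof.
case: l => [|b l] //; rewrite join_names /=.
suff -> : ps (true, skip, (ns, m)) (flatten [seq [:: Sign SComma; Name x] | x <- l])
   = (true, skip, (l ++ ns, m)) by [].
by elim: l => //= x l ->.
Qed.

Lemma parse_wset i skip ns m l : ps (i, skip, (ns, m)) (wset l) = (false, skip, (l, m)).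
Proof. by rewrite /wset /= foldr_cat /= parse_names cats0. Qed.

(** After each subformula the flags and the collected set are back in their initial state, and the
    names absorbed by a sign lie above [m]; this is why the induction can leave [m] arbitrary. *)
Lemma parse_write phi m :
  ps (false, false, ([::], m)) (write phi) = (false, false, ([::], polish phi ++ m)).
Proof.
have pc s x f : ps s (x :: f) = pstep (ps s f) x by [].
elim: phi m => [p|psi IH|psi IH1 chi IH2|a psi IH|G psi IH|G psi IH|G psi IH|G psi IH
    |B a psi IH|B a psi IH|B a psi IH|b a psi IH] m.
- by [].
- by rewrite pc IH.
- rewrite -[write _]/(Sign SLpar :: write psi ++ Sign SImp :: write chi ++ [:: Sign SRpar]).
  rewrite pc foldr_cat pc foldr_cat IH2.
  rewrite -[pstep (false, false, _) (Sign SImp)]/(false, false, ([::], polish chi ++ m)).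
  by rewrite IH1 /= catA.
- by rewrite pc pc IH.
- rewrite -[write _]/(Sign SC :: name_set codeA G ++ write psi).
  by rewrite pc foldr_cat IH name_set_wset parse_wset.
- rewrite -[write _]/(Sign SD :: name_set codeA G ++ write psi).
  by rewrite pc foldr_cat IH name_set_wset parse_wset.
- rewrite -[write _]/(Sign SE :: name_set codeA G ++ write psi).
  by rewrite pc foldr_cat IH name_set_wset parse_wset.
- rewrite -[write _]/(Sign SF :: name_set codeA G ++ write psi).
  by rewrite pc foldr_cat IH name_set_wset parse_wset.
- rewrite -[write _]/([:: Sign SLpar, Sign SPlus &
    name_set codeS B ++ [:: Sign SRpar, Name (codeA a) & write psi]]).
  by rewrite pc pc foldr_cat pc pc IH name_set_wset parse_wset.
- rewrite -[write _]/([:: Sign SLpar, Sign SMinus &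
    name_set codeS B ++ [:: Sign SRpar, Name (codeA a) & write psi]]).
  by rewrite pc pc foldr_cat pc pc IH name_set_wset parse_wset.
- rewrite -[write _]/([:: Sign SLpar, Sign SEq &
    name_set codeS B ++ [:: Sign SRpar, Name (codeA a) & write psi]]).
  by rewrite pc pc foldr_cat pc pc IH name_set_wset parse_wset.
- by rewrite 5!pc IH.
Qed.

Lemma parse_formula_write phi : parse_formula (write phi) = polish phi.
Proof. by rewrite /parse_formula foldl_rev parse_write cats0. Qed.

End Formulas.

(** * Decoding tokens into formulas *)

Section Decoding.
Context {P A S : eqType}.
Variables (codeP : P -> bitseq) (codeA : A -> bitseq) (codeS : S -> bitseq).
Variables (decP : bitseq -> P) (decA : bitseq -> A) (decS : bitseq -> S).
Hypotheses (decPK : cancel decP codeP) (decAK : cancel decA codeA) (decSK : cancel decS codeS).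
Local Notation write := (write_formula codeP codeA codeS).

Definition formula_of_tok (t : mtok) (phi psi : formula P A S) : formula P A S :=
  let: (c, (G, a)) := t in
  let GA := [seq decA b | b <- G] in
  let GS := [seq decS b | b <- G] in
  match c with
  | SNeg => Neg phi
  | SImp => Imp phi psi
  | SK => Know (decA a) phi
  | SC => Common GA phi
  | SD => Distributed GA phi
  | SE => Everyone GA phi
  | SF => Field GA phi
  | SPlus => AddSkills GS (decA a) phi
  | SMinus => SubSkills GS (decA a) phi
  | SEq => SetSkills GS (decA a) phi
  | SEquiv => CopySkills (decA (head [::] G)) (decA a) phi
  | _ => Atom A S (decP a)
  end.

Lemma write_formula_of_tok t phi psi :
  write (formula_of_tok t phi psi) = wtok t (write phi) (write psi).
Proof.
have hA G : name_set codeA [seq decA b | b <- G] = wset G.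
  by rewrite name_set_wset -map_comp (eq_map (g := id)) ?map_id // => b /=; rewrite decAK.
have hS G : name_set codeS [seq decS b | b <- G] = wset G.
  by rewrite name_set_wset -map_comp (eq_map (g := id)) ?map_id // => b /=; rewrite decSK.
case: t => c [G a]; case: c;
  by cbn [write_formula formula_of_tok wtok wtok_kind fst snd cat]; rewrite ?hA ?hS ?decPK ?decAK.
Qed.

(** Printing and building a formula are the same stack computation with corresponding defaults, so
    even a malformed token list prints as a formula. A text that equals its own reprint is therefore
    well formed. *)
Lemma unparse_write (m : seq mtok) : exists phi, unparse m = write phi.
Proof.
pose d := Atom A S (decP [::]) : formula P A S.
have hd : [:: Name [::]] = write d by rewrite /= decPK.
exists (head d (foldl (reduce d formula_of_tok) [::] (rev m))).
rewrite /unparse hd.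
have -> : foldl (reduce (write d) wtok) [::] (rev m)
    = [seq write phi | phi <- foldl (reduce d formula_of_tok) [::] (rev m)].
  elim/last_ind: (rev m) => // l t IH; rewrite !foldl_rcons IH /reduce.
  have hh st : head (write d) [seq write phi | phi <- st] = write (head d st) by case: st.
  have hb st : [seq write phi | phi <- behead st] = behead [seq write phi | phi <- st] by rewrite behead_map.
  rewrite map_cons write_formula_of_tok -!hh hb; congr (_ :: _).
  by case: t.1; rewrite /= ?hb.
by case: (foldl _ _ _).
Qed.

End Decoding.

Section Lookup.
Context {K V : eqType} (key : K -> seq name) (code : V -> name).
Hypothesis key_inj : injective key.

Definition code_graph (l : seq (K * seq V)) : seq entry :=
  [seq (key x.1, [seq code v | v <- x.2]) | x <- l].

Lemma lookup_code_graph k (l : seq (K * seq V)) : k \in unzip1 l ->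
  exists2 B, (k, B) \in l & lookup (key k) (code_graph l) = [seq code v | v <- B].
Proof.
elim: l => //= -[k' B] l IH; rewrite inE /lookup /= (inj_eq key_inj).
case: (eqVneq k' k) => [-> _|ne] /=; first by exists B; rewrite ?mem_head.
move=> /IH [B' h1 h2]; exists B' => //.
by rewrite inE h1 orbT.
Qed.

Lemma unzip1_code_graph l : [seq x.1 | x <- code_graph l] = [seq key k | k <- unzip1 l].
Proof. by rewrite -!map_comp. Qed.

End Lookup.

Section CapContext.
Variable cs : seq entry.

Lemma icstep_decided s b v (c : seq mtok) : foldl (icstep s) (b, (true, v)) c = (b, (true, v)).
Proof. by elim: c. Qed.

(** The recursion hidden in the walk. Contexts list the innermost ancestor first, so the head is the
    latest update and takes precedence over the others. *)
Lemma in_cap_cons k B b (c : seq mtok) s a :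
  in_cap cs ((k, (B, b)) :: c) s a =
  if b == a then
    match k with
    | SPlus => (s \in B) || in_cap cs c s a
    | SMinus => (s \notin B) && in_cap cs c s a
    | SEq => s \in B
    | SEquiv => in_cap cs c s (head [::] B)
    | _ => in_cap cs c s a
    end
  else in_cap cs c s a.
Proof.
rewrite /in_cap.
rewrite -[foldl _ _ (_ :: _)]/(foldl (icstep s)
  (if b == a then icstep_kind k B s (a, (false, false)) else (a, (false, false))) c).
case: eqP => // _; case: k => //; rewrite /icstep_kind.
- by case: (s \in B); rewrite ?icstep_decided.
- by case: (s \in B); rewrite ?icstep_decided.
- by rewrite /= icstep_decided.
Qed.

Lemma in_cap_univ (c : seq mtok) s a : in_cap cs c s a -> s \in univ cs c.
Proof.
have hcons t c' : s \in univ cs c' -> s \in univ cs (t :: c').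
  by rewrite /univ /= !mem_cat => /orP [->|->]; rewrite ?orbT.
have hB k B b c' : s \in B -> s \in univ cs ((k, (B, b)) :: c').
  by move=> h; rewrite /univ /= !mem_cat h orbT.
elim: c a => [|[k [B b]] c IH] a.
  rewrite /in_cap /univ /= cats0 /lookup; elim: cs => //= x l IHl; case: ifP => _ /= h.
    by rewrite mem_cat h.
  by rewrite mem_cat IHl ?orbT.
rewrite in_cap_cons; case: ifP => _; last by move/IH; exact: hcons.
case: k; try by move/IH; exact: hcons.
- by case/orP => [/hB //|/IH]; exact: hcons.
- by case/andP => _ /IH; exact: hcons.
- exact: hB.
Qed.

End CapContext.

(** * Ancestors and evaluation in Polish notation *)

Section Scan.
Context {P A S : eqType}.
Variables (codeP : P -> bitseq) (codeA : A -> bitseq) (codeS : S -> bitseq).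
Local Notation polish := (@polish P A S codeP codeA codeS).

Lemma cstep_acc r d acc :
  foldl cstep (d, acc) r = ((foldl cstep (d, [::]) r).1, (foldl cstep (d, [::]) r).2 ++ acc).
Proof.
elim: r d acc => // t r IH d acc.
have fc s : foldl cstep s (t :: r) = foldl cstep (cstep s t) r by [].
have [d' [l h]] : exists d' l, forall acc, cstep (d, acc) t = (d', l ++ acc).
  rewrite /cstep; case: t.1 => /=; case: (d == 0); case: (d == 1);
    first [by exists 0, [:: t] | by exists d, [::] | by exists d.+1, [::] | by exists d.-1, [::]].
by rewrite !fc !h IH [in RHS]IH cats0 /= catA.
Qed.

Lemma ancestors_cons t r :
  cstep (0, [::]) t = (0, [:: t]) -> ancestors (t :: r) = t :: ancestors r.
Proof.
move=> h; rewrite /ancestors -[foldl _ _ (t :: r)]/(foldl cstep (cstep (0, [::]) t) r).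
by rewrite h cstep_acc rev_cat.
Qed.

(** After the two arguments of an implication the counter is at least 2, so its sign is not mistaken
    for an ancestor and merges the two complete subtrees into one. *)
Lemma scan_polish phi d acc :
  foldl cstep (d, acc) (rev (polish phi)) = (d.+1, acc).
Proof.
elim: phi d acc => //=.
all: try by move=> *; rewrite rev_cons foldl_rcons; match goal with H : forall _ _, _ |- _ => rewrite H end.
by move=> psi IH1 chi IH2 d acc; rewrite rev_cons rev_cat foldl_rcons foldl_cat IH2 IH1; case: d.
Qed.

Lemma ancestors_imp t phi r : t.1 = SImp ->
  ancestors (rev (polish phi) ++ t :: r) = t :: ancestors r.
Proof.
move=> h; rewrite /ancestors foldl_cat scan_polish.
rewrite -[foldl _ _ (t :: r)]/(foldl cstep (cstep (1, [::]) t) r) {2}/cstep h /=.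
by rewrite cstep_acc rev_cat.
Qed.

Variable M : pmodel.

(** The structural counterpart of [eval]: the context is handed down as an argument instead of being
    recovered by a scan. *)
Fixpoint sem (c : seq mtok) (phi : formula P A S) : seq name :=
  let t := head dtok (polish phi) in
  match phi with
  | Atom _ => tok_val M c t [::] [::]
  | Imp psi chi => tok_val M c t (sem (t :: c) psi) (sem (t :: c) chi)
  | Neg psi | Know _ psi | Common _ psi | Distributed _ psi | Everyone _ psi | Field _ psi
  | AddSkills _ _ psi | SubSkills _ _ psi | SetSkills _ _ psi | CopySkills _ _ psi =>
      tok_val M c t (sem (t :: c) psi) [::]
  end.

Lemma eval_polish_stack phi st r :
  foldl (evstep M) (st, rev (polish phi) ++ r) (rev (polish phi)) =
  (sem (ancestors r) phi :: st, r).
Proof.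
elim: phi st r => [p|psi IH|psi IH1 chi IH2|a psi IH|G psi IH|G psi IH|G psi IH|G psi IH
    |B a psi IH|B a psi IH|B a psi IH|b a psi IH] st r; first by [].
2: {
  rewrite /= rev_cons rev_cat foldl_rcons foldl_cat rcons_cat -!catA IH2 cat_rcons IH1 /evstep.
  by rewrite ancestors_imp // ancestors_cons. }
all: by rewrite /= rev_cons foldl_rcons cat_rcons IH /evstep ancestors_cons.
Qed.

Lemma eval_polish phi : eval M (polish phi) = sem [::] phi.
Proof. by rewrite /eval -{1}[rev _]cats0 eval_polish_stack. Qed.

End Scan.

(** * Correctness of the evaluation *)

Section CommonKnowledge.
Variables (T : eqType) (l : seq T) (F : seq T -> seq T).
Hypothesis Funiq : forall X, uniq (F X).
Hypothesis Feq : forall X Y, X =i Y -> F X =i F Y.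

(** A descending chain of lists without repetition loses an element at every step until it becomes
    stationary, and then stays so because [F] respects equality of members. *)
Lemma iter_stationary n : uniq l ->
  (forall k, {subset iter k.+1 F l <= iter k F l}) ->
  size l <= n -> iter n F l =i iter (size l) F l.
Proof.
move=> ul dec.
have stat k : iter k.+1 F l =i iter k F l -> forall m, iter (m + k) F l =i iter k F l.
  move=> h; elim=> // m IH x; rewrite addSn iterS (Feq IH); exact: h.
have uk k : uniq (iter k F l) by case: k => [|k] //; exact: Funiq.
have bound k : size (iter k F l) + k <= size l \/ iter k.+1 F l =i iter k F l.
  elim: k => [|k [IH|IH]]; first by left; rewrite addn0.
    case: (leqP (size (iter k F l)) (size (iter k.+1 F l))) => hs.
      have [_ e] := uniq_min_size (uk k.+1) (dec k) hs.
      by right => x; exact: (Feq e x).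
    by left; lia.
  by right => x; exact: (Feq IH x).
move=> le x; rewrite -(subnK le); apply: stat; case: (bound (size l)) => // h.
(* A chain that has lost an element at each of [size l] steps has arrived at the empty list, and
   there it is stationary as well. *)
have {}h : iter (size l) F l = [::] by apply/nilP; rewrite /nilp; lia.
by move=> y; apply/idP/idP => [/dec|]; rewrite h.
Qed.

End CommonKnowledge.

Section Coding.
Context {P A S : eqType}.
Variables (codeP : P -> bitseq) (codeA : A -> bitseq) (codeS : S -> bitseq).

Definition code_listing (W : eqType) (codeW : W -> bitseq) (L : listing P A S W) : pmodel :=
  ([seq codeW w | w <- lworlds L],
   (code_graph (fun wu => [:: codeW wu.1; codeW wu.2]) codeS (ledges L),
    (code_graph (fun a => [:: codeA a]) codeS (lcaps L),
     code_graph (fun w => [:: codeW w]) codeP (lvals L)))).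

Lemma wmodel_code_listing (W : eqType) (codeW : W -> bitseq) (L : listing P A S W) :
  wmodel (code_listing codeW L) = write_listing codeP codeA codeS codeW L.
Proof.
have h (K V : eqType) (key : K -> seq name) (key' : K -> seq symbol) (code : V -> bitseq)
    (l : seq (K * seq V)) :
    (forall k, join [seq [:: Name b] | b <- key k] = key' k) ->
    wgraph (code_graph key code l) = write_graph key' code l.
  move=> hk; rewrite /write_graph braces_join /wgraph -map_comp; congr (_ :: join _ ++ _).
  by apply: eq_map => x; rewrite name_set_wset -hk.
rewrite /wmodel /write_listing -map_comp; congr (_ ++ (_ ++ (_ ++ _))); exact: h.
Qed.

End Coding.

Section Truth.
Local Open Scope classical_set_scope.
Context {P A S : eqType}.
Variables (codeP : P -> bitseq) (codeA : A -> bitseq) (codeS : S -> bitseq).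
Hypotheses (codeP_bij : bijective codeP) (codeA_bij : bijective codeA) (codeS_bij : bijective codeS).
Variables (M : model P A S) (codeW : M -> bitseq) (L : listing P A S M).
Hypotheses (codeW_inj : injective codeW) (hL : lists L).
Local Notation cm := (code_listing codeP codeA codeS codeW L).
Local Notation cs := cm.2.2.1.
Local Notation sem := (sem codeP codeA codeS cm).

Lemma mem_worlds w : codeW w \in cm.1.
Proof. by case: hL => -[_ h] _ _ _; rewrite mem_map. Qed.

Lemma worldsP x : x \in cm.1 -> exists w, x = codeW w.
Proof. by case/mapP => w _ ->; exists w. Qed.

Lemma mem_edge w u s : edge w u s <-> codeS s \in lookup [:: codeW w; codeW u] cm.2.1.
Proof.
have [[_ hw] [hp he] _ _] := hL.
have key_inj : injective (fun wu : M * M => [:: codeW wu.1; codeW wu.2]).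
  by move=> [a b] [c d] [/codeW_inj -> /codeW_inj ->].
have hk : (w, u) \in unzip1 (ledges L) by rewrite (perm_mem hp); apply/allpairsP; exists (w, u); split.
have [B hB ->] := lookup_code_graph codeS key_inj hk.
rewrite (mem_map (bij_inj codeS_bij)); have [_ ->] := he _ _ _ hB.
by split.
Qed.

Lemma mem_cap a s : a \in unzip1 (lcaps L) -> cap M a s <-> codeS s \in lookup [:: codeA a] cs.
Proof.
have [_ _ [_ hc] _] := hL => ha.
have key_inj : injective (fun a => [:: codeA a]) by move=> x y [] /(bij_inj codeA_bij).
have [B hB ->] := lookup_code_graph codeS key_inj ha.
by rewrite (mem_map (bij_inj codeS_bij)); have [_ ->] := hc _ _ hB; split.
Qed.

Lemma mem_val w p : valuation w p <-> codeP p \in lookup [:: codeW w] cm.2.2.2.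
Proof.
have [[_ hw] _ _ [hp hv]] := hL.
have key_inj : injective (fun w => [:: codeW w]) by move=> x y [] /codeW_inj.
have hk : w \in unzip1 (lvals L) by rewrite (perm_mem hp).
have [B hB ->] := lookup_code_graph codeP key_inj hk.
by rewrite (mem_map (bij_inj codeP_bij)); have [_ ->] := hv _ _ hB; split.
Qed.

(** The common core of all boxes: inclusion of [B] in an edge, which speaks of infinitely many
    skills, may be tested on any finite list [U] that covers [B]. Surjectivity of [codeS] turns the
    words of [U] back into skills. *)
Lemma mem_box (p : name -> bool) (B : set S) (Q : set M) (q U : seq name) w :
  (forall s, B s <-> p (codeS s)) -> (forall x, p x -> x \in U) ->
  (forall u, Q u <-> codeW u \in q) ->
  box B Q w <-> codeW w \in [seq w <- cm.1 |
    all (fun u => all (fun s => p s ==> (s \in lookup [:: w; u] cm.2.1)) U ==> (u \in q)) cm.1].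
Proof.
move=> hB hU hQ; rewrite mem_filter mem_worlds andbT; split => [h|/allP h u hu].
  apply/allP => x /worldsP [u ->]; apply/implyP => /allP hs; apply/hQ/h => s /hB ps.
  by apply/mem_edge; move: (hs _ (hU _ ps)); rewrite ps.
apply/hQ; move: (h _ (mem_worlds u)) => /implyP; apply; apply/allP => x _; apply/implyP => px.
by have [g _ gK] := codeS_bij; rewrite -(gK x); apply/mem_edge/hu/hB; rewrite gK.
Qed.

Section Capabilities.
Variables (C : A -> set S) (c : seq mtok).
Hypothesis hC : forall a, a \in unzip1 (lcaps L) -> forall s, C a s <-> in_cap cs c (codeS s) (codeA a).
Local Notation N := (set_cap M C).

Lemma mem_box_any (G : seq A) (Q : set M) (q : seq name) w :
  {subset G <= unzip1 (lcaps L)} -> (forall u, Q u <-> codeW u \in q) ->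
  @box _ _ _ N (\bigcup_(a in [set` G]) C a) Q w <-> codeW w \in box_any cm c [seq codeA a | a <- G] q.
Proof.
move=> hG hQ; apply: mem_box hQ => [s|x /hasP [a _ /in_cap_univ] //]; split.
  by case=> a /= aG /(hC (hG _ aG)) h; apply/hasP; exists (codeA a) => //; exact: map_f.
by move=> /hasP [_ /mapP [a aG ->] h]; exists a => //=; exact/hC/h/hG.
Qed.

Lemma mem_box_one a (Q : set M) (q : seq name) w :
  a \in unzip1 (lcaps L) -> (forall u, Q u <-> codeW u \in q) ->
  @box _ _ _ N (C a) Q w <-> codeW w \in box_any cm c [:: codeA a] q.
Proof.
move=> ha hQ; rewrite -[[:: codeA a]]/([seq codeA a | a <- [:: a]]).
rewrite -(mem_box_any (G := [:: a])) //; last by move=> b; rewrite inE => /eqP ->.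
have -> // : \bigcup_(b in [set` [:: a]]) C b = C a.
apply/seteqP; split => [s [b /=]|s h]; first by rewrite inE => /eqP ->.
by exists a => //=; rewrite inE.
Qed.

(** An intersection over the empty group would be the set of all skills, which no finite list
    covers; a member of [G] keeps the intersection within [univ]. *)
Lemma mem_box_all (G : seq A) (Q : set M) (q : seq name) w : G != [::] ->
  {subset G <= unzip1 (lcaps L)} -> (forall u, Q u <-> codeW u \in q) ->
  @box _ _ _ N (\bigcap_(a in [set` G]) C a) Q w <-> codeW w \in box_all cm c [seq codeA a | a <- G] q.
Proof.
move=> G0 hG hQ; apply: mem_box hQ => [s|x /allP h]; last first.
  case: G G0 h {hG} => // a G _ h; have := h (codeA a); rewrite /= mem_head.
  by move/(_ isT)/in_cap_univ.
split=> [h|/allP h a /= aG].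
  by apply/allP => _ /mapP [a aG ->]; apply/hC; [exact: hG|exact: h].
by apply/hC; [exact: hG|apply: h; exact: map_f].
Qed.

Lemma mem_everyone (G : seq A) (Q : set M) (q : seq name) w :
  {subset G <= unzip1 (lcaps L)} -> (forall u, Q u <-> codeW u \in q) ->
  @everyone _ _ _ N G Q w <-> codeW w \in box_every cm c [seq codeA a | a <- G] q.
Proof.
move=> hG hQ; rewrite mem_filter mem_worlds andbT; split.
  by move=> h; apply/allP => _ /mapP [a aG ->]; apply/(mem_box_one (Q := Q)) => //; [exact: hG|exact: h].
by move=> /allP h a aG; apply/(mem_box_one (q := q)); [exact: hG|by []|apply: h; exact: map_f].
Qed.

Lemma mem_common (G : seq A) (Q : set M) (q : seq name) w :
  {subset G <= unzip1 (lcaps L)} -> (forall u, Q u <-> codeW u \in q) ->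
  (forall n, 1 <= n -> iter n (@everyone _ _ _ N G) Q w) <->
  codeW w \in box_common cm c [seq codeA a | a <- G] q.
Proof.
move=> hG hQ; pose F (X : seq name) := box_every cm c [seq codeA a | a <- G] [seq w <- q | w \in X].
have -> : box_common cm c [seq codeA a | a <- G] q = iter (size cm.1) F cm.1.
  rewrite /box_common; have h (l X : seq name) : foldl (fun X _ => F X) X l = iter (size l) F X.
    by elim/last_ind: l => // l x IH; rewrite foldl_rcons IH size_rcons.
  exact: h.
(* The operator commutes with conjunction, so iterating from the set of all worlds collects the
   first [k] levels of mutual knowledge. *)
have hF k u : codeW u \in iter k F cm.1 <->
    (forall n, 1 <= n <= k -> iter n (@everyone _ _ _ N G) Q u).
  elim: k u => [|k IH] u.
    by split=> [_ n|_]; [case: n|exact: mem_worlds].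
  rewrite iterS -(mem_everyone (Q := [set v | Q v /\ codeW v \in iter k F cm.1])) //; last first.
    by move=> v; rewrite mem_filter andbC; split => [[/hQ -> ->]|/andP [/hQ ? ?]].
  split=> [h [//|n] hn a aG v hv|h a aG v hv].
    case: n hn => [|n] hn; first by case: (h a aG v hv).
    by have [_ /IH h'] := h a aG v hv; exact: (h' n.+1).
  split; first exact: (h 1 isT a aG v hv).
  by apply/IH => n hn; apply: (h n.+1) a aG v hv; lia.
have [[ul _] _ _ _] := hL.
have uw : uniq cm.1 by rewrite map_inj_uniq.
have stat n : size cm.1 <= n -> iter n F cm.1 =i iter (size cm.1) F cm.1.
  apply: iter_stationary => //.
  - by move=> X; exact: filter_uniq.
  - move=> X Y h x; rewrite /F (_ : [seq w <- q | w \in X] = [seq w <- q | w \in Y]) //.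
    by apply: eq_filter => y; rewrite h.
  - move=> k x; have : {subset iter k.+1 F cm.1 <= cm.1} by move=> y; rewrite mem_filter => /andP [].
    move=> hs hx; have /worldsP [u e] := hs _ hx; move: hx; rewrite e => /hF h.
    by apply/hF => m /andP [h1 h2]; apply: h; rewrite h1 leqW.
split=> [h|h n hn]; first by apply/hF => n /andP [hn _]; exact: h.
(* Past the number of worlds all iterates agree, so one may be taken that is late enough to include
   level [n]. *)
have : codeW w \in iter (maxn n (size cm.1)) F cm.1 by rewrite stat // leq_maxr.
by move/hF; apply; rewrite hn leq_maxl.
Qed.

End Capabilities.

(** [C] and [c] vary together: entering a capability modality updates [C] on one side and puts a
    token in front of [c] on the other, and [in_cap_cons] shows that the two changes agree.
    Agreement is claimed on listed agents only, which include all agents of the formula. *)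
Lemma sat_sem X (phi : formula P A S) (C : A -> set S) (c : seq mtok) :
  (forall a, a \in unzip1 (lcaps L) -> forall s, C a s <-> in_cap cs c (codeS s) (codeA a)) ->
  in_lang X phi -> {subset agents phi <= unzip1 (lcaps L)} ->
  forall w, @sat _ _ _ (set_cap M C) w phi <-> codeW w \in sem c phi.
Proof.
have cA a b : (codeA b == codeA a) = (a == b) by rewrite (inj_eq (bij_inj codeA_bij)) eq_sym.
have cS s B : (codeS s \in [seq codeS x | x <- B]) = (s \in B) by rewrite (mem_map (bij_inj codeS_bij)).
(* Signs other than those of the capability modalities are invisible to the walk, so the agreement
   of [C] and [c] passes unchanged to their arguments. *)
have skip k B b c0 s a : (if k is (SPlus | SMinus | SEq | SEquiv) then false else true) ->
    in_cap cs ((k, (B, b)) :: c0) s a = in_cap cs c0 s a.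
  by rewrite in_cap_cons; case: ifP => // _; case: k.
elim: phi C c => [p|psi IH|psi IH1 chi IH2|a psi IH|G psi IH|G psi IH|G psi IH|G psi IH
    |B a psi IH|B a psi IH|B a psi IH|b a psi IH] C c hC.
- by move=> _ _ w; rewrite mem_filter mem_worlds andbT -mem_val.
- move=> hX ha w; rewrite mem_filter mem_worlds andbT.
  have h : @sat _ _ _ (set_cap M C) w psi <-> codeW w \in sem ((SNeg, ([::], [::])) :: c) psi.
    by apply: IH => // a0 h s; rewrite skip //; exact: hC.
  by split=> [h1|/negP h1 /h //]; apply/negP => /h.
- move=> /= /andP [hX1 hX2] ha w; rewrite mem_filter mem_worlds andbT.
  have h1 : @sat _ _ _ (set_cap M C) w psi <-> codeW w \in sem ((SImp, ([::], [::])) :: c) psi.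
    apply: IH1 => //; first by move=> a0 h s; rewrite skip //; exact: hC.
    by move=> a0 h; apply: ha; rewrite mem_cat h.
  have h2 : @sat _ _ _ (set_cap M C) w chi <-> codeW w \in sem ((SImp, ([::], [::])) :: c) chi.
    apply: IH2 => //; first by move=> a0 h s; rewrite skip //; exact: hC.
    by move=> a0 h; apply: ha; rewrite mem_cat h orbT.
  by split=> [h|/implyP h /h1 /h /h2 //]; apply/implyP => /h1 /h /h2.
- move=> /= hX ha w; apply: (mem_box_one hC); first by apply: ha; rewrite mem_head.
  move=> u; apply: IH => //; first by move=> a0 h s; rewrite skip //; exact: hC.
  by move=> a0 h; apply: ha; rewrite inE h orbT.
- move=> /= /and3P [_ _ hX] ha w; apply: (mem_common hC);
    first by move=> a0 h; apply: ha; rewrite mem_cat h.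
  move=> u; apply: IH => //; first by move=> a0 h s; rewrite skip //; exact: hC.
  by move=> a0 h; apply: ha; rewrite mem_cat h orbT.
- move=> /= /and3P [_ _ hX] ha w; apply: (mem_box_any hC);
    first by move=> a0 h; apply: ha; rewrite mem_cat h.
  move=> u; apply: IH => //; first by move=> a0 h s; rewrite skip //; exact: hC.
  by move=> a0 h; apply: ha; rewrite mem_cat h orbT.
- move=> /= /and3P [_ _ hX] ha w; apply: (mem_everyone hC);
    first by move=> a0 h; apply: ha; rewrite mem_cat h.
  move=> u; apply: IH => //; first by move=> a0 h s; rewrite skip //; exact: hC.
  by move=> a0 h; apply: ha; rewrite mem_cat h orbT.
- move=> /= /and3P [_ /andP [G0 _] hX] ha w; apply: (mem_box_all hC) => //.
    by move=> a0 h; apply: ha; rewrite mem_cat h.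
  move=> u; apply: IH => //; first by move=> a0 h s; rewrite skip //; exact: hC.
  by move=> a0 h; apply: ha; rewrite mem_cat h orbT.
- move=> /= /and3P [_ _ hX] ha w; rewrite mem_filter mem_worlds andbT.
  apply: IH => //; last by move=> a0 h; apply: ha; rewrite inE h orbT.
  move=> a0 h s; rewrite in_cap_cons cA cS; case: eqP => [->|_]; last exact: hC.
  rewrite -(rwP orP) /= -hC //; last by apply: ha; rewrite mem_head.
  by split=> -[]; [right|left|right|left].
- move=> /= /and3P [_ _ hX] ha w; rewrite mem_filter mem_worlds andbT.
  apply: IH => //; last by move=> a0 h; apply: ha; rewrite inE h orbT.
  move=> a0 h s; rewrite in_cap_cons cA cS; case: eqP => [->|_]; last exact: hC.
  rewrite -(rwP andP) /= -hC //; last by apply: ha; rewrite mem_head.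
  by split=> -[h1 h2]; split => //; exact/negP.
- move=> /= /and3P [_ _ hX] ha w; rewrite mem_filter mem_worlds andbT.
  apply: IH => //; last by move=> a0 h; apply: ha; rewrite inE h orbT.
  by move=> a0 h s; rewrite in_cap_cons cA cS; case: eqP => [_|_]; [split|exact: hC].
- move=> /= /andP [_ hX] ha w; rewrite mem_filter mem_worlds andbT.
  apply: IH => //; last by move=> a0 h; apply: ha; rewrite !inE h !orbT.
  move=> a0 h s; rewrite in_cap_cons cA; case: eqP => [_|_]; last exact: hC.
  by apply: hC; apply: ha; rewrite mem_head.
Qed.

Lemma sat_eval X (phi : formula P A S) w :
  in_lang X phi -> {subset agents phi <= unzip1 (lcaps L)} ->
  sat w phi <-> codeW w \in eval cm (polish codeP codeA codeS phi).
Proof.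
move=> hX ha; rewrite eval_polish.
have h := sat_sem (C := cap M) (c := [::]) (fun a ha s => mem_cap s ha) hX ha w.
(* Giving a model its own capabilities returns the same model, by computation once the record is
   destructed. *)
rewrite -h; move: w {h}; case: M => //.
Qed.

End Truth.

(** * From polynomial-time functions to P *)

Lemma push_tree_input t x r :
  execs (push_tree t) (x, r, [::], [::], [::]) (2 * tsize t) (x, code t ++ r, [::], [::], [::]).
Proof.
rewrite /push_tree -size_code; elim: (code t) => [|c l IH] /=; first exact: execs_nop.
apply: (execs_weak (n := 2 * size l + 2)); last by lia.
exact: execs_seq IH (execs_push _ _ _).
Qed.

Definition load_char := foldr
  (fun (c : char) p => If Inp (fun y => y == Some (inl c)) (push_tree (enc c)) p) (Nop _) (enum char).

Lemma load_char_spec (c : char) x r :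
  execs load_char (inl c :: x, r, [::], [::], [::]) (2 * #|char| + 2 * fin_bound char)
    (inl c :: x, code (enc c) ++ r, [::], [::], [::]).
Proof.
rewrite cardE /load_char; have : c \in enum char by rewrite mem_enum.
elim: (enum char) => //= d l IH; rewrite inE => hc.
apply: (execs_weak (n := (2 * size l + 2 * fin_bound char).+2)); last by lia.
apply: execs_if => /=; rewrite (inj_eq (@Some_inj _)) (inj_eq (@inl_inj _ _)).
case: (eqVneq c d) hc => [-> _|_ /IH //].
apply: execs_weak (push_tree_input _ _ _) _.
have h : tsize (fin_tree (d : char)) <= fin_bound char by exact: sz_fin.
by move: h; rewrite /=; lia.
Qed.

(** Each character is put in front of the list as it is read, so the encoded list is the reversal of
    the input; hence the [rev] in what follows. *)
Definition load :=
  Seq (Push Main (inr false))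
    (While Inp isSome (Seq load_char (Seq (Push Main (inr true)) (Pop _ Inp)))).

Definition load_cost := 2 * #|char| + 2 * fin_bound char + 5.

Lemma load_spec (s : seq char) :
  execs load ([seq inl c | c <- s], [::], [::], [::], [::]) (load_cost * size s + 3)
    (main_store (code (enc (rev s)))).
Proof.
apply: (execs_weak (n := 2 + (load_cost * size s + 1))); last by lia.
apply: execs_seq (execs_push _ _ _) _.
have h (l r : seq char) : execs (While Inp isSome (Seq load_char (Seq (Push Main (inr true)) (Pop _ Inp))))
    ([seq inl c | c <- l], code (enc r), [::], [::], [::]) (load_cost * size l + 1)
    (main_store (code (enc (catrev l r)))).
  elim: l r => [|c l IH] r; first by apply: execs_while_stop; rewrite ?addn1.
  apply: (execs_weak (n := (2 * #|char| + 2 * fin_bound char + (2 + 1)) + (load_cost * size l + 1) + 2));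
    last by rewrite /load_cost /=; lia.
  apply: execs_while (IH (c :: r)) => //.
  apply: execs_seq (load_char_spec _ _ _) _.
  exact: execs_seq (execs_push _ _ _) (execs_pop _ _).
exact: (h s [::]).
Qed.

Lemma sz_input (s : seq char) : sz (rev s) <= load_cost * size s + 1.
Proof.
rewrite sz_rev; elim: s => [|c s IH]; first by rewrite sz_nil addn1.
pose proof (@sz_fin char c) as h.
by rewrite /sz /= /load_cost in h IH *; lia.
Qed.

Lemma polyfun_inP (L : set (seq char)) (f : seq char -> bool) :
  polyfun f -> (forall s, f (rev s) <-> L s) -> inP L.
Proof.
move=> [p [k hp]] hL; pose q := Seq load p.
(* The first summand covers loading. The second covers the program, since the loaded size plus 2 is
   at most [(load_cost + 3) * (size s).+1]. The exponent [k.+1] leaves room for the linear loading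
   time even when [k] is 0. *)
exists (machine_of q), ((load_cost + 6) + (load_cost + 3) ^ k), k.+1 => s t.
have [_ h1] := hp (rev s); have := h1 [::]; rewrite !cats0 => {}h1.
have [m lm hm] := execs_seq (load_spec s) h1.
have lt : m < t.
  have hk : pw k (sz (rev s)) <= (load_cost + 3) ^ k * (size s).+1 ^ k.
    rewrite /pw -expnMn; case: (k) => // k'; rewrite leq_exp2r //.
    by have := sz_input s; lia.
  have h2 : (load_cost + 3) ^ k * (size s).+1 ^ k <= (load_cost + 3) ^ k * (size s).+1 ^ k.+1.
    by rewrite leq_mul2l expnS leq_pmull ?orbT.
  have h3 : load_cost * size s + 4 <= (load_cost + 4) * (size s).+1 ^ k.+1.
    apply: leq_trans (_ : (load_cost + 4) * (size s).+1 <= _); first by rewrite mulnS mulnDl; lia.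
    by rewrite leq_mul2l expnS leq_pmulr ?orbT // expn_gt0.
  have h4 : (load_cost + 4) * (size s).+1 ^ k.+1 <= (load_cost + 6) * (size s).+1 ^ k.+1.
    by rewrite leq_mul2r leq_add2l orbT.
  rewrite /t mulnDl; lia.
have := machine_of_halts hm lt.
have -> : accepting (ohead (stack_of (main_store (code (enc (f (rev s))))) Main)) = f (rev s).
  by case: (f _).
case: (boolP (f (rev s))) => [/hL hs|/negP hs] hh; split => // hs'.
  by case: hs; exact/hL.
Qed.

(** * Correctness of the decision procedure *)

Lemma lookup_mem (l : seq entry) x : uniq [seq y.1 | y <- l] -> x \in l -> lookup x.1 l = x.2.
Proof.
elim: l => //= y l IH /andP [hy ul]; rewrite inE /lookup /= => /orP [/eqP ->|xl].
  by rewrite eqxx.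
case: eqP => [e|_]; last exact: IH.
by case/negP: hy; rewrite e; apply/mapP; exists x.
Qed.

Lemma keys_ofP (l : seq entry) (ks : seq (seq name)) :
  uniq ks -> reflect (perm_eq [seq x.1 | x <- l] ks) (keys_of l ks).
Proof.
move=> uk; apply: (iffP and3P) => [[u1 /allP h1 /allP h2]|h].
  by apply: uniq_perm => // k; apply/idP/idP => [/h1|/h2].
by split; [rewrite (perm_uniq h)|apply/allP => k /=|apply/allP => k /=]; rewrite ?(perm_mem h).
Qed.

Lemma uniq_pairs (l : seq name) : uniq l ->
  uniq (flatten [seq [seq [:: w; u] | u <- l] | w <- l]).
Proof. by move=> ul; apply: allpairs_uniq => // -[a b] [c d] _ _ [-> ->]. Qed.

Section Checking.
Context {P A S : eqType}.
Variables (codeP : P -> bitseq) (codeA : A -> bitseq) (codeS : S -> bitseq).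
Hypotheses (codeP_bij : bijective codeP) (codeA_bij : bijective codeA) (codeS_bij : bijective codeS).
Local Notation write := (write_formula codeP codeA codeS).
Local Notation polish := (polish codeP codeA codeS).
Implicit Types phi : formula P A S.

Lemma unparse_polish phi : unparse (polish phi) = write phi.
Proof.
suff h st : foldl (reduce [:: Name [::]] wtok) st (rev (polish phi)) = write phi :: st.
  by rewrite /unparse h.
elim: phi st => [p|psi IH|psi IH1 chi IH2|a psi IH|G psi IH|G psi IH|G psi IH|G psi IH
    |B a psi IH|B a psi IH|B a psi IH|b a psi IH] st; first by [].
2: by rewrite /= rev_cons rev_cat foldl_rcons foldl_cat IH2 IH1.
all: rewrite [polish _]/= rev_cons foldl_rcons IH /reduce; congr (_ :: _).
all: by cbn [wtok wtok_kind write_formula fst snd head cat]; rewrite ?name_set_wset.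
Qed.

(** Membership in the language and the listing of agents are conditions on single operators, so they
    can be checked token by token. *)
Lemma all_tok_ok X phi (l : seq A) :
  all (tok_ok X [seq [:: codeA a] | a <- l]) (polish phi) =
  in_lang X phi && all (mem l) (agents phi).
Proof.
have iA := bij_inj codeA_bij; have iS := bij_inj codeS_bij.
have hk a : ([:: codeA a] \in [seq [:: codeA a] | a <- l]) = (a \in l).
  by rewrite (mem_map (f := fun a => [:: codeA a])) // => x y [] /iA.
have hn (T : eqType) (code : T -> bitseq) (G : seq T) : injective code ->
    nonempty_uniq [seq code x | x <- G] = nonempty_set G.
  by move=> ic; rewrite /nonempty_uniq /nonempty_set map_inj_uniq //; case: G.
have ha (G : seq A) : all (fun b => [:: b] \in [seq [:: codeA a] | a <- l]) [seq codeA a | a <- G]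
   = all (mem l) G.
  by rewrite all_map; apply: eq_all => a /=; exact: hk.
elim: phi => [p|psi IH|psi IH1 chi IH2|a psi IH|G psi IH|G psi IH|G psi IH|G psi IH
    |B a psi IH|B a psi IH|B a psi IH|b a psi IH] //=; rewrite /tok_ok /=.
- by rewrite all_cat IH1 IH2 all_cat andbACA.
- by rewrite hk IH andbCA.
- by rewrite hn // ha IH all_cat -!andbA; do !bool_congr.
- by rewrite hn // ha IH all_cat -!andbA; do !bool_congr.
- by rewrite hn // ha IH all_cat -!andbA; do !bool_congr.
- by rewrite hn // ha IH all_cat -!andbA; do !bool_congr.
- by rewrite hn // hk IH -!andbA; do !bool_congr.
- by rewrite hn // hk IH -!andbA; do !bool_congr.
- by rewrite hn // hk IH -!andbA; do !bool_congr.
- by rewrite !hk IH -!andbA; do !bool_congr.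
Qed.

Lemma wf_code_listing (M : model P A S) (codeW : M -> bitseq) (L : listing P A S M) :
  injective codeW -> lists L -> wf_model (code_listing codeP codeA codeS codeW L).
Proof.
move=> iW hL; have iA := bij_inj codeA_bij; have iS := bij_inj codeS_bij; have iP := bij_inj codeP_bij.
have [[ul hw] [hp he] [uc hc] [hq hv]] := hL.
have uw : uniq [seq codeW w | w <- lworlds L] by rewrite map_inj_uniq.
have uv (K V : eqType) (key : K -> seq name) (code : V -> bitseq) (l : seq (K * seq V)) :
    injective code -> (forall k B, (k, B) \in l -> uniq B) -> uniq_values (code_graph key code l).
  move=> ic h; apply/allP => _ /mapP [[k B] hB ->] /=; rewrite map_inj_uniq //; exact: h hB.
have kW : injective (fun w => [:: codeW w]) by move=> x y [] /iW.
have kA : injective (fun a => [:: codeA a]) by move=> x y [] /iA.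
apply/and5P; split => //; last first.
- apply/and5P; split.
  + by rewrite unzip1_code_graph map_inj_uniq.
  + by apply/allP => _ /mapP [x _ ->] /=.
  + by apply: uv iS _ => k B /hc [].
  + apply/keys_ofP; first by rewrite map_inj_uniq // => x y [].
    by rewrite unzip1_code_graph; apply: perm_trans (perm_map _ hq) _; rewrite -map_comp.
  + by apply: uv iP _ => k B /hv [].
- apply/allP => _ /mapP [w _ ->]; apply/allP => _ /mapP [u _ ->]; apply/allP => x hx.
  have [g _ gK] := codeS_bij; move: hx; rewrite -(gK x).
  move=> /(mem_edge codeP codeA codeS_bij iW hL) h; apply/(mem_edge codeP codeA codeS_bij iW hL).
  by rewrite edge_sym.
- by apply: uv iS _ => -[w u] B /he [].
- apply/keys_ofP; first exact: uniq_pairs.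
  rewrite unzip1_code_graph; apply: perm_trans (perm_map _ hp) _.
  have e : [seq [:: w; u] | w <- [seq codeW w | w <- lworlds L], u <- [seq codeW w | w <- lworlds L]]
      = [seq [:: codeW w; codeW u] | w <- lworlds L, u <- lworlds L].
    by rewrite allpairs_mapl allpairs_mapr.
  by rewrite map_allpairs -e.
Qed.

(** A word longer than all words of [l] names a skill that is missing. Consequently no edge read off
    a finite list carries all skills, and [edge_full] holds vacuously in the model built below. *)
Lemma finite_not_setT (l : seq name) : [set s : S | codeS s \in l]%classic <> setT.
Proof.
have [g _ gK] := codeS_bij; pose n := foldr maxn 0 [seq size x | x <- l].
have hn x : x \in l -> size x <= n.
  rewrite {}/n; elim: l => //= y l IH; rewrite inE => /orP [/eqP ->|/IH h]; first exact: leq_maxl.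
  by apply: leq_trans h _; exact: leq_maxr.
move=> e; have : [set s : S | codeS s \in l]%classic (g (nseq n.+1 true)) by rewrite e.
by rewrite /= gK => /hn; rewrite /= size_nseq ltnn.
Qed.

(** The worlds are the names in the text, coded by themselves, and the listing is [pm] decoded.
    Coding it again gives [pm] back, and along the injective codings each clause of [lists] reduces
    to a check made by [wf_model]. *)
Lemma realize_model (pm : pmodel) (x0 : name) : wf_model pm -> x0 \in pm.1 ->
  exists (M : model P A S) (codeW : M -> bitseq) (L : listing P A S M) (w : M),
    [/\ injective codeW, lists L, code_listing codeP codeA codeS codeW L = pm & codeW w = x0].
Proof.
have [dP PK KP] := codeP_bij; have [dA AK KA] := codeA_bij; have [dS SK KS] := codeS_bij.
case: pm => ws [es [cs vs]] /and5P [/= uw kes ues /allP sym].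
move=> /and5P [ucs /allP kcs ucsv kvs uvs] hx0.
move/keys_ofP: kes => /(_ (uniq_pairs uw)) pes.
have uvw : uniq [seq [:: w] | w <- ws] by rewrite map_inj_uniq // => x y [].
move/keys_ofP: kvs => /(_ uvw) pvs.
have uke : uniq [seq x.1 | x <- es] by rewrite (perm_uniq pes); exact: uniq_pairs.
have ukv : uniq [seq x.1 | x <- vs] by rewrite (perm_uniq pvs).
pose W : eqType := {x : name | x \in ws}.
pose w0 : W := exist _ x0 hx0.
pose edge_ (w u : W) := [set s : S | codeS s \in lookup [:: val w; val u] es]%classic.
have edge_sym_ w u : edge_ w u = edge_ u w.
  have sub w1 u1 : (edge_ w1 u1 `<=` edge_ u1 w1)%classic.
    move=> s; rewrite /edge_ /= => hs.
    by have /allP /(_ _ (valP u1)) /allP /(_ _ hs) := sym _ (valP w1).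
  by apply/seteqP; split; exact: sub.
have edge_full_ w u : edge_ w u = setT -> w = u by move/finite_not_setT.
pose M : model P A S := Model (inhabits w0) edge_sym_ edge_full_
  (fun a => [set s : S | codeS s \in lookup [:: codeA a] cs]%classic)
  (fun w : W => [set p : P | codeP p \in lookup [:: val w] vs]%classic).
(* The listing needs a total map from words to worlds; [w0], obtained from [x0], is the default
   outside [ws]. *)
pose i (x : name) : M := insubd w0 x.
have iK x : x \in ws -> val (i x) = x by move=> hx; rewrite /i insubdK.
have vK : cancel (val : W -> name) i by move=> w; exact: valKd.
pose L : listing P A S M := Listing [seq i x | x <- ws]
  [seq (i (head [::] x.1), i (head [::] (behead x.1)), [seq dS b | b <- x.2]) | x <- es]
  [seq (dA (head [::] x.1), [seq dS b | b <- x.2]) | x <- cs]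
  [seq (i (head [::] x.1), [seq dP b | b <- x.2]) | x <- vs].
have eqL : code_listing codeP codeA codeS (val : W -> name) L = (ws, (es, (cs, vs))).
  have hS l : [seq codeS s | s <- [seq dS b | b <- l]] = l.
    by rewrite -map_comp (eq_map (g := id)) ?map_id.
  have hP l : [seq codeP s | s <- [seq dP b | b <- l]] = l.
    by rewrite -map_comp (eq_map (g := id)) ?map_id.
  rewrite /code_listing /L /=; congr (_, (_, (_, _))).
  - by rewrite -map_comp -[RHS]map_id; apply/eq_in_map => x /iK.
  - rewrite /code_graph -map_comp -[RHS]map_id; apply/eq_in_map => -[k B] hk /=.
    have : k \in [seq x.1 | x <- es] by apply/mapP; exists (k, B).
    rewrite (perm_mem pes) => /flattenP [_ /mapP [w hw ->] /mapP [u hu ->]] /=.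
    by rewrite !iK // hS.
  - rewrite /code_graph -map_comp -[RHS]map_id; apply/eq_in_map => -[k B] hk /=.
    by have /= /eqP -> := kcs _ hk; rewrite /= KA hS.
  - rewrite /code_graph -map_comp -[RHS]map_id; apply/eq_in_map => -[k B] hk /=.
    have : k \in [seq x.1 | x <- vs] by apply/mapP; exists (k, B).
    by rewrite (perm_mem pvs) => /mapP [w hw ->] /=; rewrite iK // hP.
exists M, val, L, w0; split => //; first exact: val_inj.
have iW : injective (val : W -> name) := val_inj.
have kW2 : injective (fun wu : W * W => [:: val wu.1; val wu.2]).
  by move=> [a b] [c d] [/val_inj -> /val_inj ->].
have kW1 : injective (fun w : W => [:: val w]) by move=> x y [] /val_inj.
have kA1 : injective (fun a => [:: codeA a]) by move=> x y [] /(can_inj AK).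
have eW : [seq val w | w <- lworlds L] = ws by case: eqL.
have eE : code_graph (fun wu : W * W => [:: val wu.1; val wu.2]) codeS (ledges L) = es by case: eqL.
have eC : code_graph (fun a => [:: codeA a]) codeS (lcaps L) = cs by case: eqL.
have eV : code_graph (fun w : W => [:: val w]) codeP (lvals L) = vs by case: eqL.
split.
- split; first by apply: (@map_uniq _ _ val); rewrite eW.
  by move=> w; rewrite -(vK w); apply: map_f; exact: valP.
- split.
    apply: (perm_map_inj kW2); rewrite -(unzip1_code_graph _ codeS) eE map_allpairs.
    have e : [seq [:: w; u] | w <- [seq val w | w <- lworlds L], u <- [seq val w | w <- lworlds L]]
        = [seq [:: val w; val u] | w <- lworlds L, u <- lworlds L].
      by rewrite allpairs_mapl allpairs_mapr.
    by rewrite -e eW.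
  move=> w u B hB.
  have hB' : ([:: val w; val u], [seq codeS s | s <- B]) \in es by rewrite -eE; apply/mapP; exists (w, u, B).
  split; first by have /= := allP ues _ hB'; rewrite map_inj_uniq //; exact: can_inj SK.
  have := lookup_mem uke hB' => /= e; rewrite /edge_ e.
  by apply/seteqP; split => s /=; rewrite mem_map //; exact: can_inj SK.
- split; first by move: ucs; rewrite -[in X in uniq X]eC unzip1_code_graph map_inj_uniq.
  move=> a B hB.
  have hB' : ([:: codeA a], [seq codeS s | s <- B]) \in cs by rewrite -eC; apply/mapP; exists (a, B).
  split; first by have /= := allP ucsv _ hB'; rewrite map_inj_uniq //; exact: can_inj SK.
  have := lookup_mem ucs hB' => /= e; rewrite e.
  by apply/seteqP; split => s /=; rewrite mem_map //; exact: can_inj SK.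
- split.
    apply: (perm_map_inj kW1); rewrite -(unzip1_code_graph _ codeP) eV.
    have e : [seq [:: w] | w <- [seq val w | w <- lworlds L]] = [seq [:: val w] | w <- lworlds L].
      by rewrite -map_comp.
    by rewrite -e eW.
  move=> w B hB.
  have hB' : ([:: val w], [seq codeP s | s <- B]) \in vs by rewrite -eV; apply/mapP; exists (w, B).
  split; first by have /= := allP uvs _ hB'; rewrite map_inj_uniq //; exact: can_inj PK.
  have := lookup_mem ukv hB' => /= e; rewrite e.
  by apply/seteqP; split => s /=; rewrite mem_map //; exact: can_inj PK.
Qed.

(** From an accepted text a model and a formula are rebuilt. Conversely, any witnesses of membership
    write the same text, and [sat_eval] ties the truth of the formula in them to a computation on
    that text alone. *)
Lemma decideP X s : decide X (rev s) <-> model_checking codeP codeA codeS X s.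
Proof.
have [dP PK KP] := codeP_bij; have [dA AK KA] := codeA_bij; have [dS SK KS] := codeS_bij.
have keys (W : eqType) (codeW : W -> bitseq) (L : listing P A S W) :
    [seq x.1 | x <- (code_listing codeP codeA codeS codeW L).2.2.1]
    = [seq [:: codeA a] | a <- unzip1 (lcaps L)] by exact: unzip1_code_graph.
split=> [/and3P [/eqP es /eqP ets hv]|[M [codeW [L [w [phi [iW hL hX ha [es hs]]]]]]]].
  rewrite revK in es; move: ets hv; case e : (parse_input _) => [pm [x m]] ets /and4P [/= hw hx ht hev].
  have [phi hphi] := unparse_write KP KA KS m.
  (* The text equals its own reprint, whose formula part is the writing of [phi]; parsing it gave
     [m], and parsing the writing of [phi] gives [polish phi]. *)
  have em : m = polish phi.
    move: e; rewrite -{1}ets /write_parsed /= hphi parse_input_write => -[<-].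
    exact: parse_formula_write.
  have [M [codeW [L [w [iW hL eL ew]]]]] := realize_model hw hx.
  move: ht; rewrite -eL keys em all_tok_ok => /andP [hX /allP ha].
  exists M, codeW, L, w, phi; split => //; split.
    by rewrite -es -ets /write_parsed /= hphi -eL wmodel_code_listing -ew.
  by apply/(sat_eval codeP_bij codeA_bij codeS_bij iW hL w hX ha); rewrite eL ew -em.
have el : lex (rev s) = write_input codeP codeA codeS codeW L w phi by rewrite es lex_spell.
have ep : parse_input (lex (rev s)) = (code_listing codeP codeA codeS codeW L, (codeW w, polish phi)).
  by rewrite el /write_input -wmodel_code_listing parse_input_write parse_formula_write.
rewrite /decide ep revK; apply/and3P; split.
- by rewrite el -es.
- by rewrite el /write_parsed /= unparse_polish wmodel_code_listing.
apply/and4P; split.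
- exact: wf_code_listing.
- exact: mem_worlds.
- rewrite -[all _ _]/(all (tok_ok X [seq x.1 | x <- (code_listing codeP codeA codeS codeW L).2.2.1])
    (polish phi)).
  by rewrite keys all_tok_ok hX; apply/allP.
- exact/(sat_eval codeP_bij codeA_bij codeS_bij iW hL w hX ha).
Qed.

End Checking.

Theorem theorem10 (P A S : eqType)
    (codeP : P -> bitseq) (codeA : A -> bitseq) (codeS : S -> bitseq)
    (codeP_bij : bijective codeP) (codeA_bij : bijective codeA)
    (codeS_bij : bijective codeS) (X : {pred op}) :
  inP (model_checking codeP codeA codeS X).
Proof. by apply: polyfun_inP (pf_decide X) _ => s; exact: decideP. Qed.
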